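(* Let $1<p_0\le p<\infty$ and let $M\in\mathscr{M}_{p,p_0}(\mathbb{M}_m)$ be an $m\times m$ matrix-valued multiplier on $\mathbb{R}^n$. If there exist $v^{+},v^{-}\in\mathbb{R}^n$ such that $M(v^{+})=\delta^{+}U$ and $M(v^{-})=\delta^{-}U$, where $U$ is a unitary matrix and $\delta^{+}>\delta^{-}$ are real numbers, then $$\|T_M\|_{L^p(\mathbb{R}^n,\mathbb{C}^m)\to L^{p_0}(\mathbb{R}^n,\mathbb{C}^m)}\ \ge\ \|T_{\widetilde M}\|_{L^p(\mathbb{T}^n,\mathbb{C}^m)\to L^{p_0}(\mathbb{T}^n,\mathbb{C}^m)}\ \ge\ \frac{UMD_{p,p_0}(\mathbb{C}^m)}{\frac{2}{\delta^+-\delta^-}\left(1+\frac{|\delta^++\delta^-|}{|\delta^+|+|\delta^-|}\right)} .$$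
   Context: $\mathscr{M}_{p,p_0}(\mathbb{M}_m)$ is the collection of $m\times m$ matrix-valued multipliers $M$ on $\mathbb{R}^n$ whose entries are bounded functions that are real, even, continuous (except possibly at zero) and homogeneous of order zero ($M(\lambda\xi)=M(\xi)$ for $\lambda>0$, $\xi\ne0$). Being a multiplier means that $T_Mf=(M\widehat f\,)^\vee$ (Fourier transform and its inverse taken componentwise, considered for $f:\mathbb{R}^n\to\mathbb{C}^m$ with Schwartz components) is bounded from $L^p(\mathbb{R}^n,\mathbb{C}^m)$ to $L^{p_0}(\mathbb{R}^n,\mathbb{C}^m)$. $\mathbb{T}^n=[-\pi,\pi)^n$ carries normalized Lebesgue measure. The discrete multiplier $\widetilde M$ is obtained by restricting $M$ to $\mathbb{Z}^n$, and its operator is $(T_{\widetilde M}f)(\theta)=\sum_{k\in\mathbb{Z}^n}M(k)\widehat f(k)e^{i(k,\theta)}$, considered for $\mathbb{C}^m$-valued trigonometric polynomials $f$ on $\mathbb{T}^n$. $L^q$ norms of $\mathbb{C}^m$-valued functions are formed with the Euclidean norm on $\mathbb{C}^m$, and the norms of $T_M$ and $T_{\widetilde M}$ are the operator norms between the indicated spaces. Definition of $UMD_{p,p_0}(X)$ for a Banach space $X$: let $(r_k)_{k\ge0}$ be the Rademacher sequence on $[0,1)$ (independent, uniformly distributed $\pm1$-valued). Then $$UMD_{p,p_0}(X)=\sup\frac{\left\|\sum_{k=1}^N\beta_k\,d_k(r_0,\dots,r_{k-1})\,r_k\right\|_{L^{p_0}([0,1),X)}}{\left\|\sum_{k=1}^N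 d_k(r_0,\dots,r_{k-1})\,r_k\right\|_{L^p([0,1),X)}},$$ the supremum being over all $N\ge1$, all $\beta_1,\dots,\beta_N\in\{\pm1\}$, and all Bochner integrable $d_k:\{\pm1\}^k\to X$ for which the denominator is nonzero. Here $X=\mathbb{C}^m$ with the Euclidean norm.
   Formalization: It is additionally assumed that M(0) is a convex combination of values M(ξ), ξ≠0; with M(0) left arbitrary, the first inequality fails (a huge M(0) makes the norm of the discrete operator exceed that of T_M, which does not see M(0)). *)

(* Defs.v *)
From HB Require Import structures.
From mathcomp Require Import all_boot all_order all_algebra.
From mathcomp Require Import complex.
From mathcomp Require Import all_classical all_reals all_analysis.
Set Implicit Arguments.
Unset Strict Implicit.
Unset Printing Implicit Defensive.
Import Order.TTheory GRing.Theory Num.Theory.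
Import numFieldNormedType.Exports.
Local Open Scope classical_set_scope.
Local Open Scope ring_scope.

Section tuple_measure.
Context d (T : measurableType d) (R : realType).
Variable nu : {sigma_finite_measure set T -> \bar R}.
Local Open Scope ereal_scope.

Definition tuple_cons n (z : T * n.-tuple T) : n.+1.-tuple T :=
  [tuple of z.1 :: z.2].

Lemma measurable_tuple_cons n :
  measurable_fun [set: T * n.-tuple T] (@tuple_cons n).
Proof. exact: measurable_cons. Qed.

Section cons_measure.
Variables (n : nat) (mu : {sigma_finite_measure set (n.-tuple T) -> \bar R}).

Definition cons_measure : set (n.+1.-tuple T) -> \bar R :=
  pushforward (nu \x mu) (@tuple_cons n).

HB.instance Definition _ := Measure.copy cons_measure
  (measure_function_pushforward__canonical__measure_function_Measure
    (nu \x mu) (@measurable_tuple_cons n)).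

Lemma cons_measureX (A : set T) (B : set (n.-tuple T)) :
  measurable A -> measurable B ->
  cons_measure [set t | A (thead t) /\ B [tuple of behead t]] = nu A * mu B.
Proof.
move=> mA mB; rewrite /cons_measure /pushforward -product_measure1E//.
congr (_ _); apply/seteqP; split => -[x t] /=; rewrite theadE.
- move=> [Ax Bt]; split => //=.
  by rewrite (_ : t = [tuple of behead (tuple_cons (x, t))])//; apply/val_inj.
- move=> [Ax Bt]; split => //=.
  by rewrite (_ : [tuple of behead (tuple_cons (x, t))] = t)//; apply/val_inj.
Qed.

Let sigma_finite_cons_measure : sigma_finite [set: n.+1.-tuple T] cons_measure.
Proof.
have /sigma_finiteP[F [TF ndF Foo]] := sigma_finiteT nu.
have /sigma_finiteP[G [TG ndG Goo]] := sigma_finiteT mu.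
exists (fun k => [set t | F k (thead t) /\ G k [tuple of behead t]]).
  apply/esym/seteqP; split => // t _.
  have : [set: T] (thead t) by [].
  rewrite TF => -[i _ Fi].
  have : [set: n.-tuple T] [tuple of behead t] by [].
  rewrite TG => -[j _ Gj].
  exists (maxn i j) => //; split.
  - by move: (thead t) Fi; exact/subsetPset/ndF/leq_maxl.
  - by move: [tuple of behead t] Gj; exact/subsetPset/ndG/leq_maxr.
move=> k; have [mF Fk] := Foo k; have [mG Gk] := Goo k; split.
  have -> : [set t | F k (thead t) /\ G k [tuple of behead t]] =
      ((fun t : n.+1.-tuple T => tnth t ord0) @^-1` F k) `&`
      ((fun t : n.+1.-tuple T => [tuple of behead t]) @^-1` G k) by [].
  apply: measurableI; rewrite -[X in measurable X]setTI.
  - by apply: measurable_tnth.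
  - by apply: measurable_behead.
by rewrite cons_measureX// lte_mul_pinfty// ge0_fin_numE.
Qed.

HB.instance Definition _ := Measure_isSigmaFinite.Build _ _ _ cons_measure
  sigma_finite_cons_measure.

End cons_measure.

Fixpoint tuple_measure n : {sigma_finite_measure set (n.-tuple T) -> \bar R} :=
  match n with
  | 0 => \d_([tuple])
  | n'.+1 => cons_measure (tuple_measure n')
  end.

Lemma tuple_measure_box n (A : 'I_n -> set T) :
  (forall i, measurable (A i)) ->
  tuple_measure n [set t | forall i, A i (tnth t i)] = \prod_(i < n) nu (A i).
Proof.
elim: n A => [A _|n IH A mA].
  rewrite big_ord0 /= diracE mem_set//= => -[]//.
rewrite big_ord_recl -IH//.
rewrite -cons_measureX//; last first.
  have -> : [set t : n.-tuple T | forall i, A (lift ord0 i) (tnth t i)] =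
      \big[setI/setT]_(i < n) ((fun t => tnth t i) @^-1` A (lift ord0 i)).
    rewrite -bigcap_seq; apply/seteqP; split => [t At i _|t At i]; first exact: At.
    by apply: (At i); rewrite /= mem_index_enum.
  apply: big_ind => //; first by move=> *; exact: measurableI.
  by move=> i _; rewrite -[X in measurable X]setTI; exact: measurable_tnth.
congr (cons_measure _ _); apply/seteqP; split => t /=.
  move=> At; split; first exact: At.
  by move=> i; have := At (lift ord0 i); rewrite {1}(tuple_eta t) tnthS.
move=> [At0 At] i; case: (unliftP ord0 i) => [j ->|->//].
by rewrite (tuple_eta t) tnthS.
Qed.

End tuple_measure.

Section euclidean.
Variables (R : realType) (n : nat).

Definition lebesgue_Rn : {sigma_finite_measure set (n.-tuple (measurableTypeR R)) -> \bar R} :=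
  tuple_measure (@lebesgue_measure R) n.

(* The topology, the linear structure and derivatives live on row vectors, the
   sigma-algebra and the measure on tuples. *)
Definition row_of (t : n.-tuple (measurableTypeR R)) : 'rV[R]_n := \row_i tnth t i.

Definition dotr (x y : 'rV[R]_n) : R := \sum_(i < n) x 0 i * y 0 i.

Definition cube : set (n.-tuple (measurableTypeR R)) := [set t | forall i, tnth t i \in `[- pi, pi[].

Lemma measurable_cube : measurable cube.
Proof.
have -> : cube =
    \big[setI/setT]_(i < n) ((fun t => tnth t i) @^-1` [set` `[- pi, pi[]).
  rewrite -bigcap_seq; apply/seteqP; split => [t At i _|t At i]; first exact: At.
  by apply: (At i); rewrite /= mem_index_enum.
apply: big_ind => //; first by move=> *; exact: measurableI.
move=> i _; rewrite -[X in measurable X]setTI; exact: measurable_tnth.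
Qed.

Lemma cube_scale_ge0 : 0 <= ((2 * pi) ^- n : R).
Proof. by rewrite invr_ge0 exprn_ge0// mulr_ge0// pi_ge0. Qed.

(* normalized Lebesgue measure on [-pi, pi)^n, as a measure on R^n *)
Definition torus_measure : {measure set (n.-tuple (measurableTypeR R)) -> \bar R} :=
  mscale (NngNum cube_scale_ge0) (mrestr lebesgue_Rn measurable_cube).

End euclidean.

Section complex_valued.
Variable R : realType.
Local Notation C := R[i].

Definition cis (x : R) : C := (cos x +i* sin x)%C.

Definition Cintegral d (T : measurableType d) (mu : {measure set T -> \bar R})
    (f : T -> C) : C :=
  ((\int[mu]_x complex.Re (f x)) +i* (\int[mu]_x complex.Im (f x)))%C.

Definition euclid m (v : 'cV[C]_m) : R :=
  Num.sqrt (\sum_(j < m) (complex.Re (v j 0) ^+ 2 + complex.Im (v j 0) ^+ 2)).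

Definition LpNorm d (T : measurableType d) (mu : {measure set T -> \bar R})
    m (p : R) (f : T -> 'cV[C]_m) : \bar R :=
  Lnorm mu p%:E (fun x => (euclid (f x))%:E).

Definition mxC m (A : 'M[R]_m) : 'M[C]_m := map_mx (real_complex R) A.

End complex_valued.

Section multiplier_Rn.
Variables (R : realType) (n m : nat).
Local Notation C := R[i].

Definition fourier (f : 'rV[R]_n -> 'cV[C]_m) (xi : 'rV[R]_n) : 'cV[C]_m :=
  \col_j Cintegral (lebesgue_Rn R n)
    (fun t => f (row_of t) j 0 * cis (- dotr (row_of t) xi)).

Definition inv_fourier (g : 'rV[R]_n -> 'cV[C]_m) (x : 'rV[R]_n) : 'cV[C]_m :=
  \col_j (((2 * pi) ^- n)%:C%C * Cintegral (lebesgue_Rn R n)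
    (fun t => g (row_of t) j 0 * cis (dotr x (row_of t)))).

Definition mult_op (M : 'rV[R]_n -> 'M[R]_m) (f : 'rV[R]_n -> 'cV[C]_m) :
    'rV[R]_n -> 'cV[C]_m :=
  inv_fourier (fun xi => mxC (M xi) *m fourier f xi).

Definition partials (s : seq 'I_n) (g : 'rV[R]_n -> R) : 'rV[R]_n -> R :=
  foldr (fun i h => 'D_(delta_mx 0 i) h) g s.

Definition schwartz (g : 'rV[R]_n -> R) : Prop :=
  forall s : seq 'I_n,
    (forall x, differentiable (partials s g) x) /\
    (forall k : nat, exists B : R, forall x,
       (1 + `|x|) ^+ k * `|partials s g x| <= B).

Definition schwartz_vec (f : 'rV[R]_n -> 'cV[C]_m) : Prop :=
  forall j, schwartz (fun x => complex.Re (f x j 0)) /\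
            schwartz (fun x => complex.Im (f x j 0)).

Definition norm_Rn (p : R) (f : 'rV[R]_n -> 'cV[C]_m) : \bar R :=
  LpNorm (lebesgue_Rn R n) p (f \o @row_of R n).

Definition mult_norm (p p0 : R) (M : 'rV[R]_n -> 'M[R]_m) : \bar R :=
  ereal_sup [set norm_Rn p0 (mult_op M f) / norm_Rn p f | f in
    [set f | schwartz_vec f /\ norm_Rn p f != 0]]%E.

Record is_multiplier (p p0 : R) (M : 'rV[R]_n -> 'M[R]_m) : Prop := {
  mult_bounded : exists B : R, forall xi i j, `|M xi i j| <= B ;
  mult_even : forall xi, M (- xi) = M xi ;
  mult_continuous : forall i j xi, xi != 0 ->
    {for xi, continuous (fun x => M x i j)} ;
  mult_homogeneous : forall (l : R) xi, 0 < l -> xi != 0 ->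
    M (l *: xi) = M xi ;
  mult_Lp_bounded : (mult_norm p p0 M < +oo)%E }.

(* M is discontinuous at the origin unless it is constant off it, so M(0) has no
   canonical value, and it does not affect [mult_op M]. It is however a term of
   the restriction of M to Z^n, and de Leeuw's comparison of the two operators
   fails for an arbitrary M(0) (M = 0 off the origin and M(0) = 1). The values
   M(0) that arise from regularizing M in that comparison, such as the mean of M
   over the sphere, are the convex combinations of values of M off the origin
   (their set is compact, hence so is its convex hull). *)
Definition averaged_at_0 (M : 'rV[R]_n -> 'M[R]_m) : Prop :=
  exists (s : nat) (w : 'I_s -> R) (xi : 'I_s -> 'rV[R]_n),
    [/\ forall i, 0 <= w i, \sum_i w i = 1, forall i, xi i != 0 &
        M 0 = \sum_i w i *: M (xi i)].

End multiplier_Rn.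

Section multiplier_torus.
Variables (R : realType) (n m : nat).
Local Notation C := R[i].

Definition lattice (k : 'rV[int]_n) : 'rV[R]_n := map_mx intr k.

Definition trig_poly (f : 'rV[R]_n -> 'cV[C]_m) : Prop :=
  exists (K : seq 'rV[int]_n) (c : 'rV[int]_n -> 'cV[C]_m),
    forall x, f x = \sum_(k <- K) cis (dotr (lattice k) x) *: c k.

Definition fourier_coef (f : 'rV[R]_n -> 'cV[C]_m) (k : 'rV[int]_n) :
    'cV[C]_m :=
  \col_j Cintegral (torus_measure R n)
    (fun t => f (row_of t) j 0 * cis (- dotr (lattice k) (row_of t))).

(* [\sum_(k \in _)] is a finite-support sum; the Fourier coefficients of a
   trigonometric polynomial have finite support. *)
Definition disc_mult_op (M : 'rV[R]_n -> 'M[R]_m) (f : 'rV[R]_n -> 'cV[C]_m)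
    (x : 'rV[R]_n) : 'cV[C]_m :=
  \sum_(k \in [set: 'rV[int]_n])
    cis (dotr (lattice k) x) *: (mxC (M (lattice k)) *m fourier_coef f k).

Definition norm_Tn (p : R) (f : 'rV[R]_n -> 'cV[C]_m) : \bar R :=
  LpNorm (torus_measure R n) p (f \o @row_of R n).

Definition disc_mult_norm (p p0 : R) (M : 'rV[R]_n -> 'M[R]_m) : \bar R :=
  ereal_sup [set norm_Tn p0 (disc_mult_op M f) / norm_Tn p f | f in
    [set f | trig_poly f /\ norm_Tn p f != 0]]%E.

End multiplier_torus.

Section UMD.
Variables (R : realType) (m : nat).
Local Notation C := R[i].

Definition unit_itv_measure : {measure set (measurableTypeR R) -> \bar R} :=
  mrestr (@lebesgue_measure R) (measurable_itv `[0, 1[).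

Definition rademacher (k : nat) (t : R) : R :=
  (-1) ^+ Num.truncn (2 ^+ k.+1 * t).

(* [d k] is only ever evaluated at the {-1, 1}-valued vector
   (r_0(t), ..., r_(k-1)(t)). *)
Definition martingale_sum (N : nat) (beta : nat -> R)
    (d : forall k : nat, ('I_k -> R) -> 'cV[C]_m) (t : R) : 'cV[C]_m :=
  \sum_(1 <= k < N.+1)
    (beta k * rademacher k t)%:C%C *: d k (fun j => rademacher j t).

Definition UMD (p p0 : R) : \bar R :=
  ereal_sup [set q | exists (N : nat) (beta : nat -> R)
      (d : forall k : nat, ('I_k -> R) -> 'cV[C]_m),
    let den := LpNorm unit_itv_measure p (martingale_sum N (fun=> 1) d) in
    [/\ (1 <= N)%N, forall k, beta k = 1 \/ beta k = -1, den != 0%E &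
        q = (LpNorm unit_itv_measure p0 (martingale_sum N beta d) / den)%E]].

End UMD.

(* Main.v *)
(* The discrete operator is bounded by the continuous one as in de Leeuw's theorem:
   M is applied to the product of a trigonometric polynomial P(. + y), with
   frequencies shifted by a small multiple of a direction xi0, and a Gaussian which
   is much wider than the inverse of the shift. The result is close to the product of
   the discrete operator applied to P(. + y) and the Gaussian, with M(0) replaced by
   M(xi0), and integrating over y in the torus separates the two factors. M(0) being
   an average of the M(xi0), the bound follows by convexity. For p0 < p the same
   comparison, in which the Gaussian factors now have different scalings, shows that
   M = 0, which contradicts the hypothesis on M(vp) and M(vm).

   For p0 = p, transference by psi = y + (u_0.theta, ..., u_N.theta), where the u_j
   are lattice vectors of rapidly increasing length pointing nearly in the directions
   v_j, shows that on the torus of dimension N + 1 multiplying the frequencies whose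
   last nonzero coordinate has index k by M(v_k) is bounded by the norm K of the
   discrete operator. Signs of cosines on this torus are distributed as Rademacher
   functions and are limits of polynomials in the cosines with odd frequencies, so
   that the martingale transform with coefficients M(v_k) is bounded by K too.
   Choosing v_k among vp and vm gives coefficients delta_k U with delta_k among dp and
   dm; U does not change norms, the transform by beta_k is a combination of the one by
   delta_k and the identity, and |dp|, |dm| <= K by taking delta_k constant. *)
Require Import Defs.
From mathcomp Require Import all_boot all_order all_algebra.
From mathcomp Require Import complex.
From mathcomp Require Import all_classical all_reals all_analysis.
From mathcomp Require Import measurable_realfun.
From mathcomp Require Import zify ring lra.
Set Implicit Arguments.
Unset Strict Implicit.
Unset Printing Implicit Defensive.
Import Order.TTheory GRing.Theory Num.Theory.
Import numFieldNormedType.Exports.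
Local Open Scope classical_set_scope.
Local Open Scope ring_scope.

(** * Product measures and the torus *)

(** The comparison on [R^n] has an error that is small uniformly in space, which says nothing in
    [L^p] of a space of infinite measure. It is therefore subtracted inside a positive part: only
    truncated powers are estimated, and Fatou's lemma restores the full ones. Under periodization
    the side of the operator scales like the inverse of a volume factor and the other side like its
    power [- p0 / p]; for equal exponents the factors cancel, and for [p0 < p] the limit is 0. In
    the second transference the symbol at a frequency is read off its last nonzero coordinate. This
    dictates odd polynomials for the signs: multiplied by functions of the earlier coordinates they
    keep an odd, hence nonzero, entry at their own index. The entry may be negative, and evenness of
    [M] absorbs the sign. The dependence of [d_k] on the past is written with interpolation weights,
    affine in each sign, so that it survives the passage from signs to polynomials. The shape of the
    constant is due to [|dp| + |dm| <= 2 K]: it converts the multiple of the identity, which carries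
    no factor [K], into one that does. *)

Section tuple_integration.
Context d (T : measurableType d) (R : realType).
Variable nu : {sigma_finite_measure set T -> \bar R}.
Local Open Scope ereal_scope.

Lemma ge0_integral_tuple0 (f : 0%N.-tuple T -> \bar R) :
  measurable_fun [set: 0%N.-tuple T] f -> \int[tuple_measure nu 0]_t f t = f [tuple].
Proof. by move=> mf; rewrite integral_dirac// diracT mul1e. Qed.

Lemma ge0_integral_tupleS n (f : n.+1.-tuple T -> \bar R) :
  measurable_fun setT f -> (forall t, 0 <= f t) ->
  \int[tuple_measure nu n.+1]_t f t =
  \int[nu]_x \int[tuple_measure nu n]_t f (tuple_cons (x, t)).
Proof.
move=> mf f0.
rewrite [LHS](_ : _ = \int[pushforward (nu \x tuple_measure nu n) (@tuple_cons _ T n)]_t f t)//.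
rewrite ge0_integral_pushforward//; last exact: measurable_tuple_cons.
rewrite preimage_setT fubini_tonelli1//; last by move=> z; exact: f0.
by apply: measurableT_comp => //; exact: measurable_tuple_cons.
Qed.

Lemma measurable_map_tuple n (g : 'I_n -> T -> T) :
  (forall i, measurable_fun setT (g i)) ->
  measurable_fun setT (fun t : n.-tuple T => [tuple g i (tnth t i) | i < n]).
Proof.
move=> mg; apply/measurable_fun_tnthP => i.
rewrite (_ : _ \o _ = (fun t => g i (tnth t i))); last first.
  by apply/funext => t /=; rewrite tnth_mktuple.
by apply: measurableT_comp => //; exact: measurable_tnth.
Qed.

(** Induction with Tonelli in the first coordinate: each coordinate change [g i] contributes one
    factor [c]. The instances are rotations of the circle, with [c = 1], and affine maps of the
    line, with [c] the inverse of the slope. *)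
Lemma ge0_integral_map_tuple n (g : 'I_n -> T -> T) (c : \bar R)
    (f : n.-tuple T -> \bar R) :
  (forall i, measurable_fun setT (g i)) -> 0 <= c ->
  (forall i (h : T -> \bar R), measurable_fun setT h -> (forall x, 0 <= h x) ->
    \int[nu]_x h (g i x) = c * \int[nu]_x h x) ->
  measurable_fun setT f -> (forall t, 0 <= f t) ->
  \int[tuple_measure nu n]_t f [tuple g i (tnth t i) | i < n] =
  c ^+ n * \int[tuple_measure nu n]_t f t.
Proof.
move=> + c0; elim: n g f => [|n IH] g f mg hg mf f0.
  rewrite !ge0_integral_tuple0//; last first.
    by apply: measurableT_comp => //; exact: measurable_map_tuple.
  by rewrite expe0 mul1e; congr f; apply: eq_from_tnth => -[].
have mfg : measurable_fun setT (fun t => f [tuple g i (tnth t i) | i < n.+1]).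
  by apply: measurableT_comp => //; exact: measurable_map_tuple.
rewrite ge0_integral_tupleS// ge0_integral_tupleS//.
have mfc x : measurable_fun setT (fun t => f (tuple_cons (x, t))).
  by apply: measurableT_comp => //; apply: (measurableT_comp (@measurable_tuple_cons _ T n)).
have E x t : [tuple g i (tnth (tuple_cons (x, t)) i) | i < n.+1] =
    tuple_cons (g ord0 x, [tuple g (lift ord0 i) (tnth t i) | i < n]).
  apply: eq_from_tnth => i; rewrite tnth_mktuple.
  case: (unliftP ord0 i) => [j ->|->]; last by rewrite !tnth0.
  by rewrite !tnthS tnth_mktuple.
transitivity (\int[nu]_x (c ^+ n *
    \int[tuple_measure nu n]_t f (tuple_cons (g ord0 x, t)))).
  apply: eq_integral => x _; under eq_integral do rewrite E.
  apply: (IH (fun i => g (lift ord0 i)) (fun t => f (tuple_cons (g ord0 x, t)))) => //.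
  by move=> i h mh h0; exact: hg.
rewrite ge0_integralZl//; first last.
- exact: expe_ge0.
- by move=> x _; exact: integral_ge0.
- have mF : measurable_fun setT (fun x => \int[tuple_measure nu n]_t f (tuple_cons (x, t))).
    apply: (measurable_fun_fubini_tonelli_F (fun z => f (tuple_cons z))) => //.
    by apply: measurableT_comp => //; exact: measurable_tuple_cons.
  by apply: (measurableT_comp mF).
rewrite (hg ord0 (fun x => \int[tuple_measure nu n]_t f (tuple_cons (x, t)))).
- by rewrite expeS muleCA muleA.
- apply: (measurable_fun_fubini_tonelli_F (fun z => f (tuple_cons z))) => //.
  by apply: measurableT_comp => //; exact: measurable_tuple_cons.
- by move=> x; exact: integral_ge0.
Qed.

End tuple_integration.

Section lebesgue_affine.
Variable R : realType.
Local Notation mu := (@lebesgue_measure R).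
Local Open Scope ereal_scope.

Definition affine (b t : R) : measurableTypeR R -> measurableTypeR R :=
  fun x => (b + t * x)%R.

Lemma measurable_affine b t : measurable_fun setT (affine b t).
Proof. by apply: measurable_funD => //; exact: measurable_funM. Qed.

Lemma ge0_integral_affine (b t : R) (h : measurableTypeR R -> \bar R) :
  (0 < t)%R -> measurable_fun setT h -> (forall x, 0 <= h x) ->
  \int[mu]_x h (affine b t x) = t^-1%:E * \int[mu]_x h x.
Proof.
move=> t0 mh h0.
have t0' : (0 <= t)%R by exact: ltW.
pose ps := pushforward mu (affine b t).
pose psm := measure_function_pushforward__canonical__measure_function_Measure mu (measurable_affine b t).
pose m2 : {measure set (measurableTypeR R) -> \bar R} := mscale (NngNum t0') psm.
(* Lebesgue measure is [t] times its image under the affine map, by uniqueness of the measure giving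
   each interval []x, y]] its length. *)
have E A : measurable A -> mu A = m2 A.
  apply: lebesgue_measure_unique => _ [[x y]] _ <- /=.
  rewrite /m2 /= /mscale /= /pushforward.
  rewrite (_ : affine b t @^-1` [set` `]x, y]] = [set` `]((x - b) / t)%R, ((y - b) / t)%R]]); last first.
    apply/seteqP; split => z /=; rewrite /affine !in_itv/= ltr_pdivrMr// ler_pdivlMr//;
      by rewrite ltrBlDl lerBrDl mulrC.
  rewrite !lebesgue_measure_itv/= !lte_fin ltr_pM2r ?invr_gt0// ltrD2r.
  case: ifPn => _; last by rewrite mule0.
  by rewrite -EFinB -EFinM; congr EFin; field; rewrite gt_eqF.
rewrite [in RHS](eq_measure_integral m2) => [|A mA _]; last exact: E.
rewrite ge0_integral_mscale//= muleA -EFinM mulVf ?gt_eqF// mul1e.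
by rewrite ge0_integral_pushforward//; exact: measurable_affine.
Qed.

Lemma ge0_integral_shift_itv (a c b : R) (h : measurableTypeR R -> \bar R) :
  measurable_fun setT h -> (forall x, 0 <= h x) ->
  \int[mu]_(x in `[a, c[) h (b + x)%R = \int[mu]_(x in `[(b + a)%R, (b + c)%R[) h x.
Proof.
move=> mh h0; rewrite [LHS]integral_mkcond [RHS]integral_mkcond.
have := @ge0_integral_affine b 1 (h \_ `[(b + a)%R, (b + c)%R[) ltr01.
rewrite invr1 mul1e => <-.
- apply: eq_integral => x _; rewrite !patchE /affine mul1r.
  by rewrite !mem_setE/= !in_itv/= lerD2l ltrD2l.
- by apply/(measurable_restrictT _ _).1 => //; exact: measurable_funTS.
- by move=> x; apply: erestrict_ge0.
Qed.

End lebesgue_affine.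

Section circle.
Variable R : realType.
Local Notation mu := (@lebesgue_measure R).

Lemma ltNpp : - pi < pi :> R.
Proof. by rewrite gtrN ?pi_gt0. Qed.

(** Uniform on the closed interval; the endpoint [pi] is a null set, so that integrals may be taken
    over the half-open one. *)
Definition circle : {sigma_finite_measure set (measurableTypeR R) -> \bar R} :=
  uniform_prob ltNpp.

(** The representative of [x] modulo [2 pi] in [[-pi, pi)], which turns rotations into maps of this
    interval to itself. *)
Definition wrap (x : R) : measurableTypeR R :=
  x - 2 * pi * (Num.floor ((x + pi) / (2 * pi)))%:~R.

Let tpi_gt0 : 0 < 2 * pi :> R.
Proof. by rewrite mulr_gt0// pi_gt0. Qed.

Lemma measurable_wrap : measurable_fun [set: measurableTypeR R] wrap.
Proof.
apply: measurable_funB => //; apply: measurable_funM => //.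
apply: nondecreasing_measurable => // x y xy.
by rewrite ler_int; apply: le_floor; rewrite ler_pM2r ?invr_gt0// lerD2r.
Qed.

Lemma wrap_id x : - pi <= x < pi -> wrap x = x.
Proof.
move=> /andP[x1 x2]; rewrite /wrap (_ : Num.floor _ = 0) ?mulr0 ?subr0//.
apply/eqP; rewrite floor_eq add0r divr_ge0 ?(ltW tpi_gt0)//=; last lra.
by rewrite ltr_pdivrMr//; lra.
Qed.

Lemma wrapD x (k : int) : wrap (x + 2 * pi * k%:~R) = wrap x.
Proof.
rewrite /wrap [X in Num.floor X](_ : _ = (x + pi) / (2 * pi) + k%:~R); last first.
  by move: (pi : R) (pi_gt0 R) => P P0; field; rewrite gt_eqF.
rewrite floorDrz ?intr_int// intrKfloor intrD; ring.
Qed.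

Lemma wrapE x : exists k : int, wrap x = x + 2 * pi * k%:~R.
Proof.
exists (- Num.floor ((x + pi) / (2 * pi))); by rewrite /wrap mulrNz mulrN.
Qed.

Local Open Scope ereal_scope.

Lemma integral_circle (h : measurableTypeR R -> \bar R) :
  measurable_fun setT h -> (forall x, 0 <= h x) ->
  \int[circle]_x h x = (2 * pi)^-1%:E * \int[mu]_(x in `[(- pi)%R, pi[) h x.
Proof.
move=> mh h0; rewrite -[LHS]/(\int[uniform_prob ltNpp]_x h x) integral_uniform//.
rewrite opprK -mulr2n mulr_natl.
by rewrite -!integral_itv_bndo_bndc//; exact: measurable_funTS.
Qed.

(** Rotation invariance. With [b] reduced to [b'] in [[0, 2 pi)], the translated interval
    [[b' - pi, b' + pi)] is cut at [pi] and its right piece is moved back by [2 pi], which [wrap]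
    does not see. *)
Lemma ge0_integral_wrap (b : R) (h : measurableTypeR R -> \bar R) :
  measurable_fun setT h -> (forall x, 0 <= h x) ->
  \int[circle]_x h (wrap (b + x)%R) = \int[circle]_x h x.
Proof.
move=> mh h0.
have mH : measurable_fun setT (fun x => h (wrap x)).
  by apply: measurableT_comp => //; exact: measurable_wrap.
have mHb (c : R) : measurable_fun [set: R] (fun x : R => h (wrap (c + x)%R)).
  by apply: (measurableT_comp mH); exact: measurable_funD.
rewrite integral_circle; [|exact: (mHb b)|by []].
rewrite integral_circle; [|by []|by []].
congr (_ * _).
pose b' := (b - 2 * pi * (Num.floor (b / (2 * pi)))%:~R)%R.
have b'0 : (0 <= b' < 2 * pi)%R.
  have := floor_itv (b / (2 * pi))%R.
  rewrite ler_pdivlMr// ltr_pdivrMr// intrD => /andP[h1 h2].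
  rewrite /b'; apply/andP; split; lra.
transitivity (\int[mu]_(x in `[(- pi)%R, pi[) h (wrap (b' + x)%R)).
  apply: eq_integral => x _; congr (h _); rewrite -(@wrapD (b' + x)%R (Num.floor (b / (2 * pi)))).
  by congr wrap; rewrite /b'; ring.
rewrite (@ge0_integral_shift_itv _ _ _ b' (fun x => h (wrap x)))//.
have b1 : (b' + - pi <= pi)%R by move: b'0 => /andP[_]; lra.
have b2 : (pi <= b' + pi)%R by move: b'0 => /andP[+ _]; lra.
have b3 : (- pi <= b' + - pi)%R by move: b'0 => /andP[+ _]; lra.
rewrite (@itv_bndbnd_setU _ _ (BLeft (b' + - pi)%R) (BLeft pi) (BLeft (b' + pi)%R))//.
rewrite ge0_integral_setU//=; first last.
- apply/disj_set2P/seteqP; split => // x /= [].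
  by rewrite !in_itv/= => /andP[_ + /andP[]]; rewrite ltNge => /negbTE ->.
- exact: measurable_funTS.
rewrite (_ : `[pi, (b' + pi)%R[ = `[(2 * pi + - pi)%R, (2 * pi + (b' + - pi))%R[)%classic; last first.
  have -> : (2 * pi - pi = pi :> R)%R by lra.
  by have -> : (2 * pi + (b' - pi) = b' + pi)%R by lra.
rewrite -(@ge0_integral_shift_itv _ _ _ _ (fun x => h (wrap x)))//.
under [X in _ + X]eq_integral => x _.
  rewrite (_ : (2 * pi + x = x + 2 * pi * 1%:~R)%R); last by ring.
  rewrite wrapD; over.
rewrite addeC -ge0_integral_setU//=; first last.
- apply/disj_set2P/seteqP; split => // x /= [].
  by rewrite !in_itv/= => /andP[_ + /andP[]]; rewrite ltNge => /negbTE ->.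
- exact: measurable_funTS.
rewrite -(@itv_bndbnd_setU _ _ (BLeft (- pi)%R) (BLeft (b' + - pi)%R) (BLeft pi))//.
apply: eq_integral => x; rewrite inE/= in_itv/= => xpi.
by rewrite wrap_id.
Qed.

Lemma circle_setT : circle setT = 1.
Proof. exact: probability_setT. Qed.

End circle.

Section torus.
Variable R : realType.
Local Open Scope ereal_scope.

(** An iterated product, to which induction on the dimension and Tonelli apply directly, whereas
    [torus_measure] restricts Lebesgue measure to the cube and rescales it. The two agree by
    [torus_measureE]. *)
Definition torus n : {sigma_finite_measure set (n.-tuple (measurableTypeR R)) -> \bar R} :=
  tuple_measure (circle R) n.

Let measurable_indic_cube n : measurable_fun [set: n.-tuple (measurableTypeR R)]
  (fun t : n.-tuple (measurableTypeR R) => (\1_(@cube R n) t)%:E : \bar R).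
Proof.
apply/measurable_EFinP; apply: measurable_indic; exact: measurable_cube.
Qed.

Lemma ge0_integral_torus n (f : n.-tuple (measurableTypeR R) -> \bar R) :
  measurable_fun setT f -> (forall t, 0 <= f t) ->
  \int[torus n]_t f t =
  ((2 * pi) ^- n)%:E * \int[lebesgue_Rn R n]_t (f t * (\1_(@cube R n) t)%:E).
Proof.
elim: n f => [|n IH] f mf f0.
  rewrite /torus !ge0_integral_tuple0//; last first.
    by apply: emeasurable_funM => //; exact: measurable_indic_cube.
  rewrite expr0 invr1 mul1e indicE mem_set ?mule1// => -[]//.
have mfc x : measurable_fun setT (fun t : n.-tuple (measurableTypeR R) => f (tuple_cons (x, t))).
  by apply: measurableT_comp => //; apply: (measurableT_comp (@measurable_tuple_cons _ _ n)).
have mfi : measurable_fun setT (fun t => f t * (\1_(@cube R n.+1) t)%:E).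
  by apply: emeasurable_funM => //; exact: measurable_indic_cube.
rewrite /torus /lebesgue_Rn !ge0_integral_tupleS//; last first.
  by move=> t; rewrite mule_ge0// lee_fin.
have mF : measurable_fun setT (fun x => \int[tuple_measure (circle R) n]_t f (tuple_cons (x, t))).
  apply: (measurable_fun_fubini_tonelli_F (fun z => f (tuple_cons z))) => //.
  by apply: measurableT_comp => //; exact: measurable_tuple_cons.
have mG : measurable_fun setT (fun x : measurableTypeR R =>
    \int[lebesgue_Rn R n]_t (f (tuple_cons (x, t)) * (\1_(@cube R n) t)%:E)).
  apply: (measurable_fun_fubini_tonelli_F
    (fun z => f (tuple_cons z) * (\1_(@cube R n) z.2)%:E)) => //.
    apply: emeasurable_funM.
      by apply: measurableT_comp => //; exact: measurable_tuple_cons.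
    apply: (measurableT_comp (@measurable_indic_cube n)) => //.
  by move=> z; rewrite mule_ge0// lee_fin.
rewrite integral_circle; [|exact: mF|by move=> x; exact: integral_ge0].
have -> : ((2 * pi) ^- n.+1 = (2 * pi)^-1 * (2 * pi) ^- n :> R)%R.
  by rewrite exprS [LHS]invfM.
rewrite [in RHS]EFinM -[RHS]muleA; congr (_ * _).
rewrite -ge0_integralZl//; first last.
- by rewrite lee_fin invr_ge0 exprn_ge0// mulr_ge0// pi_ge0.
- by move=> x _; apply: integral_ge0 => t _; rewrite mule_ge0// lee_fin.
- apply: (measurable_fun_fubini_tonelli_F
    (fun z => f (tuple_cons z) * (\1_(@cube R n.+1) (tuple_cons z))%:E)) => //.
    by apply: (measurableT_comp mfi); exact: measurable_tuple_cons.
  by move=> z; rewrite mule_ge0// lee_fin.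
rewrite [LHS]integral_mkcond; apply: eq_integral => x _; rewrite patchE.
case: ifPn => xpi.
  rewrite -/(torus n) IH//; congr (_ * _).
  apply: eq_integral => t _; congr (_ * (_ : R)%:E).
  rewrite !indicE; congr ((_ : bool)%:R); apply/idP/idP; rewrite !inE => H.
    move=> i; case: (unliftP ord0 i) => [j ->|->]; first by rewrite tnthS; exact: H.
    by rewrite tnth0; move: xpi; rewrite inE.
  by move=> i; have := H (lift ord0 i); rewrite tnthS.
rewrite (_ : (fun t => _) = cst 0) ?integral0 ?mule0//.
apply/funext => t; rewrite indicE memNset ?mule0//= => H.
by move/negP: xpi; apply; rewrite inE; have := H ord0; rewrite tnth0.
Qed.

Lemma torus_measureE n A : measurable A -> torus_measure R n A = torus n A.
Proof.
move=> mA; have -> : torus n A = \int[torus n]_t (\1_A t)%:E.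
  by rewrite integral_indic// setIT.
rewrite ge0_integral_torus; [|exact/measurable_EFinP/measurable_indic|by []].
transitivity (((2 * pi) ^- n)%:E * lebesgue_Rn R n (A `&` @cube R n)); first by [].
congr (_ * _).
under eq_integral => t _ do rewrite -EFinM -[(_ * _)%R]/((\1_A \* \1_(@cube R n))%R t) -indicI.
rewrite integral_indic ?setIT//; apply: measurableI => //; exact: measurable_cube.
Qed.

Lemma integral_torus_measure n (f : n.-tuple (measurableTypeR R) -> \bar R) :
  \int[torus_measure R n]_t f t = \int[torus n]_t f t.
Proof. by apply: eq_measure_integral => A mA _; exact: torus_measureE. Qed.

Lemma torus_setT n : torus n setT = 1.
Proof.
have := @tuple_measure_box _ _ _ (circle R) n (fun=> setT) (fun=> measurableT).
rewrite (_ : [set t | _] = setT); last by apply/seteqP; split.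
by move=> ->; rewrite big1// => i _; rewrite circle_setT.
Qed.

Lemma ge0_integral_wrapt n (b : 'I_n -> R) (f : n.-tuple (measurableTypeR R) -> \bar R) :
  measurable_fun setT f -> (forall t, 0 <= f t) ->
  \int[torus n]_t f [tuple wrap (b i + tnth t i)%R | i < n] =
  \int[torus n]_t f t.
Proof.
move=> mf f0.
have := @ge0_integral_map_tuple _ _ R (circle R) n (fun i x => wrap (b i + x)%R) 1 f.
rewrite -[X in X ^+ n]/(1%:E) -EFin_expe expr1n mul1e; apply => //.
- move=> i; apply: (measurableT_comp (@measurable_wrap R)).
  exact: measurable_funD.
- by move=> i h mh h0; rewrite mul1e ge0_integral_wrap.
Qed.

Lemma ge0_integral_affine_tuple n (b : 'I_n -> R) (s : R) (f : n.-tuple (measurableTypeR R) -> \bar R) :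
  (0 < s)%R -> measurable_fun setT f -> (forall t, 0 <= f t) ->
  \int[lebesgue_Rn R n]_t f [tuple affine (b i) s (tnth t i) | i < n] =
  (s ^- n)%:E * \int[lebesgue_Rn R n]_t f t.
Proof.
move=> s0 mf f0.
have := @ge0_integral_map_tuple _ _ R (@lebesgue_measure R) n (fun i => affine (b i) s) (s^-1)%:E f.
rewrite -EFin_expe exprVn; apply => //.
- by move=> i; exact: measurable_affine.
- by rewrite lee_fin invr_ge0 ltW.
- by move=> i h mh h0; rewrite ge0_integral_affine.
Qed.

End torus.

(** * Complex vectors and integrals *)

Section euclid_norm.
Variables (R : realType) (m : nat).
Local Notation C := R[i].
Implicit Types (u v : 'cV[C]_m) (z w : C).

Definition sqn z : R := complex.Re z ^+ 2 + complex.Im z ^+ 2.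

Lemma sqn_ge0 z : 0 <= sqn z.
Proof. by rewrite addr_ge0// sqr_ge0. Qed.

Lemma sqnM z w : sqn (z * w) = sqn z * sqn w.
Proof. by case: z w => [a b] [c d]; rewrite /sqn /=; ring. Qed.

Lemma sqn_real (r : R) : sqn r%:C%C = r ^+ 2.
Proof. by rewrite /sqn /= expr0n addr0. Qed.

Lemma sqn_cis x : sqn (cis x : C) = 1.
Proof. by rewrite /sqn /= cos2Dsin2. Qed.

Lemma euclid_ge0 v : 0 <= euclid v.
Proof. exact: sqrtr_ge0. Qed.

Lemma sqr_euclid v : euclid v ^+ 2 = \sum_j sqn (v j 0).
Proof. by rewrite sqr_sqrtr// sumr_ge0// => j _; exact: sqn_ge0. Qed.

Lemma euclid0 : euclid (0 : 'cV[C]_m) = 0.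
Proof.
by rewrite /euclid big1 ?sqrtr0// => j _; rewrite mxE /= expr0n addr0.
Qed.

Lemma euclid_eq0 v : euclid v = 0 -> v = 0.
Proof.
move=> /(congr1 (fun x => x ^+ 2)); rewrite sqr_euclid expr0n /= => /eqP.
rewrite psumr_eq0; last by move=> j _; exact: sqn_ge0.
move=> /allP vj0; apply/matrixP => j k; rewrite ord1 mxE.
have := vj0 j (mem_index_enum _); rewrite /= /sqn.
by rewrite paddr_eq0 ?sqr_ge0// !sqrf_eq0; case: (v j 0) => a b /= /andP[/eqP -> /eqP ->].
Qed.

Lemma euclidZ z v : euclid (z *: v) = Num.sqrt (sqn z) * euclid v.
Proof.
rewrite /euclid -sqrtrM ?sqn_ge0// mulr_sumr; congr Num.sqrt.
by apply: eq_bigr => j _; rewrite mxE -!/(sqn _) sqnM.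
Qed.

Lemma euclidZr (r : R) v : euclid (r%:C%C *: v) = `|r| * euclid v.
Proof. by rewrite euclidZ sqn_real sqrtr_sqr. Qed.

Lemma euclid_cis x v : euclid (cis x *: v) = euclid v.
Proof. by rewrite euclidZ sqn_cis sqrtr1 mul1r. Qed.

Let rdot u v : R := \sum_j (complex.Re (u j 0) * complex.Re (v j 0) +
  complex.Im (u j 0) * complex.Im (v j 0)).

Let sqr_euclid_lin (a b : R) u v :
  euclid (a%:C%C *: u + b%:C%C *: v) ^+ 2 =
  a ^+ 2 * euclid u ^+ 2 + b ^+ 2 * euclid v ^+ 2 + 2 * (a * b) * rdot u v.
Proof.
rewrite !sqr_euclid !mulr_sumr -!big_split /=; apply: eq_bigr => j _.
rewrite !mxE; case: (u j 0) (v j 0) => [c d] [e f].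
by rewrite /sqn /=; ring.
Qed.

(** Cauchy-Schwarz in [R^(2m)], from the nonnegativity of the squared norm of [|v|^2 u - <u, v> v],
    which is [|v|^2 (|u|^2 |v|^2 - <u, v>^2)]. *)
Let rdot_le u v : rdot u v <= euclid u * euclid v.
Proof.
have [v0|v0] := eqVneq (euclid v) 0.
  rewrite v0 mulr0 (euclid_eq0 v0) /rdot big1// => j _.
  by rewrite mxE /= !mulr0 addr0.
have vp : 0 < euclid v by rewrite lt0r v0 euclid_ge0.
have := sqr_ge0 (euclid ((euclid v ^+ 2)%:C%C *: u + (- rdot u v)%:C%C *: v)).
rewrite sqr_euclid_lin; set A := euclid u; set B := euclid v; set D := rdot u v => H.
have H2 : 0 <= B ^+ 2 * (A ^+ 2 * B ^+ 2 - D ^+ 2).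
  by apply: le_trans H _; rewrite le_eqVlt; apply/orP; left; apply/eqP; ring.
rewrite pmulr_rge0 ?exprn_gt0// subr_ge0 -exprMn in H2.
have AB0 : 0 <= A * B by rewrite mulr_ge0 ?euclid_ge0.
by rewrite (le_trans (ler_norm _))// -(ler_pXn2r (ltn0Sn 1)) ?nnegrE// ?real_normK ?num_real.
Qed.

Lemma euclidD u v : euclid (u + v) <= euclid u + euclid v.
Proof.
rewrite -(ler_pXn2r (ltn0Sn 1)) ?nnegrE ?addr_ge0 ?euclid_ge0//.
have := sqr_euclid_lin 1 1 u v; rewrite !scale1r => ->.
have := rdot_le u v; set A := euclid u; set B := euclid v; set D := rdot u v => H.
rewrite -subr_ge0; rewrite (_ : _ - _ = 2 * (A * B - D)); last by ring.
by rewrite mulr_ge0// subr_ge0.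
Qed.

Lemma euclid_sum (I : Type) (r : seq I) (P : pred I) (f : I -> 'cV[C]_m) :
  euclid (\sum_(i <- r | P i) f i) <= \sum_(i <- r | P i) euclid (f i).
Proof.
elim/big_rec2 : _ => [|i y x _ IH]; first by rewrite euclid0.
by rewrite (le_trans (euclidD _ _))// lerD2l.
Qed.

Lemma euclidN v : euclid (- v) = euclid v.
Proof.
rewrite -scaleN1r (_ : -1 = (-1 : R)%:C%C); last by rewrite rmorphN1.
by rewrite euclidZr normrN1 mul1r.
Qed.

Lemma euclidB_le u v : `|euclid u - euclid v| <= euclid (u - v).
Proof.
rewrite ler_norml; apply/andP; split.
  rewrite lerNl opprB -(euclidN (u - v)) opprB lerBlDr.
  by rewrite (le_trans _ (euclidD _ _))// subrK.
by rewrite lerBlDr (le_trans _ (euclidD _ _))// subrK.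
Qed.

Lemma euclid_le_sum v :
  euclid v <= \sum_j (`|complex.Re (v j 0)| + `|complex.Im (v j 0)|).
Proof.
suff [h0 h] : 0 <= \sum_j (`|complex.Re (v j 0)| + `|complex.Im (v j 0)|) /\
    \sum_j sqn (v j 0) <= (\sum_j (`|complex.Re (v j 0)| + `|complex.Im (v j 0)|)) ^+ 2.
  by rewrite -(ler_pXn2r (ltn0Sn 1)) ?nnegrE ?euclid_ge0// sqr_euclid.
elim/big_rec2 : _ => [|j y x _ [x0 IH]]; first by rewrite expr0n.
split; first by rewrite !addr_ge0.
rewrite /sqn -(real_normK (num_real (complex.Re _))) -(real_normK (num_real (complex.Im _))).
by have := normr_ge0 (complex.Re (v j 0)); have := normr_ge0 (complex.Im (v j 0)); nra.
Qed.

(** The squared norm is the entry of [w^* w]. Membership in [unitarymx] gives [U U^* = 1], and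
    [U^* U = 1] follows because [U] is square. *)
Lemma euclid_unitary (U : 'M[C]_m) v : U \is unitarymx -> euclid (U *m v) = euclid v.
Proof.
have E (w : 'cV[C]_m) : (euclid w ^+ 2)%:C%C = (map_mx Num.conj w^T *m w) 0 0.
  rewrite sqr_euclid rmorph_sum mxE; apply: eq_bigr => j _.
  rewrite !mxE; case: (w j 0) => a b; rewrite /sqn /=.
  by apply/eqP; rewrite eq_complex /=; apply/andP; split; apply/eqP; ring.
move=> /unitarymxP UU; have UU' : map_mx Num.conj U^T *m U = 1%:M by exact: mulmx1C.
suff : (euclid (U *m v) ^+ 2)%:C%C = (euclid v ^+ 2)%:C%C.
  move=> /(congr1 (@complex.Re R)) /= /eqP.
  by rewrite eqrXn2 ?euclid_ge0// => /eqP.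
by rewrite !E trmx_mul map_mxM mulmxA -(mulmxA (map_mx _ v^T)) UU' mulmx1.
Qed.

End euclid_norm.

Section real_product.
Context d1 d2 (T1 : measurableType d1) (T2 : measurableType d2) (R : realType).
Variable m1 : {sigma_finite_measure set T1 -> \bar R}.
Variable m2 : {sigma_finite_measure set T2 -> \bar R}.
Variables (f : T1 -> R) (g : T2 -> R).
Hypothesis fi : m1.-integrable setT (EFin \o f).
Hypothesis gi : m2.-integrable setT (EFin \o g).

Let mf : measurable_fun setT f.
Proof. by apply/measurable_EFinP; exact: measurable_int fi. Qed.

Let mg : measurable_fun setT g.
Proof. by apply/measurable_EFinP; exact: measurable_int gi. Qed.

Let mfg : measurable_fun setT (fun z : T1 * T2 => (f z.1 * g z.2)%:E).
Proof.
apply/measurable_EFinP; apply: measurable_funM.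
- by apply: (measurableT_comp mf); exact: measurable_fst.
- by apply: (measurableT_comp mg); exact: measurable_snd.
Qed.

Lemma integrable_prodM :
  (m1 \x m2)%E.-integrable setT (fun z : T1 * T2 => (f z.1 * g z.2)%:E).
Proof.
apply/integrable12ltyP => //.
have -> : (\int[m1]_x \int[m2]_y `|(f (x, y).1 * g (x, y).2)%:E| =
    \int[m1]_x (`|(f x)%:E| * \int[m2]_y `|(g y)%:E|))%E.
  apply: eq_integral => x _ /=; rewrite -ge0_integralZl//.
  - by apply: eq_integral => y _; rewrite normrM EFinM.
  - by apply/measurable_EFinP; exact: measurableT_comp.
rewrite ge0_integralZr//; last 2 first.
- by apply/measurable_EFinP; exact: measurableT_comp.
- exact: integral_ge0.
apply: lte_mul_pinfty.
- exact: integral_ge0.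
- rewrite ge0_fin_numE; last exact: integral_ge0.
  by have /integrableP[] := fi.
- by have /integrableP[] := gi.
Qed.

Lemma Rintegral_prodM : \int[(m1 \x m2)%E]_z (f z.1 * g z.2) =
  (\int[m1]_x f x) * (\int[m2]_y g y).
Proof.
rewrite {1}/Rintegral -integral12_prod_meas1; last exact: integrable_prodM.
rewrite (_ : (\int[m1]_x fubini_F _ _ x)%E = (\int[m1]_x ((f x)%:E * (\int[m2]_y g y)%:E))%E).
  rewrite integralZr// fineM//; last exact: integrable_fin_num.
apply: eq_integral => x _; rewrite /fubini_F /=.
under eq_integral do rewrite EFinM.
by rewrite integralZl// /Rintegral fineK//; exact: integrable_fin_num.
Qed.

End real_product.

Section complex_integral.
Context d (T : measurableType d) (R : realType).
Variable mu : {measure set T -> \bar R}.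
Local Notation C := R[i].
Implicit Types (f g : T -> C).

Definition Cmeasurable f := measurable_fun setT (fun x => complex.Re (f x)) /\
  measurable_fun setT (fun x => complex.Im (f x)).

Definition Cintegrable f :=
  mu.-integrable setT (EFin \o (fun x => complex.Re (f x))) /\
  mu.-integrable setT (EFin \o (fun x => complex.Im (f x))).

Lemma Cintegrable_measurable f : Cintegrable f -> Cmeasurable f.
Proof. by move=> [h1 h2]; split; apply/measurable_EFinP; [exact: measurable_int h1|exact: measurable_int h2]. Qed.

Lemma le_Cintegrable f (g : T -> R) : Cmeasurable f ->
  mu.-integrable setT (EFin \o g) -> (forall x, sqn (f x) <= g x ^+ 2) ->
  (forall x, 0 <= g x) -> Cintegrable f.
Proof.
move=> [h1 h2] gi fg g0; split; apply: le_integrable gi => //.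
- exact/measurable_EFinP.
- move=> x _ /=; rewrite lee_fin (ger0_norm (g0 x)).
  rewrite -(ler_pXn2r (ltn0Sn 1)) ?nnegrE// real_normK ?num_real//.
  by rewrite (le_trans _ (fg x))// lerDl sqr_ge0.
- exact/measurable_EFinP.
- move=> x _ /=; rewrite lee_fin (ger0_norm (g0 x)).
  rewrite -(ler_pXn2r (ltn0Sn 1)) ?nnegrE// real_normK ?num_real//.
  by rewrite (le_trans _ (fg x))// lerDr sqr_ge0.
Qed.

Lemma CmeasurableM f g : Cmeasurable f -> Cmeasurable g -> Cmeasurable (fun x => f x * g x).
Proof.
move=> [f1 f2] [g1 g2]; split.
- rewrite (_ : (fun x => _) = (fun x => complex.Re (f x) * complex.Re (g x) - complex.Im (f x) * complex.Im (g x))).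
    by apply: measurable_funB; exact: measurable_funM.
  by apply/funext => x; case: (f x) (g x) => [a b] [c e].
- rewrite (_ : (fun x => _) = (fun x => complex.Re (f x) * complex.Im (g x) + complex.Im (f x) * complex.Re (g x))).
    by apply: measurable_funD; exact: measurable_funM.
  by apply/funext => x; case: (f x) (g x) => [a b] [c e].
Qed.

Lemma CmeasurableD f g : Cmeasurable f -> Cmeasurable g -> Cmeasurable (fun x => f x + g x).
Proof.
move=> [f1 f2] [g1 g2]; split.
- rewrite (_ : (fun x => _) = (fun x => complex.Re (f x) + complex.Re (g x))).
    exact: measurable_funD.
  by apply/funext => x; case: (f x) (g x) => [a b] [c e].
- rewrite (_ : (fun x => _) = (fun x => complex.Im (f x) + complex.Im (g x))).
    exact: measurable_funD.
  by apply/funext => x; case: (f x) (g x) => [a b] [c e].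
Qed.

Lemma Cmeasurable_cst (c : C) : Cmeasurable (fun=> c).
Proof. by split; exact: measurable_cst. Qed.

Lemma Cmeasurable_sum (I : Type) (r : seq I) (F : I -> T -> C) :
  (forall i, Cmeasurable (F i)) -> Cmeasurable (fun x => \sum_(i <- r) F i x).
Proof.
move=> mF; elim: r => [|i r IH].
  by under eq_fun do rewrite big_nil; exact: Cmeasurable_cst.
by under eq_fun do rewrite big_cons; exact: CmeasurableD.
Qed.

Lemma Cmeasurable_cis (h : T -> R) : measurable_fun setT h ->
  Cmeasurable (fun x => cis (h x)).
Proof.
move=> mh; split => /=; apply: measurableT_comp mh.
- by apply: continuous_measurable_fun; exact: continuous_cos.
- by apply: continuous_measurable_fun; exact: continuous_sin.
Qed.

Lemma Cmeasurable_real (h : T -> R) : measurable_fun setT h ->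
  Cmeasurable (fun x => (h x)%:C%C).
Proof. by move=> mh; split => //=; exact: measurable_cst. Qed.

Lemma CintegrableD f g : Cintegrable f -> Cintegrable g -> Cintegrable (fun x => f x + g x).
Proof.
move=> [f1 f2] [g1 g2]; split.
- rewrite (_ : _ \o _ = (EFin \o (fun x => complex.Re (f x))) \+ (EFin \o (fun x => complex.Re (g x))))%E.
    exact: integrableD.
  by apply/funext => x /=; case: (f x) (g x) => [a b] [c e].
- rewrite (_ : _ \o _ = (EFin \o (fun x => complex.Im (f x))) \+ (EFin \o (fun x => complex.Im (g x))))%E.
    exact: integrableD.
  by apply/funext => x /=; case: (f x) (g x) => [a b] [c e].
Qed.

Lemma CintegralD f g : Cintegrable f -> Cintegrable g ->
  Cintegral mu (fun x => f x + g x) = Cintegral mu f + Cintegral mu g.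
Proof.
move=> [f1 f2] [g1 g2]; apply/eqP; rewrite eq_complex /=; apply/andP; split; apply/eqP.
- rewrite -RintegralD//; apply: eq_Rintegral => x _.
  by case: (f x) (g x) => [a b] [c e].
- rewrite -RintegralD//; apply: eq_Rintegral => x _.
  by case: (f x) (g x) => [a b] [c e].
Qed.

Let integrable_lin (a b : R) (u v : T -> R) :
  mu.-integrable setT (EFin \o u) -> mu.-integrable setT (EFin \o v) ->
  mu.-integrable setT (EFin \o (fun x => a * u x + b * v x)).
Proof.
move=> ui vi.
rewrite (_ : _ \o _ = (fun x => a%:E * (EFin \o u) x) \+ (fun x => b%:E * (EFin \o v) x))%E//.
by apply: integrableD => //; exact: integrableZl.
Qed.

Let Rintegral_lin (a b : R) (u v : T -> R) :
  mu.-integrable setT (EFin \o u) -> mu.-integrable setT (EFin \o v) ->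
  \int[mu]_x (a * u x + b * v x) = a * (\int[mu]_x u x) + b * (\int[mu]_x v x).
Proof.
move=> ui vi; rewrite RintegralD//.
- by rewrite !RintegralZl.
- by rewrite (_ : _ \o _ = (fun x => a%:E * (EFin \o u) x)%E)//; exact: integrableZl.
- by rewrite (_ : _ \o _ = (fun x => b%:E * (EFin \o v) x)%E)//; exact: integrableZl.
Qed.

Lemma CintegrableZ (c : C) f : Cintegrable f -> Cintegrable (fun x => c * f x).
Proof.
move=> [f1 f2]; split.
- rewrite (_ : _ \o _ = EFin \o (fun x => complex.Re c * complex.Re (f x) + (- complex.Im c) * complex.Im (f x))).
    exact: integrable_lin.
  by apply/funext => x /=; case: c (f x) => [a b] [e h] /=; rewrite mulNr.
- rewrite (_ : _ \o _ = EFin \o (fun x => complex.Re c * complex.Im (f x) + complex.Im c * complex.Re (f x))).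
    exact: integrable_lin.
  by apply/funext => x /=; case: c (f x) => [a b] [e h].
Qed.

Lemma CintegralZ (c : C) f : Cintegrable f ->
  Cintegral mu (fun x => c * f x) = c * Cintegral mu f.
Proof.
move=> [f1 f2]; case: c => a b.
apply/eqP; rewrite eq_complex /=; apply/andP; split; apply/eqP.
- rewrite -mulNr -Rintegral_lin//; apply: eq_Rintegral => x _.
  by case: (f x) => e h /=; rewrite mulNr.
- rewrite -Rintegral_lin//; apply: eq_Rintegral => x _.
  by case: (f x) => e h.
Qed.

Lemma Cintegrable0 : Cintegrable (fun=> 0).
Proof. by split; exact: integrable0. Qed.

Lemma Cintegral0 : Cintegral mu (fun=> 0) = 0.
Proof.
by apply/eqP; rewrite eq_complex /= /Rintegral integral0 /= eqxx.
Qed.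

Lemma Cintegrable_sum (I : Type) (r : seq I) (F : I -> T -> C) :
  (forall i, Cintegrable (F i)) -> Cintegrable (fun x => \sum_(i <- r) F i x).
Proof.
move=> iF; elim: r => [|i r IH].
  by under eq_fun do rewrite big_nil; exact: Cintegrable0.
by under eq_fun do rewrite big_cons; exact: CintegrableD.
Qed.

Lemma Cintegral_sum (I : Type) (r : seq I) (F : I -> T -> C) :
  (forall i, Cintegrable (F i)) ->
  Cintegral mu (fun x => \sum_(i <- r) F i x) = \sum_(i <- r) Cintegral mu (F i).
Proof.
move=> iF; elim: r => [|i r IH].
  by under eq_fun do rewrite big_nil; rewrite big_nil Cintegral0.
under eq_fun do rewrite big_cons; rewrite CintegralD ?big_cons ?IH//.
exact: Cintegrable_sum.
Qed.

Lemma eq_Cintegral f g : f =1 g -> Cintegral mu f = Cintegral mu g.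
Proof. by move=> /funext ->. Qed.

Lemma ae_eq0_Cintegral f :
  Cmeasurable f -> (\int[mu]_x (sqn (f x))%:E = 0)%E -> Cintegral mu f = 0.
Proof.
move=> [f1 f2] f0.
have ms : measurable_fun setT (fun x => (sqn (f x))%:E : \bar R).
  by apply/measurable_EFinP/measurable_funD; exact: measurable_funX.
have : (\int[mu]_x `|(sqn (f x))%:E| = 0)%E.
  rewrite -f0; apply: eq_integral => x _.
  by rewrite gee0_abs// lee_fin sqn_ge0.
move=> /(ae_eq_integral_abs mu measurableT ms) aef.
have z1 : (\int[mu]_x (complex.Re (f x))%:E = 0)%E.
  rewrite (ae_eq_integral (cst 0%E))// ?integral0//; first exact/measurable_EFinP.
  apply: filterS aef => x /(_ Logic.I) /= [] /eqP.
  by rewrite paddr_eq0 ?sqr_ge0// !sqrf_eq0 => /andP[/eqP -> _].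
have z2 : (\int[mu]_x (complex.Im (f x))%:E = 0)%E.
  rewrite (ae_eq_integral (cst 0%E))// ?integral0//; first exact/measurable_EFinP.
  apply: filterS aef => x /(_ Logic.I) /= [] /eqP.
  by rewrite paddr_eq0 ?sqr_ge0// !sqrf_eq0 => /andP[_ /eqP ->].
by rewrite /Cintegral /Rintegral z1 z2.
Qed.

End complex_integral.

Section complex_product.
Context d (T : measurableType d) (R : realType).
Variable nu : {sigma_finite_measure set T -> \bar R}.
Local Notation C := R[i].

Lemma Cintegral_prodM d2 (T2 : measurableType d2)
    (m2 : {sigma_finite_measure set T2 -> \bar R}) (f : T -> C) (g : T2 -> C) :
  Cintegrable nu f -> Cintegrable m2 g ->
  Cintegrable (nu \x m2)%E (fun z => f z.1 * g z.2) /\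
  Cintegral (nu \x m2)%E (fun z => f z.1 * g z.2) = Cintegral nu f * Cintegral m2 g.
Proof.
move=> [f1 f2] [g1 g2].
have i11 := integrable_prodM f1 g1; have i22 := integrable_prodM f2 g2.
have i12 := integrable_prodM f1 g2; have i21 := integrable_prodM f2 g1.
have E1 : (fun z : T * T2 => complex.Re (f z.1 * g z.2)) =
  (fun z => complex.Re (f z.1) * complex.Re (g z.2) - complex.Im (f z.1) * complex.Im (g z.2)).
  by apply/funext => z; case: (f z.1) (g z.2) => [a b] [c e].
have E2 : (fun z : T * T2 => complex.Im (f z.1 * g z.2)) =
  (fun z => complex.Re (f z.1) * complex.Im (g z.2) + complex.Im (f z.1) * complex.Re (g z.2)).
  by apply/funext => z; case: (f z.1) (g z.2) => [a b] [c e].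
split.
  split; rewrite ?E1 ?E2.
  - by apply: (integrableB _ i11 i22).
  - by apply: (integrableD _ i12 i21).
apply/eqP; rewrite eq_complex /=; apply/andP; split; apply/eqP.
- rewrite E1 RintegralB//; congr (_ - _); exact: Rintegral_prodM.
- rewrite E2 RintegralD//; congr (_ + _); exact: Rintegral_prodM.
Qed.

Lemma Cintegral_pushforward d2 (T2 : measurableType d2) (phi : T -> T2)
    (mphi : measurable_fun setT phi) (mu : {measure set T -> \bar R})
    (f : T2 -> C)
    (pm := measure_function_pushforward__canonical__measure_function_Measure mu mphi) :
  Cmeasurable f -> Cintegrable mu (f \o phi) ->
  Cintegrable pm f /\ Cintegral pm f = Cintegral mu (f \o phi).
Proof.
move=> [/measurable_EFinP mf1 /measurable_EFinP mf2] [if1 if2]; split.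
  by split; apply: integrable_pushforward => //; rewrite preimage_setT.
have e1 : (\int[pm]_x (complex.Re (f x))%:E = \int[mu]_x (complex.Re (f (phi x)))%:E)%E.
  exact: (integral_pushforward mphi mf1 if1 measurableT).
have e2 : (\int[pm]_x (complex.Im (f x))%:E = \int[mu]_x (complex.Im (f (phi x)))%:E)%E.
  exact: (integral_pushforward mphi mf2 if2 measurableT).
by rewrite /Cintegral /Rintegral e1 e2.
Qed.

End complex_product.

Section complex_tuple.
Context d (T : measurableType d) (R : realType).
Variable nu : {sigma_finite_measure set T -> \bar R}.
Local Notation C := R[i].

Lemma Cmeasurable_prod_tuple n (phi : 'I_n -> T -> C) :
  (forall i, Cmeasurable (phi i)) ->
  Cmeasurable (fun t : n.-tuple T => \prod_(i < n) phi i (tnth t i)).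
Proof.
move=> mphi.
have mi i : Cmeasurable (fun t : n.-tuple T => phi i (tnth t i)).
  by split; [apply: measurableT_comp (mphi i).1 _|apply: measurableT_comp (mphi i).2 _]; exact: measurable_tnth.
elim: (index_enum _) => [|i r IH].
  by under eq_fun do rewrite big_nil; exact: Cmeasurable_cst.
by under eq_fun do rewrite big_cons; exact: CmeasurableM.
Qed.

Lemma Cintegral_prod_tuple n (phi : 'I_n -> T -> C) :
  (forall i, Cintegrable nu (phi i)) ->
  Cintegrable (tuple_measure nu n) (fun t => \prod_(i < n) phi i (tnth t i)) /\
  Cintegral (tuple_measure nu n) (fun t => \prod_(i < n) phi i (tnth t i)) =
  \prod_(i < n) Cintegral nu (phi i).
Proof.
elim: n phi => [|n IH] phi iphi.
  under eq_fun do rewrite big_ord0; rewrite big_ord0.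
  have E (r : R) : (\int[tuple_measure nu 0]_x r%:E = r%:E)%E.
    by rewrite integral_dirac// diracT mul1e.
  split.
    split; apply/integrableP; split => //=; first exact: measurable_cst.
      by rewrite (E `|1|) ltry.
      exact: measurable_cst.
      by rewrite (E `|0|) ltry.
  by rewrite /Cintegral /Rintegral /= !E.
have [IH1 IH2] := IH (fun i => phi (lift ord0 i)) (fun i => iphi _).
have [P1 P2] := Cintegral_prodM (iphi ord0) IH1.
have mF := @Cmeasurable_prod_tuple n.+1 phi (fun i => Cintegrable_measurable (iphi i)).
have E : (fun t : n.+1.-tuple T => \prod_(i < n.+1) phi i (tnth t i)) \o (@tuple_cons _ T n) =
  (fun z => phi ord0 z.1 * \prod_(i < n) phi (lift ord0 i) (tnth z.2 i)).
  apply/funext => -[x t] /=; rewrite big_ord_recl tnth0; congr (_ * _).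
  by apply: eq_bigr => i _; rewrite tnthS.
have iF : Cintegrable (nu \x tuple_measure nu n)%E
    ((fun t : n.+1.-tuple T => \prod_(i < n.+1) phi i (tnth t i)) \o (@tuple_cons _ T n)).
  by rewrite E.
have [Q1 Q2] := Cintegral_pushforward (@measurable_tuple_cons _ T n) mF iF.
by split; [exact: Q1|rewrite big_ord_recl -IH2 -P2 -E; exact: Q2].
Qed.

End complex_tuple.

(** * The Fourier transform of Gaussians *)

Section gaussian.
Variable R : realType.
Local Notation mu := (@lebesgue_measure R).

Implicit Types s x u c : R.

Definition gauss (s x : R) : R := expR (- (s * x ^+ 2)).

Lemma gauss_gt0 s x : 0 < gauss s x.
Proof. exact: expR_gt0. Qed.

Lemma gauss_ge0 s x : 0 <= gauss s x.
Proof. exact: expR_ge0. Qed.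

Lemma measurable_gauss s : measurable_fun [set: measurableTypeR R] (gauss s : measurableTypeR R -> R).
Proof.
apply: measurableT_comp => //; apply: measurable_funN.
by apply: measurable_funM => //; exact: measurable_funX.
Qed.

Lemma integral_gauss s : 0 < s ->
  (\int[mu]_x (gauss s x)%:E = (Num.sqrt pi / Num.sqrt s)%:E)%E.
Proof.
move=> s0; have ss : 0 < Num.sqrt s by rewrite sqrtr_gt0.
have := @ge0_integral_affine R 0 (Num.sqrt s) (fun x => (gauss_fun x)%:E) ss.
rewrite integralT_gauss mulrC -EFinM => <-.
- apply: eq_integral => x _; rewrite /affine add0r /gauss /gauss_fun.
  by rewrite exprMn sqr_sqrtr// ltW.
- by apply/measurable_EFinP; exact: measurable_gauss_fun.
- by move=> x; rewrite lee_fin gauss_fun_ge0.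
Qed.

Lemma integrable_gauss s : 0 < s -> mu.-integrable setT (fun x => (gauss s x)%:E).
Proof.
move=> s0; apply/integrableP; split.
  by apply/measurable_EFinP; exact: measurable_gauss.
under eq_integral do rewrite gee0_abs ?lee_fin ?gauss_ge0//.
by rewrite integral_gauss// ltry.
Qed.

(** Half of the exponent absorbs the factor: [|x| <= (1 + 1/s) (1 + s x^2 / 2) <= (1 + 1/s) exp(s
    x^2 / 2)]. This makes the function that dominates the derivative under the integral
    integrable. *)
Lemma normM_gauss_le s x : 0 < s ->
  `|x| * gauss s x <= (1 + s^-1) * gauss (s / 2) x.
Proof.
move=> s0; rewrite (_ : gauss s x = gauss (s / 2) x * gauss (s / 2) x); last first.
  by rewrite /gauss -expRD; congr expR; field.
rewrite mulrA ler_pM2r ?gauss_gt0// /gauss expRN ler_pdivrMr ?expR_gt0//.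
have h1 : 1 + s / 2 * x ^+ 2 <= expR (s / 2 * x ^+ 2) by exact: expR_ge1Dx.
have K0 : 0 < 1 + s^-1 by rewrite addr_gt0// invr_gt0.
apply: le_trans (_ : (1 + s^-1) * (1 + s / 2 * x ^+ 2) <= _); last by rewrite ler_pM2l.
have -> : (1 + s^-1) * (1 + s / 2 * x ^+ 2) = 1 + x ^+ 2 / 2 + (s^-1 + s / 2 * x ^+ 2).
  by field; rewrite gt_eqF.
have h2 : 0 <= s^-1 + s / 2 * x ^+ 2.
  by rewrite addr_ge0 ?invr_ge0 ?(ltW s0)// mulr_ge0 ?sqr_ge0// divr_ge0// ltW.
rewrite (le_trans _ (_ : 1 + x ^+ 2 / 2 <= _))//; last by rewrite lerDl.
by rewrite -(real_normK (num_real x)); move: (`|x|) => y; nra.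
Qed.

Lemma integrable_normM_gauss s : 0 < s ->
  mu.-integrable setT (fun x => (`|x| * gauss s x)%:E).
Proof.
move=> s0.
have h : mu.-integrable setT (fun x => (1 + s^-1)%:E * (gauss (s / 2) x)%:E)%E.
  by apply: integrableZl => //; apply: integrable_gauss; rewrite divr_gt0.
apply: le_integrable h => //.
- apply/measurable_EFinP; apply: measurable_funM; last exact: measurable_gauss.
  exact: normr_measurable.
- move=> x _; rewrite -EFinM !abse_EFin lee_fin ger0_norm ?mulr_ge0 ?gauss_ge0//.
  by rewrite ger0_norm ?normM_gauss_le// mulr_ge0 ?gauss_ge0// addr_ge0// invr_ge0 ltW.
Qed.

Lemma is_derive_gauss s x : is_derive x 1 (gauss s) (- (2 * s * x) * gauss s x).
Proof.
by rewrite /gauss; apply: is_derive_eq; rewrite /GRing.scale /=; ring.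
Qed.

End gaussian.

Section integral_of_derivative.
Variable R : realType.
Local Notation mu := (@lebesgue_measure R).

Lemma derivable_continuous (f : R -> R) (df : R -> R) :
  (forall x : R, is_derive x 1 f (df x)) -> continuous f.
Proof.
move=> fdf x; apply: differentiable_continuous; apply/derivable1_diffP.
exact: ex_derive.
Qed.

(** The fundamental theorem of calculus on [[-(n+1), n+1]] followed by dominated convergence;
    integration by parts over the line is an instance. *)
Lemma Rintegral_derive_eq0 (H h : R -> R) :
  (forall x : R, is_derive x 1 H (h x)) -> continuous h ->
  mu.-integrable setT (EFin \o h) ->
  H n.+1%:R @[n --> \oo] --> 0 -> H (- n.+1%:R) @[n --> \oo] --> 0 ->
  \int[mu]_x h x = 0.
Proof.
move=> Hh ch ih Hp Hm.
pose f_ (n : nat) := (EFin \o h) \_ `[- n.+1%:R, n.+1%:R].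
have mh : measurable_fun [set: measurableTypeR R] (EFin \o h) by exact: measurable_int ih.
have mf n : measurable_fun [set: measurableTypeR R] (f_ n).
  by apply/(measurable_restrictT _ _).1 => //; exact: measurable_funTS.
have nbd : mu.-integrable setT (fun x => `|(EFin \o h) x|)%E by exact: integrable_abse.
have cvf x : f_ n x @[n --> \oo] --> (EFin \o h) x.
  apply: cvg_near_cst; near=> n; rewrite /f_ patchE mem_set//= in_itv/= -ler_norml.
  by rewrite (@le_trans _ _ n%:R)// ?ler_nat//; near: n; exact: nbhs_infty_ger.
have lef x n : (`|f_ n x| <= `|(EFin \o h) x|)%E.
  by rewrite /f_ patchE; case: ifPn => // _; rewrite abse0 abse_ge0.
have [_ _ cv] := @dominated_convergence _ _ R mu setT measurableT _ _ _ mf mh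
  (aeW mu (fun (x : measurableTypeR R) _ => cvf x)) nbd
  (aeW mu (fun (x : measurableTypeR R) n _ => lef x n)).
have E n : (\int[mu]_x f_ n x = (H n.+1%:R - H (- n.+1%:R))%:E)%E.
  rewrite /f_ -integral_mkcond EFinB; apply: continuous_FTC2.
  - by rewrite gtrN.
  - exact: continuous_subspaceT.
  - have cH := derivable_continuous Hh; split.
    + by move=> x _; exact: ex_derive.
    + by apply: cvg_at_right_filter; exact: cH.
    + by apply: cvg_at_left_filter; exact: cH.
  - by move=> x _; rewrite derive1E; exact: derive_val.
move: cv; under eq_fun do rewrite E.
move=> cv; have : ((H n.+1%:R - H (- n.+1%:R))%:E @[n --> \oo] --> 0%:E)%E.
  by apply: cvg_EFin; [exact: nearW|rewrite -[X in _ --> X](subr0 0); exact: cvgB].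
by move=> /(cvg_unique (@ereal_hausdorff R) cv); rewrite /Rintegral => ->.
Unshelve. all: by end_near. Qed.

End integral_of_derivative.

Section gaussian_fourier.
Variable R : realType.
Local Notation mu := (@lebesgue_measure R).
Implicit Types s x u c : R.

Let integrable_bounded_mul (f g : R -> R) (b : R) :
  mu.-integrable setT (EFin \o f) -> measurable_fun [set: measurableTypeR R] (g : measurableTypeR R -> R) ->
  (forall x, `|g x| <= b) -> mu.-integrable setT (EFin \o (fun x => f x * g x)).
Proof.
move=> fi mg gb; have h : mu.-integrable setT (fun x => b%:E * (EFin \o f) x)%E by exact: integrableZl.
have b0 : 0 <= b by rewrite (le_trans _ (gb 0)).
have mf : measurable_fun [set: measurableTypeR R] (f : measurableTypeR R -> R) by apply/measurable_EFinP; exact: measurable_int fi.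
apply: le_integrable h => //.
- by apply/measurable_EFinP; apply: measurable_funM.
- move=> x _ /=; rewrite lee_fin !normrM mulrC ler_pM//.
  by rewrite (le_trans (gb x)) ?ler_norm.
Qed.

Let integrable_scale (k : R) (f : R -> R) : mu.-integrable setT (EFin \o f) ->
  mu.-integrable setT (EFin \o (fun x => k * f x)).
Proof.
move=> fi; rewrite (_ : _ \o _ = (fun x => k%:E * (EFin \o f) x)%E)//.
exact: integrableZl.
Qed.

Let is_derive_cosl u c x : is_derive x 1 (fun x => cos (x * u + c)) (- (u * sin (x * u + c))).
Proof. by apply: is_derive_eq; rewrite /GRing.scale /=; ring. Qed.

Let is_derive_sinl u c x : is_derive x 1 (fun x => sin (x * u + c)) (u * cos (x * u + c)).
Proof. by apply: is_derive_eq; rewrite /GRing.scale /=; ring. Qed.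

Let measurable_cosl u c : measurable_fun setT (fun x : measurableTypeR R => cos (x * u + c)).
Proof.
apply: continuous_measurable_fun; apply: derivable_continuous => x; exact: is_derive_cosl.
Qed.

Let measurable_sinl u c : measurable_fun setT (fun x : measurableTypeR R => sin (x * u + c)).
Proof.
apply: continuous_measurable_fun; apply: derivable_continuous => x; exact: is_derive_sinl.
Qed.

Lemma integrable_gauss_cos s u c : 0 < s ->
  mu.-integrable setT (EFin \o (fun x => gauss s x * cos (x * u + c))).
Proof.
move=> s0; apply: (@integrable_bounded_mul (gauss s) _ 1) => //.
- exact: integrable_gauss.
- by move=> x; exact: cos_max.
Qed.

Let integrable_xgauss_sin s u c : 0 < s ->
  mu.-integrable setT (EFin \o (fun x => x * gauss s x * sin (x * u + c))).
Proof.
move=> s0; apply: (@integrable_bounded_mul (fun x => x * gauss s x) _ 1) => //; last first.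
  by move=> x; exact: sin_max.
apply: le_integrable (integrable_normM_gauss s0) => //.
  apply/measurable_EFinP; apply: measurable_funM => //; exact: measurable_gauss.
by move=> x _ /=; rewrite lee_fin !normrM normr_id.
Qed.

Let gauss_cvg0 s : 0 < s -> gauss s n.+1%:R @[n --> \oo] --> 0.
Proof.
move=> s0; apply: (@squeeze_cvgr _ _ _ _ (cst 0) (fun n => s^-1 * n.+1%:R^-1)).
- apply: nearW => n; rewrite gauss_ge0/= /gauss expRN -invfM lef_pV2 ?posrE ?expR_gt0 ?mulr_gt0//.
  apply: le_trans (expR_ge1Dx _); rewrite (le_trans (_ : _ <= s * n.+1%:R ^+ 2))//.
    by rewrite ler_pM2l// expr2 ler_peMr// ler1n.
  by rewrite lerDr.
- exact: cvg_cst.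
- rewrite -[X in _ --> X](mulr0 s^-1); apply: cvgMr => //; exact: cvg_harmonic.
Qed.

Let is_derive_gauss_sin s u c x : is_derive x 1 (fun x => gauss s x * sin (x * u + c))
  (- (2 * s) * (x * gauss s x * sin (x * u + c)) + u * (gauss s x * cos (x * u + c))).
Proof.
have h1 := is_derive_gauss s x; have h2 := is_derive_sinl u c x.
apply: is_derive_eq; rewrite /GRing.scale /=; ring.
Qed.

(** Integration by parts: the derivative of [gauss s x * sin (x * u + c)] in [x] has integral 0. *)
Let Rintegral_xgauss_sin s u c : 0 < s ->
  \int[mu]_x (x * gauss s x * sin (x * u + c)) =
  u / (2 * s) * \int[mu]_x (gauss s x * cos (x * u + c)).
Proof.
move=> s0.
have i1 := integrable_xgauss_sin u c s0; have i2 := integrable_gauss_cos u c s0.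
have j1 : mu.-integrable setT (EFin \o (fun x => - (2 * s) * (x * gauss s x * sin (x * u + c)))).
  exact: integrable_scale.
have j2 : mu.-integrable setT (EFin \o (fun x => u * (gauss s x * cos (x * u + c)))).
  exact: integrable_scale.
have := @Rintegral_derive_eq0 R _ _ (is_derive_gauss_sin s u c) _ _ _ _.
have c1 : continuous (fun x => - (2 * s) * (x * gauss s x * sin (x * u + c)) + u * (gauss s x * cos (x * u + c))).
  move=> x; apply: cvgD; apply: cvgMr.
    apply: cvgM; last exact: (derivable_continuous (is_derive_sinl u c)).
    apply: cvgM; first exact: cvg_id.
    exact: (derivable_continuous (is_derive_gauss s)).
  apply: cvgM; last exact: (derivable_continuous (is_derive_cosl u c)).
  exact: (derivable_continuous (is_derive_gauss s)).
have bd (y : R^nat) : gauss s (y n) @[n --> \oo] --> 0 ->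
    gauss s (y n) * sin (y n * u + c) @[n --> \oo] --> 0.
  move=> gy; apply: norm_cvg0; apply: (@squeeze_cvgr _ _ _ _ (cst 0) (fun n => gauss s (y n))) => //.
  - apply: nearW => n; rewrite normr_ge0 normrM (ger0_norm (gauss_ge0 _ _))/=.
    by rewrite ler_piMr ?gauss_ge0// sin_max.
  - exact: cvg_cst.
move=> /(_ c1 _ (bd _ (gauss_cvg0 s0)) (bd _ _)) H.
have {H} : \int[mu]_x (- (2 * s) * (x * gauss s x * sin (x * u + c)) + u * (gauss s x * cos (x * u + c))) = 0.
  apply: H.
  - exact: (integrableD measurableT j1 j2).
  - rewrite (_ : (fun n => _) = (fun n => gauss s n.+1%:R)); first exact: gauss_cvg0.
    by apply/funext => n; rewrite /gauss sqrrN.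
rewrite RintegralD// !RintegralZl// => /eqP; rewrite mulNr addrC subr_eq0 => /eqP e.
rewrite mulrAC e; field; exact: lt0r_neq0.
Qed.

Let I s c u := \int[mu]_x (gauss s x * cos (x * u + c)).

Let is_derive_I s c u : 0 < s -> is_derive u 1 (I s c) (- (u / (2 * s)) * I s c u).
Proof.
move=> s0.
pose f (u x : R) := gauss s x * cos (x * u + c).
have df (v x : R) : is_derive v 1 (f ^~ x) (- (x * gauss s x * sin (x * v + c))).
  by rewrite /f; apply: is_derive_eq; rewrite /GRing.scale /=; ring.
have uin : `]u - 1, u + 1[%classic u by rewrite /= in_itv/= ltrBlDr !ltrDl ltr01.
have inf x : `]u - 1, u + 1[%classic x -> mu.-integrable setT (EFin \o f x).
  by move=> _; exact: integrable_gauss_cos.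
have df1 x y : `]u - 1, u + 1[%classic x -> [set: R] y -> derivable (f ^~ y) x 1.
  by move=> _ _; exact: ex_derive.
have G0 (y : R) : 0 <= `|y| * gauss s y by rewrite mulr_ge0// gauss_ge0.
have Gb x y : `]u - 1, u + 1[%classic x -> [set: R] y -> `|partial1of2 f x y| <= `|y| * gauss s y.
  move=> _ _; rewrite partial1of2E derive_val normrN normrM normrM (ger0_norm (gauss_ge0 _ _)).
  by rewrite ler_piMr// ?mulr_ge0 ?gauss_ge0// sin_max.
apply: DeriveDef.
  exact: (@derivable_under_integral R _ _ mu f setT measurableT u _ _ uin inf df1 _ G0 (integrable_normM_gauss s0) Gb).
rewrite -derive1E (@differentiation_under_integral R _ _ mu f setT measurableT u _ _ uin inf df1 _ G0 (integrable_normM_gauss s0) Gb).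
under eq_Rintegral do rewrite partial1of2E derive_val -mulN1r.
rewrite RintegralZl//; last exact: integrable_xgauss_sin.
by rewrite Rintegral_xgauss_sin// mulN1r mulNr.
Qed.

(** The equation [I' = - u / (2 s) I] makes [I * exp(u^2 / (4 s))] constant in [u]. The free phase
    [c] covers the real and the imaginary part of the Fourier transform at once, as [c - pi / 2]
    gives the sine. *)
Lemma Rintegral_gauss_cos s u c : 0 < s ->
  \int[mu]_x (gauss s x * cos (x * u + c)) =
  Num.sqrt pi / Num.sqrt s * cos c * gauss (4 * s)^-1 u.
Proof.
move=> s0; rewrite -/(I s c u).
pose F (u : R) := I s c u * expR ((4 * s)^-1 * u ^+ 2).
have dF (v : R) : is_derive v 1 F 0.
  have h := is_derive_I c v s0; rewrite /F.
  apply: is_derive_eq; rewrite /GRing.scale /=; field; exact: lt0r_neq0.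
have := is_derive_0_is_cst u 0 dF; rewrite /F expr0n mulr0 expR0 mulr1.
rewrite (_ : I s c 0 = Num.sqrt pi / Num.sqrt s * cos c) => [<-|].
  by rewrite /gauss expRN mulfK// gt_eqF// expR_gt0.
rewrite /I; under eq_Rintegral do rewrite mulr0 add0r mulrC.
rewrite RintegralZl//; last exact: integrable_gauss.
by rewrite /Rintegral integral_gauss// mulrC.
Qed.

End gaussian_fourier.

Section lebesgue_shift.
Variable R : realType.
Local Notation mu := (@lebesgue_measure R).

Lemma integral_shift (b : R) (h : measurableTypeR R -> \bar R) :
  measurable_fun setT h ->
  (\int[mu]_x h (b + x)%R = \int[mu]_x h x)%E.
Proof.
move=> mh; rewrite integralE [RHS]integralE.
have E (k : measurableTypeR R -> \bar R) : measurable_fun setT k -> (forall x, 0 <= k x)%E ->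
    (\int[mu]_x k (b + x)%R = \int[mu]_x k x)%E.
  move=> mk k0; have := @ge0_integral_affine R b 1 k ltr01 mk k0.
  rewrite invr1 mul1e => <-; apply: eq_integral => x _; by rewrite /affine mul1r.
congr (_ - _)%E.
- rewrite -[RHS]E; [|exact: measurable_funepos|by move=> x; exact: funepos_ge0].
  by apply: eq_integral => x _; rewrite !funeposE.
- rewrite -[RHS]E; [|exact: measurable_funeneg|by move=> x; exact: funeneg_ge0].
  by apply: eq_integral => x _; rewrite !funenegE.
Qed.

Lemma Cintegral_shift (b : R) (h : R -> R[i]) : Cintegrable mu h ->
  Cintegrable mu (fun x => h (b + x)) /\
  Cintegral mu (fun x => h (b + x)) = Cintegral mu h.
Proof.
move=> [h1 h2].
have m1 : measurable_fun [set: measurableTypeR R] (fun x : measurableTypeR R => (complex.Re (h x))%:E) by exact: measurable_int h1.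
have m2 : measurable_fun [set: measurableTypeR R] (fun x : measurableTypeR R => (complex.Im (h x))%:E) by exact: measurable_int h2.
split; last by rewrite /Cintegral /Rintegral !(integral_shift b m1, integral_shift b m2).
have mb : measurable_fun [set: measurableTypeR R] (fun x : measurableTypeR R => b + x : measurableTypeR R).
  exact: measurable_funD.
split; apply/integrableP; split.
- exact: (measurableT_comp m1 mb).
- rewrite (@integral_shift b (fun x => `|(complex.Re (h x))%:E|)%E).
    by have /integrableP[] := h1.
  exact: measurableT_comp.
- exact: (measurableT_comp m2 mb).
- rewrite (@integral_shift b (fun x => `|(complex.Im (h x))%:E|)%E).
    by have /integrableP[] := h2.
  exact: measurableT_comp.
Qed.

End lebesgue_shift.

Section cis.
Variable R : realType.

Lemma cisD (x y : R) : cis (x + y) = cis x * cis y.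
Proof.
rewrite /cis cosD sinD; apply/eqP; rewrite eq_complex /=.
by apply/andP; split; apply/eqP; ring.
Qed.

Lemma cis0 : cis (0 : R) = 1.
Proof. by rewrite /cis cos0 sin0. Qed.

Lemma cis_sum (I : Type) (r : seq I) (F : I -> R) :
  cis (\sum_(i <- r) F i) = \prod_(i <- r) cis (F i).
Proof. by elim/big_rec2 : _ => [|i y x _ <-]; rewrite ?cis0 ?cisD. Qed.

Lemma cis_2pi_int (x : R) (k : int) : cis (x + 2 * pi * k%:~R) = cis x.
Proof.
have nat_case (y : R) (j : nat) : cis (y + 2 * pi * j%:R) = cis y.
  elim: j y => [|j IH] y; first by rewrite mulr0 addr0.
  have -> : 2 * pi * j.+1%:R = 2 * pi * j%:R + pi *+ 2 :> R.
    by rewrite -[j.+1%:R]natr1 (mulrDr (2 * pi)) mulr1 (mulr_natl pi).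
  by rewrite addrA -[in RHS](IH y) /cis cosD2pi sinD2pi.
case: k => j; first exact: nat_case.
by rewrite NegzE mulrNz mulrN -[LHS](nat_case _ j.+1) subrK.
Qed.

End cis.

Section gaussian_Rn.
Variable R : realType.
Local Notation C := R[i].
Local Notation mu := (@lebesgue_measure R).

Let cgauss (s u c x : R) : C := (gauss s x)%:C%C * cis (x * u + c).

Lemma Cintegral_gauss (s u c : R) : 0 < s ->
  Cintegrable mu (cgauss s u c) /\
  Cintegral mu (cgauss s u c) =
  (Num.sqrt pi / Num.sqrt s * gauss (4 * s)^-1 u)%:C%C * cis c.
Proof.
move=> s0.
have E1 : (fun x => complex.Re (cgauss s u c x)) = (fun x => gauss s x * cos (x * u + c)).
  by apply/funext => x; rewrite /cgauss /= mul0r subr0.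
have E2 : (fun x => complex.Im (cgauss s u c x)) = (fun x => gauss s x * cos (x * u + (c - pi / 2))).
  apply/funext => x; rewrite /cgauss /= mul0r addr0 addrA cosB cos_pihalf sin_pihalf.
  by rewrite mulr0 add0r mulr1.
split.
  by split; rewrite ?E1 ?E2; exact: integrable_gauss_cos.
apply/eqP; rewrite eq_complex /= E1 E2 !Rintegral_gauss_cos// cosB cos_pihalf sin_pihalf.
apply/andP; split; apply/eqP; ring.
Qed.

Lemma Cintegral_gauss_shift (s u b : R) : 0 < s ->
  Cintegrable mu (fun x => (gauss s (x - b))%:C%C * cis (x * u)) /\
  Cintegral mu (fun x => (gauss s (x - b))%:C%C * cis (x * u)) =
  (Num.sqrt pi / Num.sqrt s * gauss (4 * s)^-1 u)%:C%C * cis (b * u).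
Proof.
move=> s0; have [h1 h2] := Cintegral_gauss u (b * u) s0.
have [h3 h4] := Cintegral_shift (- b) h1; rewrite -h2 -h4.
have -> : (fun x => (gauss s (x - b))%:C%C * cis (x * u)) = (fun x => cgauss s u (b * u) (- b + x)).
  by apply/funext => x; rewrite /cgauss (addrC (- b)) mulrBl subrK.
by split.
Qed.

(** A product over the coordinates, so that integrals factor by [Cintegral_prod_tuple]; the radial
    form is [gaussnE]. *)
Definition gaussn n (s : R) (x : 'rV[R]_n) : R := \prod_i gauss s (x 0 i).

Lemma gaussn_gt0 n s (x : 'rV_n) : 0 < gaussn s x.
Proof. by apply: prodr_gt0 => i _; exact: gauss_gt0. Qed.

Lemma gaussn_ge0 n s (x : 'rV_n) : 0 <= gaussn s x.
Proof. exact/ltW/gaussn_gt0. Qed.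

Lemma gaussnE n s (x : 'rV_n) : gaussn s x = expR (- (s * dotr x x)).
Proof.
rewrite /gaussn /gauss -expR_sum; congr expR.
by rewrite sumrN /dotr mulr_sumr; congr (- _); apply: eq_bigr => i _; rewrite expr2.
Qed.

Lemma Cintegral_gaussn n (s : R) (u b : 'rV[R]_n) : 0 < s ->
  Cintegrable (lebesgue_Rn R n)
    (fun t => (gaussn s (row_of t - b))%:C%C * cis (dotr (row_of t) u)) /\
  Cintegral (lebesgue_Rn R n)
    (fun t => (gaussn s (row_of t - b))%:C%C * cis (dotr (row_of t) u)) =
  ((Num.sqrt pi / Num.sqrt s) ^+ n * gaussn (4 * s)^-1 u)%:C%C * cis (dotr b u).
Proof.
move=> s0.
pose phi (i : 'I_n) (x : R) : C := (gauss s (x - b 0 i))%:C%C * cis (x * u 0 i).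
have h i := Cintegral_gauss_shift (u 0 i) (b 0 i) s0.
have [h1 h2] := @Cintegral_prod_tuple _ _ R mu n phi (fun i => (h i).1).
have E : (fun t : n.-tuple (measurableTypeR R) => (gaussn s (row_of t - b))%:C%C * cis (dotr (row_of t) u)) =
    (fun t => \prod_i phi i (tnth t i)).
  apply/funext => t; rewrite /phi big_split /= -cis_sum /gaussn rmorph_prod.
  congr (_ * cis _); last by apply: eq_bigr => i _; rewrite !mxE.
  by apply: eq_bigr => i _; rewrite !mxE.
rewrite E; split; first exact: h1.
apply: eq_trans h2 _; under eq_bigr do rewrite (h _).2.
rewrite big_split /= -cis_sum -rmorph_prod big_split /= prodr_const card_ord.
by [].
Qed.

End gaussian_Rn.

(** * Trigonometric polynomials *)

Section circle_fourier.
Variable R : realType.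
Local Notation C := R[i].

Lemma cos_wrap (l : int) (c x : R) : cos (l%:~R * wrap x + c) = cos (l%:~R * x + c).
Proof.
have [k ->] := wrapE x.
rewrite (_ : _ + c = l%:~R * x + c + 2 * pi * (l * k)%:~R); last by rewrite intrM; ring.
by have := congr1 (@complex.Re R) (cis_2pi_int (l%:~R * x + c) (l * k)).
Qed.

Lemma circle_lty : (circle R setT < +oo)%E.
Proof. by rewrite circle_setT ltry. Qed.

Lemma integral_circle_cst (r : R) : (\int[circle R]_x r%:E = r%:E)%E.
Proof. by rewrite integral_cst//; have := circle_setT R; rewrite /= => ->; rewrite mule1. Qed.

Lemma integrable_circle_cos (a c : R) :
  (circle R).-integrable setT (EFin \o (fun x : measurableTypeR R => cos (a * x + c))).
Proof.
apply: measurable_bounded_integrable => //.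
- exact: circle_lty.
- apply: continuous_measurable_fun => x; apply: continuous_comp; last exact: continuous_cos.
  by apply: cvgD; [apply: cvgMr; exact: cvg_id|exact: cvg_cst].
- exists 1; split; first exact: num_real.
  by move=> y y1 x _ /=; rewrite (le_trans (cos_max _))// ltW.
Qed.

(** Rotation by [pi / l] changes the sign of the cosine. The constant 1 is added because rotation
    invariance was shown for nonnegative functions. *)
Lemma Rintegral_circle_cos (l : int) (c : R) : l != 0 ->
  \int[circle R]_x cos (l%:~R * x + c) = 0.
Proof.
move=> l0; have l0' : l%:~R != 0 :> R by rewrite intr_eq0.
have pos (c' x : R) : (0 <= (1 + cos (l%:~R * x + c'))%:E)%E.
  by rewrite lee_fin -lerBlDl sub0r; have := cos_max (l%:~R * x + c'); rewrite ler_norml => /andP[].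
have ms (c' : R) : measurable_fun [set: measurableTypeR R]
    (fun x : measurableTypeR R => (1 + cos (l%:~R * x + c'))%:E).
  apply/measurable_EFinP; apply: measurable_funD => //.
  apply/measurable_EFinP; exact: measurable_int (integrable_circle_cos l%:~R c').
have I1 (c' : R) : (\int[circle R]_x (1 + cos (l%:~R * x + c'))%:E =
    (1 + \int[circle R]_x cos (l%:~R * x + c'))%:E)%E.
  under eq_integral do rewrite EFinD.
  rewrite integralD//; last 2 first.
  - apply: measurable_bounded_integrable => //; first exact: circle_lty.
    by exists 1; split => // y y1 x _; rewrite normr1 ltW.
  - exact: integrable_circle_cos.
  rewrite (integral_circle_cst 1) EFinD; congr (_ + _)%E.
  by rewrite /Rintegral fineK//; apply: integrable_fin_num => //; exact: integrable_circle_cos.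
have := @ge0_integral_wrap R (pi / l%:~R) _ (ms c) (pos c).
under eq_integral => x _.
  rewrite cos_wrap (_ : _ * _ + c = l%:~R * x + (pi + c)); last first.
    by rewrite mulrDr mulrCA divff// mulr1 addrAC addrC.
  over.
rewrite !I1 => -[] /addrI.
move=> shiftpi.
have : \int[circle R]_x cos (l%:~R * x + (pi + c)) = - \int[circle R]_x cos (l%:~R * x + c).
  rewrite -mulN1r -RintegralZl//; last exact: integrable_circle_cos.
  by apply: eq_Rintegral => x _; rewrite (addrC pi c) addrA cosDpi mulN1r.
by rewrite shiftpi; lra.
Qed.

Lemma Cintegral_circle_cis (l : int) :
  Cintegrable (circle R) (fun x => cis (l%:~R * x)) /\
  Cintegral (circle R) (fun x => cis (l%:~R * x)) = (l == 0)%:R :> C.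
Proof.
have sinE (x : R) : sin (l%:~R * x) = cos (l%:~R * x + - (pi / 2)).
  by rewrite cosB cos_pihalf sin_pihalf mulr0 add0r mulr1.
have cosE (x : R) : cos (l%:~R * x) = cos (l%:~R * x + 0) by rewrite addr0.
have i1 := integrable_circle_cos l%:~R 0; have i2 := integrable_circle_cos l%:~R (- (pi / 2)).
split.
  split => /=.
  - by under eq_fun do rewrite cosE.
  - by under eq_fun do rewrite sinE.
rewrite /Cintegral /=.
under eq_Rintegral do rewrite cosE.
under [X in (_ +i* X)%C]eq_Rintegral do rewrite sinE.
have [->|l0] := eqVneq l 0; last by rewrite !Rintegral_circle_cos.
have cst (r : R) : \int[circle R]_x r = r.
  by rewrite /Rintegral integral_circle_cst.
under eq_Rintegral do rewrite mul0r addr0 cos0.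
under [X in (_ +i* X)%C]eq_Rintegral do rewrite mul0r add0r cosN cos_pihalf.
by rewrite !cst.
Qed.

End circle_fourier.

Lemma sum_pred1_uniq (V : nmodType) (I : eqType) (r : seq I) (i : I) (F : I -> V) :
  uniq r -> i \in r -> \sum_(k <- r | k == i) F k = F i.
Proof.
move=> ur ir; rewrite big_mkcond (bigD1_seq i)//= eqxx big1 ?addr0// => k.
by move=> /negbTE ->.
Qed.

Section torus_fourier.
Variables (R : realType) (n m : nat).
Local Notation C := R[i].

Lemma dotrBl (x y z : 'rV[R]_n) : dotr (x - y) z = dotr x z - dotr y z.
Proof.
rewrite /dotr -sumrB; apply: eq_bigr => i _; by rewrite !mxE mulrBl.
Qed.

Lemma dotrDl (x y z : 'rV[R]_n) : dotr (x + y) z = dotr x z + dotr y z.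
Proof.
rewrite /dotr -big_split; apply: eq_bigr => i _; by rewrite !mxE mulrDl.
Qed.

Lemma dotrC (x y : 'rV[R]_n) : dotr x y = dotr y x.
Proof. by apply: eq_bigr => i _; rewrite mulrC. Qed.

Lemma latticeB (k l : 'rV[int]_n) : lattice R (k - l) = lattice R k - lattice R l.
Proof. by apply/matrixP => i j; rewrite !mxE intrB. Qed.

Lemma measurable_dotr (b : 'rV[R]_n) :
  measurable_fun [set: n.-tuple (measurableTypeR R)] (fun t => dotr b (row_of t)).
Proof.
apply: measurable_sum => i; apply: measurable_funM => //.
rewrite (_ : (fun x => _) = (fun t : n.-tuple (measurableTypeR R) => tnth t i)).
  exact: measurable_tnth.
by apply/funext => t; rewrite mxE.
Qed.

Lemma Cintegral_torus_cis (l : 'rV[int]_n) :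
  Cintegrable (torus R n) (fun t => cis (dotr (lattice R l) (row_of t))) /\
  Cintegral (torus R n) (fun t => cis (dotr (lattice R l) (row_of t))) =
  (l == 0)%:R :> C.
Proof.
pose phi (i : 'I_n) (x : R) : C := cis ((l 0 i)%:~R * x).
have h i := Cintegral_circle_cis R (l 0 i).
have [h1 h2] := @Cintegral_prod_tuple _ _ R (circle R) n phi (fun i => (h i).1).
have E : (fun t : n.-tuple (measurableTypeR R) => cis (dotr (lattice R l) (row_of t))) =
    (fun t => \prod_i phi i (tnth t i)).
  apply/funext => t; rewrite /phi -cis_sum.
  by congr cis; apply: eq_bigr => i _; rewrite !mxE.
rewrite E; split; first exact: h1.
apply: eq_trans h2 _; under eq_bigr do rewrite (h _).2.
have [->|l0] := eqVneq l 0; first by rewrite big1// => i _; rewrite mxE eqxx.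
have /existsP[i li] : [exists i, l 0 i != 0].
  rewrite -negb_forall; apply: contra l0 => /forallP l0; apply/eqP/rowP => i.
  by rewrite mxE; apply/eqP.
by rewrite (bigD1 i)//= (negbTE li) mul0r.
Qed.

Lemma Cintegral_torus_measure (f : n.-tuple (measurableTypeR R) -> C) :
  Cintegral (torus_measure R n) f = Cintegral (torus R n) f.
Proof. by rewrite /Cintegral /Rintegral !integral_torus_measure. Qed.

(** A frequency may occur several times, each time with its own coefficient, so that lists can be
    mapped without merging terms. *)
Definition trig (L : seq ('rV[int]_n * 'cV[C]_m)) (x : 'rV[R]_n) : 'cV[C]_m :=
  \sum_(z <- L) cis (dotr (lattice R z.1) x) *: z.2.

Lemma trig_polyP (f : 'rV[R]_n -> 'cV[C]_m) :
  trig_poly f <-> exists L, f = trig L.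
Proof.
split => [[K [c fE]]|[L ->]].
  exists [seq (k, c k) | k <- K]; apply/funext => x.
  by rewrite fE /trig big_map.
exists (undup [seq z.1 | z <- L]), (fun k => \sum_(z <- L | k == z.1) z.2) => x.
rewrite /trig; under [RHS]eq_bigr do rewrite scaler_sumr.
rewrite (exchange_big_dep xpredT)//=; apply: eq_big_seq => z zL.
by rewrite sum_pred1_uniq ?undup_uniq// mem_undup map_f.
Qed.

Lemma trig_coef (L : seq ('rV[int]_n * 'cV[C]_m)) k :
  fourier_coef (trig L) k = \sum_(z <- L | k == z.1) z.2.
Proof.
apply/matrixP => j c; rewrite ord1 !mxE {c} Cintegral_torus_measure.
rewrite (@eq_Cintegral _ _ _ _ _
  (fun t => \sum_(z <- L) z.2 j 0 * cis (dotr (lattice R (z.1 - k)) (row_of t)))); last first.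
  move=> t; rewrite /trig summxE mulr_suml; apply: eq_bigr => z _.
  by rewrite mxE latticeB dotrBl cisD mulrA (mulrC (z.2 j 0)).
rewrite Cintegral_sum; last by move=> z; apply: CintegrableZ; exact: (Cintegral_torus_cis _).1.
rewrite summxE [RHS]big_mkcond; apply: eq_bigr => z _.
rewrite CintegralZ; last exact: (Cintegral_torus_cis _).1.
rewrite (Cintegral_torus_cis _).2 subr_eq0 eq_sym.
by case: eqP => _; rewrite ?mulr1 ?mulr0.
Qed.

Lemma disc_mult_opE (M : 'rV[R]_n -> 'M[R]_m) (L : seq ('rV[int]_n * 'cV[C]_m)) :
  disc_mult_op M (trig L) =
  trig [seq (z.1, mxC (M (lattice R z.1)) *m z.2) | z <- L].
Proof.
apply/funext => x; rewrite /disc_mult_op /trig big_map.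
under eq_fsbigr do rewrite trig_coef.
rewrite (fsbigE (undup [seq z.1 | z <- L])) ?undup_uniq//; last first.
  move=> k _; rewrite mem_undup => kL.
  rewrite big_seq_cond big_pred0 ?mulmx0 ?scaler0// => z.
  by apply/negP => /andP[zL /eqP kz]; move: kL; rewrite kz map_f.
under eq_bigl do rewrite in_setT.
under eq_bigr do rewrite mulmx_sumr scaler_sumr.
rewrite (exchange_big_dep xpredT)//=; apply: eq_big_seq => z zL.
by rewrite sum_pred1_uniq ?undup_uniq// mem_undup map_f.
Qed.

End torus_fourier.

Section euclid_measurable.
Context d (T : measurableType d) (R : realType) (m : nat).
Local Notation C := R[i].

Lemma measurable_euclid (f : T -> 'cV[C]_m) :
  (forall j, Cmeasurable (fun x => f x j 0)) ->
  measurable_fun setT (fun x => euclid (f x)).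
Proof.
move=> mf; apply: measurableT_comp => /=.
  by apply: continuous_measurable_fun; exact: sqrt_continuous.
apply: measurable_sum => j; apply: measurable_funD; apply: measurable_funX.
- exact: (mf j).1.
- exact: (mf j).2.
Qed.

End euclid_measurable.

(** * Scalar symbols acting on one modulated Gaussian *)

Section gaussian_multiplier.
Variables (R : realType) (n : nat).
Local Notation C := R[i].
Local Notation mun := (lebesgue_Rn R n).
Local Notation tup := (n.-tuple (measurableTypeR R)).

(* [gauss_op h b t x] is the value at [x] of the multiplier operator with symbol
   [h] applied to the modulated Gaussian exp(i b.x) exp(- t^2 |x|^2 / 4). *)
Definition gauss_op (h : 'rV[R]_n -> R) (b : 'rV[R]_n) (t : R) (x : 'rV[R]_n) : C :=
  ((2 * pi) ^- n * (Num.sqrt pi / (t / 2)) ^+ n)%:C%C *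
  Cintegral mun (fun u => (h (row_of u) * gaussn (t ^- 2) (row_of u - b))%:C%C *
    cis (dotr x (row_of u))).

Lemma measurable_gaussn (s : R) (b : 'rV[R]_n) :
  measurable_fun [set: tup] (fun u : tup => gaussn s (row_of u - b)).
Proof.
apply: measurable_prod => i _.
rewrite (_ : (fun x => _) = (gauss s \o (fun y : measurableTypeR R => y - b 0 i)) \o (fun u : tup => tnth u i)).
  apply: measurableT_comp; last exact: measurable_tnth.
  apply: measurableT_comp; first exact: measurable_gauss.
  exact: measurable_funB.
by apply/funext => u /=; rewrite !mxE.
Qed.

Lemma integrable_gaussn (s : R) (b : 'rV[R]_n) : 0 < s ->
  mun.-integrable setT (EFin \o (fun u : tup => gaussn s (row_of u - b))).
Proof.
move=> s0; have [[h _] _] := Cintegral_gaussn 0 b s0.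
rewrite (_ : _ \o _ = EFin \o (fun t : tup => complex.Re ((gaussn s (row_of t - b))%:C%C * cis (dotr (row_of t) 0)))) //.
apply/funext => u /=; rewrite /dotr big1 ?cos0 ?sin0 ?mulr1 ?mul0r ?subr0// => i _.
by rewrite !mxE mulr0.
Qed.

Lemma Cintegrable_gauss_op (h : 'rV[R]_n -> R) (b : 'rV[R]_n) (t : R) (x : 'rV[R]_n) (K : R) : 0 < t ->
  measurable_fun [set: tup] (fun u : tup => h (row_of u)) ->
  (forall x, `|h x| <= K) ->
  Cintegrable mun (fun u => (h (row_of u) * gaussn (t ^- 2) (row_of u - b))%:C%C *
    cis (dotr x (row_of u))).
Proof.
move=> t0 mh hK; have s0 : 0 < (t ^- 2) by rewrite invr_gt0 exprn_gt0.
have K0 : 0 <= K by rewrite (le_trans _ (hK 0)).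
apply: (@le_Cintegrable _ _ R mun _ (fun u => K * gaussn (t ^- 2) (row_of u - b))).
- apply: CmeasurableM; last by apply: Cmeasurable_cis; exact: measurable_dotr.
  by apply: Cmeasurable_real; apply: measurable_funM => //; exact: measurable_gaussn.
- rewrite (_ : _ \o _ = (fun u => K%:E * (EFin \o (fun u : tup => gaussn (t ^- 2) (row_of u - b))) u)%E)//.
  by apply: integrableZl => //; exact: integrable_gaussn.
- move=> u; rewrite sqnM sqn_cis mulr1 sqn_real !exprMn ler_wpM2r ?sqr_ge0//.
  by rewrite -(real_normK (num_real (h _))) ler_pXn2r ?nnegrE.
- by move=> u; rewrite mulr_ge0// gaussn_ge0.
Qed.

(** Fourier inversion for the modulated Gaussian: the normalizations [Num.sqrt pi / (t / 2)] and
    [Num.sqrt pi * t] of the two transforms multiply to [2 * pi]. *)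
Lemma gauss_op_cst (r : R) (b : 'rV[R]_n) (t : R) x : 0 < t ->
  gauss_op (fun=> r) b t x = (r * gaussn (t ^+ 2 / 4) x)%:C%C * cis (dotr b x).
Proof.
move=> t0; have s0 : 0 < (t ^- 2) by rewrite invr_gt0 exprn_gt0.
have [i1 e1] := Cintegral_gaussn x b s0.
rewrite /gauss_op (@eq_Cintegral _ _ _ _ _ (fun u => r%:C%C * ((gaussn (t ^- 2) (row_of u - b))%:C%C *
   cis (dotr (row_of u) x)))); last first.
  by move=> u; rewrite rmorphM mulrA dotrC.
rewrite CintegralZ// e1 !mulrA -!rmorphM; congr (_%:C%C * _).
have -> : (4 * (t ^- 2))^-1 = t ^+ 2 / 4 by field; exact: lt0r_neq0.
have -> : Num.sqrt (t ^- 2) = t^-1 by rewrite -exprVn sqrtr_sqr ger0_norm ?invr_ge0 ?ltW.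
rewrite invrK; set A := ((2 * pi) ^- n).
rewrite [LHS](_ : _ = (A * ((Num.sqrt pi / (t / 2)) ^+ n * (Num.sqrt pi * t) ^+ n)) * (r * gaussn (t ^+ 2 / 4) x)); last by ring.
rewrite -exprMn (_ : _ * (_ * t) = 2 * pi); last first.
  have := @sqr_sqrtr R pi (pi_ge0 R); set q := Num.sqrt pi => <-.
  by field; exact: lt0r_neq0.
by rewrite mulVf ?mul1r// expf_neq0// mulf_neq0// gt_eqF// pi_gt0.
Qed.

Lemma gauss_opB (h k : 'rV[R]_n -> R) (b : 'rV[R]_n) (t : R) (x : 'rV[R]_n) (K : R) : 0 < t ->
  measurable_fun [set: tup] (fun u : tup => h (row_of u)) ->
  measurable_fun [set: tup] (fun u : tup => k (row_of u)) ->
  (forall x, `|h x| <= K) -> (forall x, `|k x| <= K) ->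
  gauss_op (fun x => h x - k x) b t x = gauss_op h b t x - gauss_op k b t x.
Proof.
move=> t0 mh mk hK kK; rewrite /gauss_op -mulrBr; congr (_ * _).
rewrite -mulN1r -CintegralZ; last exact: (Cintegrable_gauss_op b x t0 mk kK).
rewrite -CintegralD; [|exact: (Cintegrable_gauss_op b x t0 mh hK)|]; last first.
  by apply: CintegrableZ; exact: (Cintegrable_gauss_op b x t0 mk kK).
by apply: eq_Cintegral => u; rewrite mulrBl rmorphB mulrBl mulN1r.
Qed.

Let Rintegral_norm_le (f g : tup -> R) :
  mun.-integrable setT (EFin \o f) -> measurable_fun [set: tup] g ->
  (forall x, `|f x| <= g x) ->
  (`|\int[mun]_x f x|%:E <= \int[mun]_x (g x)%:E)%E.
Proof.
move=> fi mg fg; have mf := measurable_int _ fi.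
rewrite EFin_normr_Rintegral//.
apply: le_trans (le_abse_integral mun measurableT mf) _.
apply: ge0_le_integral => //=.
- exact: (measurableT_comp (@abse_measurable R setT) mf).
- exact/measurable_EFinP.
- by move=> u _; rewrite lee_fin.
Qed.

(** With absolute values inside the integral and the substitution [xi = b + t u], the bound no
    longer depends on [x] and sees the symbol only around [b], at scale [t]. *)
Lemma gauss_op_le (h : 'rV[R]_n -> R) (b : 'rV[R]_n) (t : R) (x : 'rV[R]_n) (K : R) : 0 < t ->
  measurable_fun [set: tup] (fun u : tup => h (row_of u)) ->
  (forall x, `|h x| <= K) ->
  ((`|complex.Re (gauss_op h b t x)|)%:E <=
     (Num.sqrt pi ^- n)%:E * \int[mun]_u (`|h (b + t *: row_of u)| * gaussn 1 (row_of u))%:E)%E /\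
  ((`|complex.Im (gauss_op h b t x)|)%:E <=
     (Num.sqrt pi ^- n)%:E * \int[mun]_u (`|h (b + t *: row_of u)| * gaussn 1 (row_of u))%:E)%E.
Proof.
move=> t0 mh hK.
have [i1 i2] := Cintegrable_gauss_op b x t0 mh hK.
set c := ((2 * pi) ^- n * (Num.sqrt pi / (t / 2)) ^+ n).
have c0 : 0 <= c.
  have t2 : 0 <= t / 2 by rewrite divr_ge0// ltW.
  by rewrite mulr_ge0 ?invr_ge0 ?exprn_ge0 ?mulr_ge0 ?invr_ge0 ?pi_ge0 ?sqrtr_ge0.
pose g (u : tup) := `|h (row_of u)| * gaussn (t ^- 2) (row_of u - b).
have mg : measurable_fun [set: tup] g.
  by apply: measurable_funM; [exact: measurableT_comp|exact: measurable_gaussn].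
have key : (c%:E * \int[mun]_u (g u)%:E = (Num.sqrt pi ^- n)%:E *
    \int[mun]_u (`|h (b + t *: row_of u)| * gaussn 1 (row_of u))%:E)%E.
  have := @ge0_integral_affine_tuple R n (fun i => b 0 i) t (EFin \o g) t0.
  rewrite (_ : (\int[_]_u (EFin \o g) _ =
    \int[mun]_u (`|h (b + t *: row_of u)| * gaussn 1 (row_of u))%:E)%E); last first.
    apply: eq_integral => u _ /=; rewrite /g.
    have -> : row_of [tuple affine (b 0 i) t (tnth u i) | i < n] = b + t *: row_of u.
      by apply/rowP => i; rewrite !mxE tnth_mktuple.
    congr (_ * _)%:E; rewrite [b + _]addrC addrK /gaussn; apply: eq_bigr => i _.
    rewrite !mxE /gauss; congr (expR (- _)).
    by field; exact: lt0r_neq0.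
  move=> ->; last 2 first.
  - exact/measurable_EFinP.
  - by move=> u; rewrite lee_fin mulr_ge0// gaussn_ge0.
  rewrite muleA; congr (_ * _)%E; rewrite -EFinM; congr EFin.
  rewrite /c -!exprVn -!exprMn; congr (_ ^+ n).
  have := @sqr_sqrtr R pi (pi_ge0 R); have : 0 < Num.sqrt pi :> R by rewrite sqrtr_gt0 pi_gt0.
  set q := Num.sqrt pi => q0 <-; field; apply/andP; split; exact: lt0r_neq0.
have bound (y : R) : (`|y|%:E <= \int[mun]_u (g u)%:E)%E -> (`|c * y|%:E <= (Num.sqrt pi ^- n)%:E *
    \int[mun]_u (`|h (b + t *: row_of u)| * gaussn 1 (row_of u))%:E)%E.
  by move=> h1; rewrite -key normrM (ger0_norm c0) EFinM; apply: lee_wpmul2l.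
have gE (u : tup) : g u = `|h (row_of u) * gaussn (t ^- 2) (row_of u - b)|.
  by rewrite normrM (ger0_norm (gaussn_ge0 _ _)).
rewrite /gauss_op -/c /=; split.
- rewrite mul0r subr0; apply: bound; apply: Rintegral_norm_le => // u.
  rewrite gE /= mul0r subr0 normrM ler_piMr//; exact: cos_max.
- rewrite mul0r addr0; apply: bound; apply: Rintegral_norm_le => // u.
  rewrite gE /= mul0r addr0 normrM ler_piMr//; exact: sin_max.
Qed.

Lemma gauss_op_cvg0 (h_ : nat -> 'rV[R]_n -> R) (b_ : nat -> 'rV[R]_n) (t_ : nat -> R) (K : R) :
  (forall l, measurable_fun [set: tup] (fun u : tup => h_ l (b_ l + t_ l *: row_of u))) ->
  (forall l x, `|h_ l x| <= K) ->
  (forall u, h_ l (b_ l + t_ l *: u) @[l --> \oo] --> 0) ->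
  ((Num.sqrt pi ^- n)%:E * \int[mun]_u (`|h_ l (b_ l + t_ l *: row_of u)| * gaussn 1 (row_of u))%:E @[l --> \oo] --> 0)%E.
Proof.
move=> mh hK h0.
have g1 : mun.-integrable setT (EFin \o (fun u : tup => K * gaussn 1 (row_of u - 0))).
  rewrite (_ : _ \o _ = (fun u => K%:E * (EFin \o (fun u : tup => gaussn 1 (row_of u - 0))) u)%E)//.
  by apply: integrableZl => //; exact: integrable_gaussn.
pose f_ l (u : tup) := (`|h_ l (b_ l + t_ l *: row_of u)| * gaussn 1 (row_of u))%:E.
have mg : measurable_fun [set: tup] (fun u : tup => gaussn 1 (row_of u)).
  by have := measurable_gaussn 1 0; under eq_fun do rewrite subr0.
have mf l : measurable_fun [set: tup] (f_ l).
  by apply/measurable_EFinP; apply: measurable_funM => //; exact: measurableT_comp.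
have cf (u : tup) : (f_ l u @[l --> \oo] --> 0%:E)%E.
  apply: cvg_EFin; first exact: nearW.
  rewrite -[X in _ --> X](mul0r (gaussn 1 (row_of u))).
  by apply: cvgMl; rewrite -(normr0 R); apply: cvg_norm; exact: h0.
have fg (u : tup) l : (`|f_ l u| <= (K * gaussn 1 (row_of u - 0))%:E)%E.
  rewrite lee_fin subr0 normrM normr_id (ger0_norm (gaussn_ge0 _ _)).
  by rewrite ler_wpM2r ?gaussn_ge0.
have [_ _ cv] := @dominated_convergence _ _ R mun setT measurableT f_ (cst 0%E) _ mf
  (measurable_cst _) (aeW mun (fun (x : tup) _ => cf x)) g1
  (aeW mun (fun (x : tup) n _ => fg x n)).
rewrite integral0 in cv.
by rewrite -[X in _ --> X](mule0 (Num.sqrt pi ^- n)%:E); apply: cvgeMl.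
Qed.

End gaussian_multiplier.

(** * Rounding to the lattice, and measurability of functions continuous off the origin *)

Section sup_norm.
Variables (R : realType) (n : nat).
Implicit Types x : 'rV[R]_n.

Lemma norm_rV_le x (e : R) : 0 <= e -> (forall i, `|x 0 i| <= e) -> `|x| <= e.
Proof.
move=> e0 xe; rewrite [leLHS]mx_normrE; apply: bigmax_le => // -[i j] _ /=.
by rewrite ord1.
Qed.

Lemma coord_le_norm x i : `|x 0 i| <= `|x|.
Proof.
rewrite [leRHS]mx_normrE.
exact: (le_bigmax 0 (fun ij : 'I_1 * 'I_n => `|x ij.1 ij.2|) (0, i)).
Qed.

(** Dividing by [c] recovers [x] up to [1 / c]. This serves twice: to exhibit functions as limits of
    countably valued ones, and to find lattice vectors in nearly a prescribed direction. *)
Definition round (c : R) x : 'rV[int]_n := map_mx (fun y => Num.floor (c * y)) x.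

Lemma round_norm_le (c : R) x : 0 < c -> `|c^-1 *: lattice R (round c x) - x| <= c^-1.
Proof.
move=> c0; apply: norm_rV_le; first by rewrite invr_ge0 ltW.
move=> i; rewrite !mxE -[in X in - X](mulKf (lt0r_neq0 c0) (x 0 i)) -mulrBr normrM.
rewrite ger0_norm ?invr_ge0 ?(ltW c0)// ler_piMr ?invr_ge0 ?(ltW c0)//.
have := floor_itv (c * x 0 i); rewrite intrD => /andP[h1 h2].
by rewrite distrC ger0_norm; lra.
Qed.

Lemma round0 (c : R) : round c 0 = 0.
Proof. by apply/rowP => i; rewrite !mxE mulr0 floor0. Qed.

Lemma round_cvg (c_ : nat -> R) x : (forall l, 0 < c_ l) ->
  (c_ l)^-1 @[l --> \oo] --> 0 ->
  (c_ l)^-1 *: lattice R (round (c_ l) x) @[l --> \oo] --> x.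
Proof.
move=> c0 cc; apply/cvgrPdist_le => e e0.
have /cvgrPdist_le/(_ e e0) := cc; apply: filterS => l.
rewrite sub0r normrN ger0_norm ?invr_ge0 ?(ltW (c0 l))// => h.
by rewrite distrC (le_trans (round_norm_le _ (c0 l))).
Qed.

Lemma invSn_cvg0 : (n.+1%:R)^-1 @[n --> \oo] --> (0 : R).
Proof. exact: cvg_harmonic. Qed.

End sup_norm.

Section measurable_off0.
Variables (R : realType) (n : nat).
Local Notation tup := (n.-tuple (measurableTypeR R)).

Lemma measurable_round (c : R) (h : 'rV[int]_n -> R) :
  0 <= c -> measurable_fun [set: tup] (fun u : tup => h (round c (row_of u))).
Proof.
move=> c0 _ A mA; rewrite setTI.
have -> : (fun u : tup => h (round c (row_of u))) @^-1` A =
    \bigcup_(k : 'rV[int]_n) ([set u | round c (row_of u) = k] `&` [set u | A (h k)]).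
  apply/seteqP; split => [u /= Au|u [k _ [/= <-]]//].
  by exists (round c (row_of u)).
apply: countable_bigcupT_measurable => // k.
apply: measurableI; last first.
  have [Ak|Ak] := pselect (A (h k)).
    by rewrite (_ : [set _ | _] = setT)//; apply/seteqP; split.
  by rewrite (_ : [set _ | _] = set0)//; apply/seteqP; split.
have -> : [set u : tup | round c (row_of u) = k] =
    \big[setI/setT]_(i < n) ((fun t : tup => (Num.floor (c * tnth t i))%:~R : R) @^-1` [set (k 0 i)%:~R]).
  rewrite -bigcap_seq; apply/seteqP; split => [u /= uk i _ /=|u uk].
    by rewrite -uk !mxE.
  apply/rowP => i; rewrite !mxE; apply/eqP; rewrite -(eqr_int R); apply/eqP.
  by apply: (uk i); rewrite /= mem_index_enum.
apply: big_ind => //; first by move=> *; exact: measurableI.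
move=> i _; rewrite -[X in measurable X]setTI.
suff : measurable_fun [set: tup] (fun t : tup => (Num.floor (c * tnth t i))%:~R : R) by apply.
apply: (@measurableT_comp _ _ _ _ _ _ (fun x : measurableTypeR R => (Num.floor (c * x))%:~R : R)); last exact: measurable_tnth.
apply: nondecreasing_measurable => // x y xy.
by rewrite ler_int; apply: le_floor; rewrite ler_wpM2l.
Qed.

(** The topology lives on rows and the sigma-algebra on tuples, so continuity does not give
    measurability by itself: [h] is a pointwise limit of functions of [round], which takes countably
    many values. At the origin, where continuity may fail, [round] is exact. *)
Lemma measurable_off0 (h : 'rV[R]_n -> R) :
  (forall x, x != 0 -> {for x, continuous h}) ->
  measurable_fun [set: tup] (fun u : tup => h (row_of u)).
Proof.
move=> ch.
apply: (@measurable_fun_cvg _ _ _ _ (fun l (u : tup) => h (l.+1%:R^-1 *: lattice R (round l.+1%:R (row_of u))))).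
  by move=> l; apply: (measurable_round (fun k => h (l.+1%:R^-1 *: lattice R k))).
move=> u _; have [->|u0] := eqVneq (row_of u) 0.
  rewrite (_ : (fun l => _) = cst (h 0)); first exact: cvg_cst.
  apply/funext => l; rewrite round0 (_ : lattice R 0 = 0) ?scaler0//.
  by apply/rowP => i; rewrite !mxE.
apply: (@cvg_comp _ _ _ _ h _ _ _ _ (ch _ u0)).
by apply: (@round_cvg _ _ (fun l => l.+1%:R)) => //; exact: invSn_cvg0.
Qed.

Lemma measurable_affine_row (h : 'rV[R]_n -> R) (b : 'rV[R]_n) (t : R) :
  measurable_fun [set: tup] (fun u : tup => h (row_of u)) ->
  measurable_fun [set: tup] (fun u : tup => h (b + t *: row_of u)).
Proof.
move=> mh; rewrite (_ : (fun u => _) = (fun u : tup => h (row_of u)) \o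
    (fun u => [tuple affine (b 0 i) t (tnth u i) | i < n])).
  apply: (measurableT_comp mh).
  exact: (@measurable_map_tuple _ (measurableTypeR R) n (fun i => affine (b 0 i) t)
    (fun i => measurable_affine _ _)).
apply/funext => u /=; congr h; apply/rowP => i.
by rewrite !mxE tnth_mktuple.
Qed.

End measurable_off0.

Lemma powR_cvg (R : realType) (p a : R) (u : nat -> R) : 1 <= p ->
  (forall n, 0 <= u n) -> u n @[n --> \oo] --> a -> u n `^ p @[n --> \oo] --> a `^ p.
Proof.
move=> p1 u0 ua; have p0 : 0 < p by exact: lt_le_trans p1.
have a0 : 0 <= a.
  by rewrite -(cvg_lim (@Rhausdorff R) ua); apply: limr_ge; [exact: cvgP ua|exact: nearW].
have [a0'|a0'] := eqVneq a 0.
  rewrite a0' powR0 ?gt_eqF//; rewrite {}a0' in ua.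
  apply: (@squeeze_cvgr _ _ _ _ (cst 0) u) => //; last exact: cvg_cst.
  have /cvgrPdist_le/(_ 1 ltr01) := ua; apply: filterS => n.
  rewrite sub0r normrN ger0_norm// => un1; rewrite powR_ge0/=.
  have [->|un0] := eqVneq (u n) 0; first by rewrite powR0// gt_eqF.
  by rewrite -[leRHS]powRr1//; apply: ger_powR => //; rewrite lt0r un0 u0.
have ap : 0 < a by rewrite lt0r a0'.
have E (y : R) : 0 < y -> y `^ p = expR (p * ln y) by move=> y0; rewrite /powR gt_eqF.
rewrite E//.
have : expR (p * ln (u n)) @[n --> \oo] --> expR (p * ln a).
  apply: (@cvg_comp _ _ _ (fun n => p * ln (u n)) expR); last exact: continuous_expR.
  apply: cvgMr; apply: (@cvg_comp _ _ _ u (@ln R)) ua _; exact: continuous_ln.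
apply: cvg_trans; apply: near_eq_cvg.
have /cvgrPdist_lt/(_ a ap) := ua; apply: filterS => n.
rewrite ltr_norml => /andP[_]; rewrite ltrBlDr ltrDl => un0.
by rewrite E.
Qed.

Section integral_mono.
Context d (T : measurableType d) (R : realType).
Variable mu : {measure set T -> \bar R}.
Local Open Scope ereal_scope.

Lemma le_integralT (f g : T -> \bar R) :
  (forall x, 0 <= f x) -> (forall x, f x <= g x) ->
  \int[mu]_x f x <= \int[mu]_x g x.
Proof.
move=> f0 fg; have g0 x : 0 <= g x by exact: le_trans (f0 x) (fg x).
rewrite !ge0_integralTE//; apply: le_ereal_sup => _ [h hf <-].
by exists h => // x; exact: le_trans (hf x) (fg x).
Qed.

(** The truncated powers converge pointwise to the full one, and Fatou's lemma keeps the bound. No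
    smallness of the error [e_ n] in [L^p] is asked for, so it may be a constant on a space of
    infinite measure. *)
Lemma integral_powR_trunc (h : T -> R) (p : R) (e_ : nat -> R) (C_ : nat -> R) (C : R) :
  (1 <= p)%R -> measurable_fun setT h -> (forall x, 0 <= h x)%R ->
  e_ n @[n --> \oo] --> 0%R -> C_ n @[n --> \oo] --> C ->
  (forall n, \int[mu]_x (Num.max (h x - e_ n) 0 `^ p)%R%:E <= (C_ n)%:E) ->
  \int[mu]_x ((h x) `^ p)%:E <= C%:E.
Proof.
move=> p1 mh h0 e0 CC le.
pose f_ n x : \bar R := ((Num.max (h x - e_ n)%R 0%R) `^ p)%:E.
have mf n : measurable_fun setT (f_ n).
  apply/measurable_EFinP; apply: (measurableT_comp (measurable_powR p)).
  by apply: measurable_maxr => //; exact: measurable_funB.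
have f0 n x : setT x -> 0 <= f_ n x by move=> _; rewrite lee_fin powR_ge0.
have := fatou mu measurableT mf f0.
rewrite (_ : \int[mu]_x limn_einf (f_ ^~ x) = \int[mu]_x ((h x) `^ p)%:E); last first.
  apply: eq_integral => x _.
  have cv : f_ n x @[n --> \oo] --> ((h x) `^ p)%:E.
    apply: cvg_EFin; first exact: nearW.
    apply: powR_cvg => //; first by move=> n; rewrite le_max lexx orbT.
    apply/cvgrPdist_le => e e0'; have /cvgrPdist_le/(_ e e0') := e0; apply: filterS => n.
    rewrite sub0r normrN => ene; have := h0 x; have := ler_norm (e_ n); have := ler_norm (- e_ n).
    rewrite normrN => e1 e2 hx; rewrite ler_norml.
    by have [l1|l1] := leP (h x - e_ n)%R 0%R; apply/andP; split; lra.
  by rewrite (is_cvg_limn_einfE (cvgP _ cv)); apply/cvg_lim.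
move=> /le_trans; apply.
have cC : (C_ n)%:E @[n --> \oo] --> C%:E by apply: cvg_EFin => //; exact: nearW.
rewrite -(cvg_lim (@ereal_hausdorff R) cC) limn_einf_lim; apply: lee_lim.
- exact: cvgP (@cvg_einfs_sup R _).
- exact: cvgP cC.
- apply: nearW => n; apply: le_trans (le n).
  by apply: ereal_inf_lbound; exists n => /=.
Qed.

End integral_mono.

(** * Norms of vector-valued functions and their powers *)

Section LpNorm.
Context d (T : measurableType d) (R : realType) (m : nat).
Variable mu : {measure set T -> \bar R}.
Local Open Scope ereal_scope.
Implicit Types (p : R) (f g : T -> 'cV[R[i]]_m).

(** The power of the norm, without the root: in this form inequalities that hold for each value of
    an auxiliary variable can be integrated over it. *)
Definition intp (p : R) f : \bar R := \int[mu]_x ((euclid (f x)) `^ p)%:E.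

Lemma intp_ge0 p f : 0 <= intp p f.
Proof. by apply: integral_ge0 => x _; rewrite lee_fin powR_ge0. Qed.

Lemma LpNorm_intp p f : (0 < p)%R -> LpNorm mu p f `^ p = intp p f.
Proof.
move=> p0; rewrite /LpNorm poweR_Lnorm ?gt_eqF//; apply: eq_integral => x _.
by rewrite gee0_abs ?lee_fin ?euclid_ge0// poweR_EFin.
Qed.

Lemma LpNorm_ge0 p f : 0 <= LpNorm mu p f.
Proof. exact: Lnorm_ge0. Qed.

Lemma LpNormE p f : (0 < p)%R -> LpNorm mu p f = intp p f `^ p^-1.
Proof.
move=> p0; rewrite -LpNorm_intp// -poweRrM mulfV ?gt_eqF// poweRe1//.
exact: LpNorm_ge0.
Qed.

Lemma LpNorm_le_intp p f (c : R) : (0 < p)%R -> (0 <= c)%R ->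
  (LpNorm mu p f <= c%:E) = (intp p f <= (c `^ p)%:E).
Proof.
move=> p0 c0; apply/idP/idP => h.
  rewrite -LpNorm_intp// -poweR_EFin; apply: gt0_ler_poweR => //; first exact: ltW.
  - by rewrite in_itv/= LpNorm_ge0 leey.
  - by rewrite in_itv/= lee_fin c0 leey.
rewrite LpNormE//; apply: (@le_trans _ _ ((c `^ p)%:E `^ p^-1)).
  apply: gt0_ler_poweR => //; first by rewrite invr_ge0 ltW.
  - by rewrite in_itv/= intp_ge0 leey.
  - by rewrite in_itv/= lee_fin powR_ge0 leey.
by rewrite poweR_EFin -powRrM mulfV ?gt_eqF// powRr1.
Qed.

Lemma LpNorm_eq0_intp p f : (0 < p)%R -> (LpNorm mu p f == 0) = (intp p f == 0).
Proof.
move=> p0; rewrite LpNormE// poweR_eq0 ?intp_ge0//.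
by rewrite invr_eq0 (gt_eqF p0) /= andbT.
Qed.

(** Taken with [g] an exponential, this makes the Fourier transform of a function of norm 0 vanish.
    Such functions are treated apart because the quotients in the operator norms have nonzero
    denominators. *)
Lemma intp_eq0_Cintegral (p : R) f (g : T -> R[i]) (j : 'I_m) : (0 < p)%R ->
  (forall j, Cmeasurable (fun x => f x j 0%R)) -> Cmeasurable g -> intp p f = 0 ->
  Cintegral mu (fun x => (f x j 0 * g x)%R) = 0%R.
Proof.
move=> p0 mf mg f0; apply: ae_eq0_Cintegral; first exact: CmeasurableM.
have mep : measurable_fun setT (fun x => ((euclid (f x)) `^ p)%:E).
  apply/measurable_EFinP; apply: (measurableT_comp (measurable_powR p)).
  exact: measurable_euclid.
have : \int[mu]_x `|((euclid (f x)) `^ p)%:E| = 0.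
  rewrite -f0; apply: eq_integral => x _.
  by rewrite gee0_abs// lee_fin powR_ge0.
move=> /(ae_eq_integral_abs mu measurableT mep) aef.
rewrite (ae_eq_integral (cst 0))// ?integral0//.
- apply/measurable_EFinP.
  by have [h1 h2] := CmeasurableM (mf j) mg; apply: measurable_funD; exact: measurable_funX.
- apply: filterS aef => x /(_ Logic.I) /= [] /eqP; rewrite powR_eq0 => /andP[/eqP fx0 _] _.
  by rewrite (euclid_eq0 fx0) mxE mul0r /sqn /= expr0n addr0.
Qed.

End LpNorm.

(** * Multipliers and modulated Gaussians *)

Section schwartz_gaussian.
Variables (R : realType) (n : nat).
Implicit Types (b x v : 'rV[R]_n) (h : 'rV[R]_n -> R).

Lemma derive_comp1 (f : R -> R) h x v (df : R) :
  differentiable h x -> is_derive (h x) 1 f df ->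
  differentiable (f \o h) x /\ 'D_v (f \o h) x = df * 'D_v h x.
Proof.
move=> dh fdf.
have df1 : differentiable f (h x) by apply/derivable1_diffP; exact: ex_derive.
have dfh : differentiable (f \o h) x by exact: differentiable_comp.
split => //; rewrite !deriveE// diff_comp//= diff1E//.
by rewrite /= derive1E (@derive_val _ _ _ _ _ f _ fdf) mulrC.
Qed.

(* A class of rapidly decreasing functions closed under partial derivatives that
   contains the real and imaginary parts of the modulated Gaussians; [c] is a
   phase, which turns cosines into sines. *)
Inductive gclass (s : R) : ('rV[R]_n -> R) -> Prop :=
| gclass_base b c : gclass s (fun x => gaussn s x * cos (dotr b x + c))
| gclass_coord i h : gclass s h -> gclass s (fun x => x 0 i * h x)
| gclass_add h1 h2 : gclass s h1 -> gclass s h2 -> gclass s (fun x => h1 x + h2 x)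
| gclass_scale a h : gclass s h -> gclass s (fun x => a * h x).

Lemma derive_coordinate (i : 'I_n) x v :
  differentiable (fun y : 'rV[R]_n => y 0 i) x /\ 'D_v (fun y : 'rV[R]_n => y 0 i) x = v 0 i.
Proof.
split; first exact: differentiable_coord.
apply: (cvg_lim (@Rhausdorff R)).
apply: (cvg_trans _ (@cvg_cst _ (v 0 i) _ (0 : R)^' _)).
apply: near_eq_cvg; near=> e; rewrite /= !mxE addrK.
rewrite -[RHS]/(e^-1 * (e * v 0 i)) mulKf//.
by near: e; exact: nbhs_dnbhs_neq.
Unshelve. all: by end_near. Qed.

Lemma derive_add h1 h2 x v : differentiable h1 x -> differentiable h2 x ->
  differentiable (fun y => h1 y + h2 y) x /\
  'D_v (fun y => h1 y + h2 y) x = 'D_v h1 x + 'D_v h2 x.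
Proof.
move=> d1 d2; split; first exact: differentiableD.
by apply: deriveD; exact: diff_derivable.
Qed.

Lemma derive_mul h1 h2 x v : differentiable h1 x -> differentiable h2 x ->
  differentiable (fun y => h1 y * h2 y) x /\
  'D_v (fun y => h1 y * h2 y) x = h1 x * 'D_v h2 x + h2 x * 'D_v h1 x.
Proof.
move=> d1 d2; split; first exact: differentiableM.
by apply: deriveM; exact: diff_derivable.
Qed.

Lemma derive_scale (a : R) h x v : differentiable h x ->
  differentiable (fun y => a * h y) x /\ 'D_v (fun y => a * h y) x = a * 'D_v h x.
Proof.
move=> dh; split; first exact: differentiableZ.
by apply: deriveZ; exact: diff_derivable.
Qed.

Lemma derive_sum_seq (I : Type) (r : seq I) (h : I -> 'rV[R]_n -> R) x v :
  (forall i, differentiable (h i) x) ->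
  differentiable (fun y => \sum_(i <- r) h i y) x /\
  'D_v (fun y => \sum_(i <- r) h i y) x = \sum_(i <- r) 'D_v (h i) x.
Proof.
move=> dh; elim: r => [|i r [IH1 IH2]].
  under eq_fun do rewrite big_nil; rewrite big_nil; split; first exact: differentiable_cst.
  exact: derive_cst.
under eq_fun do rewrite big_cons; rewrite big_cons -IH2.
exact: derive_add.
Qed.

Lemma derive_dotr b x v : differentiable (dotr b) x /\ 'D_v (dotr b) x = dotr b v.
Proof.
have dc i := derive_scale (b 0 i) v (derive_coordinate i x v).1.
have [h1 h2] := derive_sum_seq (index_enum _) v (fun i => (dc i).1).
split; first exact: h1.
apply: eq_trans h2 _; apply: eq_bigr => i _.
by rewrite (dc i).2 (derive_coordinate i x v).2.
Qed.

Lemma derive_dotrr x v :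
  differentiable (fun y : 'rV[R]_n => dotr y y) x /\
  'D_v (fun y : 'rV[R]_n => dotr y y) x = 2 * dotr x v.
Proof.
have dc i := derive_mul v (derive_coordinate i x v).1 (derive_coordinate i x v).1.
have [h1 h2] := derive_sum_seq (index_enum _) v (fun i => (dc i).1).
split; first exact: h1.
apply: eq_trans h2 _; rewrite mulr_sumr; apply: eq_bigr => i _.
by rewrite (dc i).2 (derive_coordinate i x v).2; ring.
Qed.

Lemma derive_base (s : R) b (c : R) x v :
  differentiable (fun x => gaussn s x * cos (dotr b x + c)) x /\
  'D_v (fun x => gaussn s x * cos (dotr b x + c)) x =
  - (2 * s) * (dotr x v * (gaussn s x * cos (dotr b x + c))) +
  dotr b v * (gaussn s x * cos (dotr b x + (c + pi / 2))).
Proof.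
have [q1 q2] := derive_dotrr x v.
have [q3 q4] := derive_scale (- s) v q1.
have [e1 e2] := derive_comp1 v q3 (is_derive_expR (- s * dotr x x)).
have [r1 r2] := derive_dotr b x v.
have [r3 r4] := derive_add v r1 (@differentiable_cst _ _ _ c x).
have [c1 c2] := derive_comp1 v r3 (is_derive_cos (dotr b x + c)).
have [m1 m2] := derive_mul v e1 c1.
have E : (fun x => gaussn s x * cos (dotr b x + c)) =
    (fun y => (expR \o (fun y => - s * dotr y y)) y * (cos \o (fun y => dotr b y + cst c y)) y).
  by apply/funext => y /=; rewrite gaussnE mulNr.
rewrite E; split; first exact: m1.
apply: eq_trans m2 _; rewrite e2 c2 q4 q2 r4 r2 derive_cst addr0 /= addrA (cosD (dotr b x + c)) cos_pihalf sin_pihalf gaussnE mulNr; ring.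
Qed.

Lemma gclass_derive (s : R) h (i : 'I_n) : gclass s h ->
  (forall x, differentiable h x) /\ gclass s ('D_(delta_mx 0 i) h).
Proof.
have dotd x : dotr x (delta_mx 0 i) = x 0 i.
  rewrite /dotr (bigD1 i)//= mxE !eqxx mulr1 big1 ?addr0// => j ji.
  by rewrite mxE eqxx (negbTE ji) mulr0.
elim => {h} [b c|j h gh [dh gd]|h1 h2 g1 [d1 gd1] g2 [d2 gd2]|a h gh [dh gd]].
- split; first by move=> x; exact: (derive_base s b c x 0).1.
  rewrite (_ : 'D_ _ _ = (fun x => - (2 * s) * (x 0 i * (gaussn s x * cos (dotr b x + c))) +
    b 0 i * (gaussn s x * cos (dotr b x + (c + pi / 2))))).
    by apply: gclass_add; do ?constructor.
  by apply/funext => x; rewrite (derive_base _ _ _ _ _).2 !dotd.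
- split; first by move=> x; exact: (derive_mul 0 (derive_coordinate j x 0).1 (dh x)).1.
  rewrite (_ : 'D_ _ _ = (fun x => x 0 j * 'D_(delta_mx 0 i) h x + (i == j)%:R * h x)).
    by apply: gclass_add; do ?constructor.
  apply/funext => x; rewrite (derive_mul _ (derive_coordinate j x 0).1 (dh x)).2.
  by rewrite (derive_coordinate _ _ _).2 mxE eqxx eq_sym [X in _ + X]mulrC.
- split; first by move=> x; exact: (derive_add 0 (d1 x) (d2 x)).1.
  rewrite (_ : 'D_ _ _ = (fun x => 'D_(delta_mx 0 i) h1 x + 'D_(delta_mx 0 i) h2 x)).
    exact: gclass_add.
  by apply/funext => x; rewrite (derive_add _ (d1 x) (d2 x)).2.
- split; first by move=> x; exact: (derive_scale a 0 (dh x)).1.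
  rewrite (_ : 'D_ _ _ = (fun x => a * 'D_(delta_mx 0 i) h x)).
    exact: gclass_scale.
  by apply/funext => x; rewrite (derive_scale _ _ (dh x)).2.
Qed.

Lemma gclass_bound (s : R) h : 0 < s -> gclass s h ->
  forall k : nat, exists B : R, forall x, (1 + `|x|) ^+ k * `|h x| <= B.
Proof.
move=> s0; elim => {h} [b c|j h gh IH|h1 h2 g1 IH1 g2 IH2|a h gh IH] k.
(* From [(1 + y)^k <= exp(k y)] and, by completing the square, [k y - s y^2 <= k^2 / (4 s)], with
   [y] the sup norm of [x], which is at most the Euclidean one. *)
- exists (expR (k%:R ^+ 2 / (4 * s))) => x.
  have nx : `|x| ^+ 2 <= dotr x x.
    have n0 : (0 : R) <= Num.sqrt (dotr x x) by exact: sqrtr_ge0.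
    have dx : 0 <= dotr x x by apply: sumr_ge0 => i _; rewrite -expr2 sqr_ge0.
    rewrite -(sqr_sqrtr dx) ler_pXn2r ?nnegrE//; apply: norm_rV_le => // i.
    rewrite -sqrtr_sqr ler_sqrt//; rewrite /dotr (bigD1 i)//= expr2 lerDl.
    by apply: sumr_ge0 => l _; rewrite -expr2 sqr_ge0.
  rewrite normrM (ger0_norm (gaussn_ge0 _ _)) mulrA.
  apply: (@le_trans _ _ ((1 + `|x|) ^+ k * gaussn s x)).
    by rewrite ler_piMr ?mulr_ge0 ?exprn_ge0 ?gaussn_ge0 ?addr_ge0 ?cos_max.
  apply: (@le_trans _ _ (expR `|x| ^+ k * expR (- (s * `|x| ^+ 2)))).
    rewrite ler_pM ?exprn_ge0 ?gaussn_ge0 ?addr_ge0//.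
      by rewrite lerXn2r ?nnegrE ?addr_ge0 ?expR_ge0// expR_ge1Dx.
    by rewrite gaussnE ler_expR lerN2 ler_pM2l.
  rewrite -expRM_natl -expRD ler_expR mulr_natl -mulr_natl.
  move: (`|x|) => y; rewrite -subr_ge0.
  rewrite (_ : _ - _ = s * (y - k%:R / (2 * s)) ^+ 2).
    by rewrite mulr_ge0 ?sqr_ge0// ltW.
  by field; exact: lt0r_neq0.
(* A coordinate factor costs one more power of [1 + |x|]. *)
- have [B hB] := IH k.+1; exists B => x; apply: le_trans (hB x).
  rewrite normrM mulrA exprSr ler_wpM2r// ler_wpM2l ?exprn_ge0 ?addr_ge0//.
  by rewrite (le_trans (coord_le_norm x j))// lerDr.
- have [B1 hB1] := IH1 k; have [B2 hB2] := IH2 k; exists (B1 + B2) => x.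
  apply: le_trans (lerD (hB1 x) (hB2 x)); rewrite -mulrDr ler_wpM2l ?exprn_ge0 ?addr_ge0//.
  exact: ler_normD.
- have [B hB] := IH k; exists (`|a| * B) => x.
  by rewrite normrM mulrCA ler_wpM2l.
Qed.

Lemma gclass_schwartz (s : R) h : 0 < s -> (0 < n)%N -> gclass s h -> schwartz h.
Proof.
move=> s0 n0 gh r.
have gp : gclass s (partials r h).
  by elim: r => [//|i r IH] /=; exact: (gclass_derive i IH).2.
split; last exact: gclass_bound gp.
by move=> x; exact: (gclass_derive (Ordinal n0) gp).1.
Qed.

End schwartz_gaussian.

Section cnorm.
Variable R : realType.
Local Notation C := R[i].

Definition cnorm (z : C) : R := Num.sqrt (sqn z).

Lemma cnorm_ge0 z : 0 <= cnorm z. Proof. exact: sqrtr_ge0. Qed.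

Lemma cnormM z w : cnorm (z * w) = cnorm z * cnorm w.
Proof. by rewrite /cnorm sqnM sqrtrM ?sqn_ge0. Qed.

Lemma cnorm_cis x : cnorm (cis x) = 1.
Proof. by rewrite /cnorm sqn_cis sqrtr1. Qed.

End cnorm.

Section modulated_gaussians.
Variables (R : realType) (n m : nat) (I : finType).
Local Notation C := R[i].
Local Notation mun := (lebesgue_Rn R n).
Local Notation tup := (n.-tuple (measurableTypeR R)).
Implicit Types (b : I -> 'rV[R]_n) (c : I -> 'cV[C]_m) (x : 'rV[R]_n).

(** The exponent [t^2 / 4] is chosen so that on the Fourier side the Gaussian around [b i] has
    exponent [t^-2], that is, width [t]. *)
Definition gmod (t : R) b c x : 'cV[C]_m :=
  \sum_i ((gaussn (t ^+ 2 / 4) x)%:C%C * cis (dotr (b i) x)) *: c i.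

Lemma gclass_sum (s : R) (J : Type) (r : seq J) (h : J -> 'rV[R]_n -> R) :
  (forall j, gclass s (h j)) -> gclass s (fun x => \sum_(j <- r) h j x).
Proof.
move=> gh; elim: r => [|j r IH].
  rewrite (_ : (fun x => _) = (fun x => 0 * (gaussn s x * cos (dotr 0 x + 0)))).
    by apply: gclass_scale; exact: gclass_base.
  by apply/funext => x; rewrite big_nil mul0r.
rewrite (_ : (fun x => _) = (fun x => h j x + \sum_(j <- r) h j x)).
  exact: gclass_add.
by apply/funext => x; rewrite big_cons.
Qed.

Lemma gmod_schwartz (t : R) b c : (0 < n)%N -> 0 < t -> schwartz_vec (gmod t b c).
Proof.
move=> n0 t0 j.
have s0 : 0 < t ^+ 2 / 4 by rewrite divr_gt0// exprn_gt0.
have sinE (y : R) : sin y = cos (y + - (pi / 2)).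
  by rewrite cosB cos_pihalf sin_pihalf mulr0 add0r mulr1.
split; apply: (@gclass_schwartz _ _ (t ^+ 2 / 4)) => //.
- rewrite (_ : (fun x => _) = (fun x => \sum_i (complex.Re (c i j 0) *
    (gaussn (t ^+ 2 / 4) x * cos (dotr (b i) x + 0)) + (- complex.Im (c i j 0)) *
    (gaussn (t ^+ 2 / 4) x * cos (dotr (b i) x + - (pi / 2)))))).
    by apply: gclass_sum => i; apply: gclass_add; apply: gclass_scale; exact: gclass_base.
  apply/funext => x; rewrite /gmod summxE raddf_sum; apply: eq_bigr => i _.
  by rewrite mxE addr0 -sinE; case: (c i j 0) => e f /=; ring.
- rewrite (_ : (fun x => _) = (fun x => \sum_i (complex.Im (c i j 0) *
    (gaussn (t ^+ 2 / 4) x * cos (dotr (b i) x + 0)) + (complex.Re (c i j 0)) *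
    (gaussn (t ^+ 2 / 4) x * cos (dotr (b i) x + - (pi / 2)))))).
    by apply: gclass_sum => i; apply: gclass_add; apply: gclass_scale; exact: gclass_base.
  apply/funext => x; rewrite /gmod summxE raddf_sum; apply: eq_bigr => i _.
  by rewrite mxE addr0 -sinE; case: (c i j 0) => e f /=; ring.
Qed.

Lemma fourier_gmod (t : R) b c xi : 0 < t ->
  fourier (gmod t b c) xi =
  \sum_i ((Num.sqrt pi / (t / 2)) ^+ n * gaussn (t ^- 2) (xi - b i))%:C%C *: c i.
Proof.
move=> t0; have s0 : 0 < t ^+ 2 / 4 by rewrite divr_gt0// exprn_gt0.
have t2 : 0 <= t / 2 by rewrite divr_ge0// ltW.
apply/colP => j; rewrite !mxE.
have h i := Cintegral_gaussn (b i - xi) 0 s0.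
rewrite (@eq_Cintegral _ _ _ _ _ (fun u => \sum_i c i j 0 *
  ((gaussn (t ^+ 2 / 4) (row_of u - 0))%:C%C * cis (dotr (row_of u) (b i - xi))))); last first.
  move=> u; rewrite /gmod summxE mulr_suml; apply: eq_bigr => i _.
  rewrite mxE subr0 [dotr _ (b i - xi)]dotrC dotrBl cisD (dotrC xi); ring.
rewrite Cintegral_sum; last by move=> i; apply: CintegrableZ; exact: (h i).1.
rewrite summxE; apply: eq_bigr => i _; rewrite CintegralZ; last exact: (h i).1.
rewrite (h i).2 mxE mulrC; congr (_ * _).
have -> : dotr 0 (b i - xi) = 0 by rewrite /dotr big1// => l _; rewrite mxE mul0r.
rewrite cis0 mulr1; congr (_%:C%C); congr (_ ^+ n * _).
  by rewrite (_ : t ^+ 2 / 4 = (t / 2) ^+ 2) ?sqrtr_sqr ?ger0_norm//; field.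
rewrite !gaussnE (_ : (4 * (t ^+ 2 / 4))^-1 = t ^- 2); last by field; exact: lt0r_neq0.
congr (expR (- (_ * _))); apply: eq_bigr => l _; rewrite !mxE; ring.
Qed.

Lemma mult_op_gmod (M : 'rV[R]_n -> 'M[R]_m) (t K : R) b c x : 0 < t ->
  (forall k j, measurable_fun [set: tup] (fun u : tup => M (row_of u) k j)) ->
  (forall xi k j, `|M xi k j| <= K) ->
  mult_op M (gmod t b c) x =
  \sum_i \col_k \sum_j gauss_op (fun xi => M xi k j) (b i) t x * c i j 0.
Proof.
move=> t0 mM MK; apply/colP => k; rewrite summxE !mxE.
have h i j := Cintegrable_gauss_op (b i) x t0 (mM k j) (fun xi => MK xi k j).
rewrite (@eq_Cintegral _ _ _ _ _ (fun u => \sum_i \sum_j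
  (((Num.sqrt pi / (t / 2)) ^+ n)%:C%C * c i j 0) *
  ((M (row_of u) k j * gaussn (t ^- 2) (row_of u - b i))%:C%C * cis (dotr x (row_of u))))); last first.
  move=> u; rewrite fourier_gmod// mulmx_sumr summxE mulr_suml; apply: eq_bigr => i _.
  rewrite !mxE mulr_suml; apply: eq_bigr => j _; rewrite !mxE !rmorphM; ring.
rewrite Cintegral_sum; last first.
  by move=> i; apply: Cintegrable_sum => j; apply: CintegrableZ; exact: h.
rewrite mulr_sumr; apply: eq_bigr => i _; rewrite mxE.
rewrite Cintegral_sum; last by move=> j; apply: CintegrableZ; exact: h.
rewrite mulr_sumr; apply: eq_bigr => j _; rewrite CintegralZ; last exact: h.
rewrite /gauss_op !rmorphM; ring.
Qed.

(** [N i] is the symbol frozen at the frequency [b i]. Constant symbols act exactly, by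
    [gauss_op_cst], so the error is the operator with symbol [M - N i]. The factor [2 * m] counts
    the real and imaginary parts of the [m] entries. *)
Lemma mult_op_gmod_approx (M : 'rV[R]_n -> 'M[R]_m) (N : I -> 'M[R]_m) (t K e : R) b c x :
  0 < t ->
  (forall k j, measurable_fun [set: tup] (fun u : tup => M (row_of u) k j)) ->
  (forall xi k j, `|M xi k j| <= K) -> (forall i k j, `|N i k j| <= K) ->
  (forall i k j, `|complex.Re (gauss_op (fun xi => M xi k j - N i k j) (b i) t x)| <= e /\
                 `|complex.Im (gauss_op (fun xi => M xi k j - N i k j) (b i) t x)| <= e) ->
  euclid (mult_op M (gmod t b c) x - gmod t b (fun i => mxC (N i) *m c i) x)
    <= e * \sum_i \sum_j cnorm (c i j 0) * (2 * m)%:R.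
Proof.
move=> t0 mM MK NK He.
rewrite (mult_op_gmod b c x t0 mM MK) /gmod -sumrB.
apply: (le_trans (euclid_sum _ _ _)); rewrite mulr_sumr; apply: ler_sum => i _.
rewrite [X in euclid X](_ : _ = \sum_j c i j 0 *:
  \col_k gauss_op (fun xi => M xi k j - N i k j) (b i) t x); last first.
  apply/colP => k; rewrite !mxE summxE mulr_sumr -sumrB; apply: eq_bigr => j _.
  have mN : measurable_fun [set: tup] (fun _ : tup => N i k j) by exact: measurable_cst.
  rewrite !mxE (@gauss_opB _ _ (fun xi => M xi k j) (fun=> N i k j) (b i) t x K t0 (mM k j) mN
    (fun xi => MK xi k j) (fun _ => NK i k j)).
  rewrite gauss_op_cst// rmorphM; ring.
apply: (le_trans (euclid_sum _ _ _)); rewrite mulr_sumr; apply: ler_sum => j _.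
rewrite euclidZ -/(cnorm _) mulrCA ler_wpM2l ?cnorm_ge0//.
apply: (le_trans (euclid_le_sum _)).
apply: (@le_trans _ _ (\sum_(k < m) (e + e))).
  by apply: ler_sum => k _; rewrite !mxE; apply: lerD; [exact: (He i k j).1|exact: (He i k j).2].
by rewrite sumr_const card_ord -mulr2n -mulrnA mulr_natr.
Qed.

End modulated_gaussians.

(** * Restriction to the lattice *)

Section periodization.
Variables (R : realType) (n : nat).
Local Notation mun := (lebesgue_Rn R n).
Local Notation tup := (n.-tuple (measurableTypeR R)).
Local Open Scope ereal_scope.

Definition periodic (Q : 'rV[R]_n -> R) :=
  forall (x : 'rV[R]_n) (l : 'rV[int]_n), Q (x + (2 * pi) *: lattice R l)%R = Q x.

Lemma periodic_wrap (Q : 'rV[R]_n -> R) (b : 'I_n -> R) (u : tup) : periodic Q ->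
  Q (row_of [tuple wrap (b i + tnth u i)%R | i < n]) = Q (\row_i b i + row_of u)%R.
Proof.
move=> Qper; pose l : 'rV[int]_n := (\row_i - Num.floor ((b i + tnth u i + pi) / (2 * pi)))%R.
rewrite -[RHS](Qper _ l); congr Q; apply/rowP => i.
by rewrite !mxE tnth_mktuple /wrap mulrNz mulrN.
Qed.

Lemma measurable_row_add : measurable_fun [set: tup * tup]
  (fun z : tup * tup => [tuple (tnth z.1 i + tnth z.2 i)%R : measurableTypeR R | i < n]).
Proof.
apply/measurable_fun_tnthP => i.
rewrite (_ : _ \o _ = (fun z : tup * tup => (tnth z.1 i + tnth z.2 i)%R : measurableTypeR R)); last first.
  by apply/funext => z /=; rewrite tnth_mktuple.
apply: measurable_funD.
- exact: (measurableT_comp (@measurable_tnth _ _ n i) measurable_fst).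
- exact: (measurableT_comp (@measurable_tnth _ _ n i) measurable_snd).
Qed.

Lemma measurable_shifted (Q : 'rV[R]_n -> R) :
  measurable_fun [set: tup] (fun u : tup => Q (row_of u)) ->
  measurable_fun [set: tup * tup] (fun z : tup * tup => Q (row_of z.1 + row_of z.2)%R).
Proof.
move=> mQ; rewrite (_ : (fun z => _) = (fun u : tup => Q (row_of u)) \o
  (fun z : tup * tup => [tuple (tnth z.1 i + tnth z.2 i)%R : measurableTypeR R | i < n])).
  exact: (measurableT_comp mQ measurable_row_add).
by apply/funext => z /=; congr Q; apply/rowP => i; rewrite !mxE tnth_mktuple.
Qed.

Lemma integral_torus_shift (Q : 'rV[R]_n -> R) (F : R -> R) (x : 'rV[R]_n) :
  periodic Q -> measurable_fun [set: tup] (fun u : tup => Q (row_of u)) ->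
  measurable_fun setT F -> (forall r, 0 <= F r)%R ->
  \int[torus R n]_y (F (Q (x + row_of y)%R))%:E = \int[torus R n]_y (F (Q (row_of y)))%:E.
Proof.
move=> Qper mQ mF F0.
rewrite -[RHS](@ge0_integral_wrapt R n (fun i => x 0%R i)).
- apply: eq_integral => y _; rewrite (periodic_wrap (fun i => x 0%R i) y Qper); congr (F (Q (_ + _)%R))%:E.
  by apply/rowP => i; rewrite mxE.
- by apply/measurable_EFinP; apply: measurableT_comp.
- by move=> y; rewrite lee_fin.
Qed.

Lemma measurable_gaussn0 (s : R) : measurable_fun [set: tup] (fun u : tup => gaussn s (row_of u)).
Proof. by have := @measurable_gaussn R n s 0; under eq_fun do rewrite subr0. Qed.

(** After Tonelli, translation invariance in [y] removes [x] from the argument of [Q], and rescaling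
    [x] by [t / 2] normalizes the Gaussian. [F] is left general to cover both powers and truncated
    powers. *)
Lemma periodization (Q : 'rV[R]_n -> R) (F : R -> R) (t : R) :
  periodic Q -> measurable_fun [set: tup] (fun u : tup => Q (row_of u)) ->
  measurable_fun setT F -> (forall r, 0 <= F r)%R -> (0 < t)%R ->
  \int[torus R n]_y \int[mun]_x (F (Q (row_of x + row_of y) * gaussn (t ^+ 2 / 4) (row_of x))%R)%:E =
  ((t / 2) ^- n)%:E * \int[torus R n]_y \int[mun]_x (F (Q (row_of y) * gaussn 1 (row_of x))%R)%:E.
Proof.
move=> Qper mQ mF F0 t0.
have t20 : (0 < t / 2)%R by rewrite divr_gt0.
have mg s : measurable_fun [set: tup * tup] (fun z : tup * tup => gaussn s (row_of z.2)).
  exact: (measurableT_comp (measurable_gaussn0 s) measurable_snd).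
have m1 : measurable_fun [set: tup * tup] (fun z : tup * tup =>
    (F (Q (row_of z.2 + row_of z.1) * gaussn (t ^+ 2 / 4) (row_of z.2))%R)%:E).
  apply/measurable_EFinP; apply: (measurableT_comp mF); apply: measurable_funM => //.
  by under eq_fun do rewrite addrC; exact: measurable_shifted.
have m2 s : measurable_fun [set: tup * tup] (fun z : tup * tup =>
    (F (Q (row_of z.1) * gaussn s (row_of z.2))%R)%:E).
  apply/measurable_EFinP; apply: (measurableT_comp mF); apply: measurable_funM => //.
  exact: (measurableT_comp mQ measurable_fst).
rewrite (@fubini_tonelli _ _ _ _ R (torus R n) mun _ m1); last by move=> z; rewrite lee_fin.
transitivity (\int[mun]_x \int[torus R n]_y (F (Q (row_of y) * gaussn (t ^+ 2 / 4) (row_of x))%R)%:E).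
  apply: eq_integral => x _ /=.
  apply: (@integral_torus_shift Q (fun r => F (r * gaussn (t ^+ 2 / 4) (row_of x))%R)) => //.
  by apply: (measurableT_comp mF); exact: measurable_funM.
rewrite -(@fubini_tonelli _ _ _ _ R (torus R n) mun _ (m2 _)); last by move=> z; rewrite lee_fin.
rewrite -ge0_integralZl//; first last.
- by rewrite lee_fin invr_ge0 exprn_ge0// ltW.
- by move=> y _; apply: integral_ge0 => x _; rewrite lee_fin.
- by apply: (measurable_fun_fubini_tonelli_F _ (m2 1%R)) => z; rewrite lee_fin.
apply: eq_integral => y _.
rewrite -(@ge0_integral_affine_tuple R n (fun=> 0%R) (t / 2) _ t20); last 2 first.
- apply/measurable_EFinP; apply: (measurableT_comp mF); apply: measurable_funM => //.
  exact: measurable_gaussn0.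
- by move=> x; rewrite lee_fin.
apply: eq_integral => x _; congr ((F (_ * _)%R)%:E).
rewrite /gaussn; apply: eq_bigr => i _; rewrite !mxE tnth_mktuple /affine /gauss add0r.
by congr (expR (- _)); field.
Qed.

End periodization.

Section trig_families.
Variables (R : realType) (n m : nat) (I : finType).
Local Notation C := R[i].
Local Notation tup := (n.-tuple (measurableTypeR R)).
Implicit Types (k : I -> 'rV[int]_n) (c : I -> 'cV[C]_m).

(** The index type is kept apart from the frequencies, so that these can be replaced while the
    coefficients keep their labels. *)
Definition trigf k c (x : 'rV[R]_n) : 'cV[C]_m :=
  \sum_i cis (dotr (lattice R (k i)) x) *: c i.

Lemma cis_lattice_periodic (k l : 'rV[int]_n) (x : 'rV[R]_n) :
  cis (dotr (lattice R k) (x + (2 * pi) *: lattice R l)) = cis (dotr (lattice R k) x).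
Proof.
rewrite (_ : dotr _ _ = dotr (lattice R k) x + 2 * pi * (\sum_i k 0 i * l 0 i)%:~R).
  exact: cis_2pi_int.
rewrite [LHS]dotrC dotrDl (dotrC x); congr (_ + _).
rewrite rmorph_sum /= mulr_sumr; apply: eq_bigr => i _.
by rewrite !mxE intrM mulrAC !mulrA.
Qed.

Lemma trigf_periodic k c : periodic (fun x => euclid (trigf k c x)).
Proof.
move=> x l; congr euclid; apply: eq_bigr => i _.
by rewrite cis_lattice_periodic.
Qed.

Lemma Cmeasurable_trigf k c j :
  Cmeasurable (fun u : tup => trigf k c (row_of u) j 0).
Proof.
rewrite /trigf; under eq_fun do rewrite summxE.
apply: Cmeasurable_sum => z; under eq_fun do rewrite mxE.
apply: CmeasurableM; last exact: Cmeasurable_cst.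
by apply: Cmeasurable_cis; exact: measurable_dotr.
Qed.

Lemma measurable_euclid_trigf k c :
  measurable_fun [set: tup] (fun u : tup => euclid (trigf k c (row_of u))).
Proof. by apply: measurable_euclid => j; exact: Cmeasurable_trigf. Qed.

Lemma trigf_bound k c : exists2 B : R, 0 <= B & forall x, euclid (trigf k c x) <= B.
Proof.
exists (\sum_i euclid (c i)); first by apply: sumr_ge0 => i _; exact: euclid_ge0.
move=> x; apply: le_trans (euclid_sum _ _ _) _; apply: ler_sum => i _.
by rewrite euclid_cis.
Qed.

End trig_families.

Lemma trig_trigf (R : realType) (n m : nat) (L : seq ('rV[int]_n * 'cV[R[i]]_m)) :
  trig (R := R) L = trigf (fun i => (tnth (in_tuple L) i).1) (fun i => (tnth (in_tuple L) i).2).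
Proof. by apply/funext => x; rewrite /trig big_tnth. Qed.

Lemma cvg_sum0 (R : realType) (J : Type) (r : seq J) (f : J -> nat -> R) :
  (forall j, f j l @[l --> \oo] --> 0) -> \sum_(j <- r) f j l @[l --> \oo] --> 0.
Proof.
move=> f0; elim: r => [|j r IH].
  by under eq_fun do rewrite big_nil; exact: cvg_cst.
have h : f j l + \sum_(j <- r) f j l @[l --> \oo] --> 0 + 0 by apply: cvgD.
rewrite addr0 in h.
by under eq_fun do rewrite big_cons; exact: h.
Qed.

Section LpNorm_algebra.
Context d (T : measurableType d) (R : realType) (m : nat).
Variable mu : {measure set T -> \bar R}.
Local Open Scope ereal_scope.
Implicit Types (p : R) (f g : T -> 'cV[R[i]]_m).

Lemma eq_LpNorm p f g : (forall x, euclid (f x) = euclid (g x)) ->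
  LpNorm mu p f = LpNorm mu p g.
Proof. by move=> fg; apply: eq_Lnorm => x; rewrite fg. Qed.

Lemma LpNormD p f g : (1 <= p)%R ->
  (forall j, Cmeasurable (fun x => f x j 0%R)) ->
  (forall j, Cmeasurable (fun x => g x j 0%R)) ->
  LpNorm mu p (fun x => (f x + g x)%R) <= LpNorm mu p f + LpNorm mu p g.
Proof.
move=> p1 mf mg; have p0 : (0 < p)%R by exact: lt_le_trans p1.
have := @minkowski_EFin _ _ R mu (fun x => euclid (f x)) (fun x => euclid (g x)) p
  (measurable_euclid mf) (measurable_euclid mg) p1.
apply: le_trans; rewrite LpNormE// unlock.
apply: gt0_ler_poweR; first by rewrite invr_ge0 ltW.
- by rewrite in_itv/= intp_ge0 leey.
- by rewrite in_itv/= leey andbT; apply: integral_ge0 => x _; rewrite ?lee_fin ?powR_ge0 ?poweR_ge0.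
apply: le_integralT => x; first by rewrite lee_fin powR_ge0.
rewrite /= lee_fin ger0_norm ?addr_ge0 ?euclid_ge0//.
by apply: ge0_ler_powR; rewrite ?nnegrE ?addr_ge0 ?euclid_ge0 ?(ltW p0)// euclidD.
Qed.

Lemma LpNormZ p (z : R[i]) f : (0 < p)%R ->
  (forall j, Cmeasurable (fun x => f x j 0%R)) ->
  LpNorm mu p (fun x => (z *: f x)%R) = (cnorm z)%:E * LpNorm mu p f.
Proof.
move=> p0 mf; rewrite !LpNormE//.
have -> : intp mu p (fun x => (z *: f x)%R) = ((cnorm z) `^ p)%:E * intp mu p f.
  rewrite /intp -ge0_integralZl//.
  - by apply: eq_integral => x _; rewrite euclidZ powRM ?euclid_ge0 ?sqrtr_ge0.
  - apply/measurable_EFinP; apply: (measurableT_comp (measurable_powR p)).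
    exact: measurable_euclid.
  - by move=> x _; rewrite lee_fin powR_ge0.
  - by rewrite lee_fin powR_ge0.
rewrite poweRM ?intp_ge0 ?lee_fin ?powR_ge0//; congr (_ * _).
by rewrite poweR_EFin -powRrM mulfV ?gt_eqF// powRr1// sqrtr_ge0.
Qed.

Lemma Cmeasurable_scale (z : R[i]) f :
  (forall j, Cmeasurable (fun x => f x j 0%R)) ->
  forall j, Cmeasurable (fun x => (z *: f x)%R j 0%R).
Proof.
move=> mf j; rewrite (_ : (fun x => _) = (fun x => z * f x j 0)%R).
  by apply: CmeasurableM => //; exact: Cmeasurable_cst.
by apply/funext => x; rewrite mxE.
Qed.

(** Minkowski's inequality, meant for the average that gives [M 0]: an operator with the averaged
    symbol is the same average of operators whose symbols use one of the averaged values each. *)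
Lemma LpNorm_convex p (J : Type) (r : seq J) (w : J -> R) (F : J -> T -> 'cV[R[i]]_m) (X : R) :
  (1 <= p)%R -> (forall s, 0 <= w s)%R ->
  (forall s j, Cmeasurable (fun x => F s x j 0%R)) ->
  (forall s, LpNorm mu p (F s) <= X%:E) ->
  LpNorm mu p (fun x => \sum_(s <- r) (w s)%:C%C *: F s x)%R <= (\sum_(s <- r) w s * X)%R%:E.
Proof.
move=> p1 w0 mF FX; have p0 : (0 < p)%R by exact: lt_le_trans p1.
elim: r => [|s r IH].
  rewrite big_nil /LpNorm (_ : (fun x => _) = cst 0) ?Lnorm0 ?eqe ?gt_eqF//.
  by apply/funext => x; rewrite big_nil euclid0.
under eq_fun do rewrite big_cons; rewrite big_cons EFinD.
apply: (le_trans (LpNormD p1 _ _)).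
- exact: Cmeasurable_scale.
- move=> j; under eq_fun do rewrite summxE.
  by apply: Cmeasurable_sum => i; exact: Cmeasurable_scale.
apply: leeD => //; rewrite LpNormZ// EFinM (_ : cnorm _ = w s).
  by apply: lee_wpmul2l => //; rewrite lee_fin.
by rewrite /cnorm sqn_real sqrtr_sqr ger0_norm.
Qed.

End LpNorm_algebra.

Lemma LpNorm_torus (R : realType) (n m : nat) (p : R) (f : n.-tuple (measurableTypeR R) -> 'cV[R[i]]_m) :
  0 < p -> LpNorm (torus_measure R n) p f = LpNorm (torus R n) p f.
Proof. by move=> p0; rewrite !LpNormE// /intp integral_torus_measure. Qed.

Section gaussian_powers.
Variables (R : realType) (n : nat).
Local Notation mun := (lebesgue_Rn R n).
Local Notation tup := (n.-tuple (measurableTypeR R)).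

Lemma gaussn_powR (s p : R) (x : 'rV[R]_n) : gaussn s x `^ p = gaussn (s * p) x.
Proof. by rewrite !gaussnE -expRM mulNr mulrAC. Qed.

Lemma integral_gaussn (s : R) : 0 < s ->
  (\int[mun]_u (gaussn s (row_of u))%:E = ((Num.sqrt pi / Num.sqrt s) ^+ n)%:E)%E.
Proof.
move=> s0; have [_ e] := Cintegral_gaussn (0 : 'rV[R]_n) (0 : 'rV[R]_n) s0.
move: (congr1 (@complex.Re R) e) => /= {e}.
have -> : dotr (0 : 'rV[R]_n) 0 = 0 by rewrite /dotr big1// => i _; rewrite mxE mul0r.
have -> : gaussn (4 * s)^-1 (0 : 'rV[R]_n) = 1.
  by rewrite /gaussn big1// => i _; rewrite mxE /gauss expr0n mulr0 oppr0 expR0.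
rewrite cos0 mul0r subr0 !mulr1 => <-.
have g1 := integrable_gaussn (0 : 'rV[R]_n) s0.
rewrite /Rintegral fineK.
  apply: eq_integral => u _; congr EFin; rewrite subr0.
  rewrite (_ : dotr _ 0 = 0) ?cos0 ?mulr1 ?mul0r ?subr0// /dotr big1// => i _.
  by rewrite !mxE mulr0.
rewrite (_ : (fun x => _) = EFin \o (fun u : tup => gaussn s (row_of u - 0))).
  exact: integrable_fin_num.
apply/funext => u /=; congr EFin; rewrite subr0.
rewrite (_ : dotr _ 0 = 0) ?cos0 ?mulr1 ?mul0r ?subr0// /dotr big1// => i _.
by rewrite !mxE mulr0.
Qed.

Lemma integral_scaled_gaussn (D s p : R) : 0 <= D -> 0 < s -> 0 < p ->
  (\int[mun]_u ((D * gaussn s (row_of u)) `^ p)%R%:E =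
   (D `^ p * (Num.sqrt pi / Num.sqrt (s * p)) ^+ n)%:E)%E.
Proof.
move=> D0 s0 p0; under eq_integral do rewrite powRM ?gaussn_ge0// gaussn_powR EFinM.
rewrite ge0_integralZl//.
- by rewrite integral_gaussn ?mulr_gt0.
- by apply/measurable_EFinP; exact: measurable_gaussn0.
- by move=> u _; rewrite lee_fin gaussn_ge0.
- by rewrite lee_fin powR_ge0.
Qed.

End gaussian_powers.

Lemma intp_trigf_fin (R : realType) (n m : nat) (q : R) (I : finType) (k : I -> 'rV[int]_n)
    (c : I -> 'cV[R[i]]_m) : 0 < q ->
  intp (torus R n) q (trigf k c \o @row_of R n) \is a fin_num.
Proof.
move=> q0; have [D D0 PD] := trigf_bound k c; rewrite ge0_fin_numE ?intp_ge0//.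
apply: le_lt_trans (_ : (\int[torus R n]_y (D `^ q)%:E < +oo)%E).
  apply: le_integralT => x; first by rewrite lee_fin powR_ge0.
  by rewrite lee_fin; apply: ge0_ler_powR; rewrite ?nnegrE ?euclid_ge0 ?(ltW q0) ?PD.
by rewrite integral_cst// [X in (_ * X)%E](torus_setT R n) mule1 ltry.
Qed.

Section restriction.
Variables (R : realType) (n m : nat) (hn : (0 < n)%N) (p p0 : R).
Hypotheses (hp0 : 1 < p0) (hp : p0 <= p).
Local Notation C := R[i].
Local Notation mun := (lebesgue_Rn R n).
Local Notation tup := (n.-tuple (measurableTypeR R)).
Variables (M : 'rV[R]_n -> 'M[R]_m) (K B : R).
Hypothesis MK : forall xi k j, `|M xi k j| <= K.
Hypothesis Mcont : forall i j xi, xi != 0 -> {for xi, continuous (fun x => M x i j)}.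
Hypothesis Mhom : forall (l : R) xi, 0 < l -> xi != 0 -> M (l *: xi) = M xi.
Hypothesis B0 : 0 <= B.
Hypothesis MB : forall f, schwartz_vec f -> norm_Rn p f != 0%E -> (norm_Rn p f < +oo)%E ->
  (norm_Rn p0 (mult_op M f) <= B%:E * norm_Rn p f)%E.

Let p0_gt0 : 0 < p0. Proof. exact: lt_trans hp0. Qed.
Let p_gt0 : 0 < p. Proof. exact: lt_le_trans hp. Qed.

Lemma measurable_entry k j : measurable_fun [set: tup] (fun u : tup => M (row_of u) k j).
Proof. by apply: (@measurable_off0 R n (fun x => M x k j)) => x x0; exact: Mcont. Qed.

Section family.
Variables (I : finType) (k : I -> 'rV[int]_n) (c : I -> 'cV[C]_m).

Lemma Cmeasurable_gmod (t : R) (b : I -> 'rV[R]_n) (c' : I -> 'cV[C]_m) j :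
  Cmeasurable (fun u : tup => gmod t b c' (row_of u) j 0).
Proof.
rewrite /gmod; under eq_fun do rewrite summxE.
apply: Cmeasurable_sum => i; under eq_fun do rewrite mxE.
apply: CmeasurableM; last exact: Cmeasurable_cst.
apply: CmeasurableM; last by apply: Cmeasurable_cis; exact: measurable_dotr.
by apply: Cmeasurable_real; exact: measurable_gaussn0.
Qed.

Lemma intp_mult_op_gmod (t : R) (b : I -> 'rV[R]_n) (c' : I -> 'cV[C]_m) (a : R) :
  0 < t -> 0 <= a -> (intp mun p (gmod t b c' \o @row_of R n) <= a%:E)%E ->
  (intp mun p0 (mult_op M (gmod t b c') \o @row_of R n) <= ((B * a `^ p^-1) `^ p0)%:E)%E.
Proof.
move=> t0 a0 ia.
(* [MB] does not cover functions of norm 0; their Fourier transform vanishes, and so does their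
   image. *)
have [i0|i0] := eqVneq (intp mun p (gmod t b c' \o @row_of R n)) 0%E.
  have -> : mult_op M (gmod t b c') = fun=> 0.
    apply/funext => x; apply/colP => j; rewrite !mxE.
    rewrite (@eq_Cintegral _ _ _ _ _ (fun=> 0)) ?Cintegral0 ?mulr0// => u.
    rewrite (_ : fourier _ _ = 0) ?mulmx0 ?mxE ?mul0r//; apply/colP => l; rewrite !mxE.
    apply: (intp_eq0_Cintegral (p := p)) i0 => //; first by move=> l'; exact: Cmeasurable_gmod.
    apply: Cmeasurable_cis; apply: measurable_funN; under eq_fun do rewrite dotrC.
    exact: measurable_dotr.
  rewrite /intp (_ : (fun x => _) = cst 0%E) ?integral0 ?lee_fin ?powR_ge0//.
  by apply/funext => u /=; rewrite euclid0 powR0// gt_eqF.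
rewrite -LpNorm_le_intp// ?mulr_ge0 ?powR_ge0//.
have nf : norm_Rn p (gmod t b c') != 0%E.
  by rewrite /norm_Rn LpNorm_eq0_intp.
have ub : (norm_Rn p (gmod t b c') <= (a `^ p^-1)%:E)%E.
  rewrite /norm_Rn LpNorm_le_intp ?powR_ge0// -powRrM mulVf ?gt_eqF//.
  by rewrite powRr1.
apply: (le_trans (MB (gmod_schwartz b c' hn t0) nf (le_lt_trans ub (ltry _)))).
by rewrite EFinM; apply: lee_wpmul2l; rewrite ?lee_fin.
Qed.

Variable xi0 : 'rV[R]_n.
Hypothesis xi0N0 : xi0 != 0.

(* At the origin [M] is replaced by its value in the direction [xi0]; this is what
   is left of [M] near 0 after the frequencies are moved by [del l *: xi0], since
   the width [tt l] of the Gaussians is small compared to this shift. *)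
Definition restr (l : 'rV[int]_n) : 'M[R]_m := if l == 0 then M xi0 else M (lattice R l).

Let P := trigf (R := R) k c.
Let Q := trigf (R := R) k (fun i => mxC (restr (k i)) *m c i).

Let del (l : nat) : R := l.+1%:R^-1.
Let tt (l : nat) : R := del l ^+ 2.
Let bb (l : nat) (i : I) : 'rV[R]_n := lattice R (k i) + del l *: xi0.
(** Translation by [y] is carried by unimodular factors on the coefficients, so that the
    frequencies, and with them the error [eta] below, are the same for all [y]. *)
Let cc (y : 'rV[R]_n) (c' : I -> 'cV[C]_m) (i : I) : 'cV[C]_m :=
  cis (dotr (lattice R (k i)) y) *: c' i.

Let del_gt0 l : 0 < del l. Proof. by rewrite invr_gt0. Qed.
Let tt_gt0 l : 0 < tt l. Proof. exact: exprn_gt0. Qed.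

Let gmod_shift l y c' x :
  euclid (gmod (tt l) (bb l) (cc y c') x) = euclid (trigf k c' (x + y)) * gaussn (tt l ^+ 2 / 4) x.
Proof.
rewrite (_ : gmod _ _ _ _ = (gaussn (tt l ^+ 2 / 4) x)%:C%C *:
    (cis (dotr (del l *: xi0) x) *: trigf k c' (x + y))).
  by rewrite euclidZr euclid_cis mulrC ger0_norm ?gaussn_ge0.
rewrite /gmod /trigf !scaler_sumr; apply: eq_bigr => i _.
rewrite /cc /bb dotrDl cisD !scalerA [dotr (lattice R (k i)) (x + y)]dotrC dotrDl cisD.
by rewrite (dotrC x) (dotrC y); congr (_ *: _); ring.
Qed.

Let err l i a j : \bar R := ((Num.sqrt pi ^- n)%:E *
  \int[mun]_u (`|M (bb l i + tt l *: row_of u) a j - restr (k i) a j| * gaussn 1 (row_of u))%:E)%E.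

Let restrK i a j : `|restr (k i) a j| <= K.
Proof. by rewrite /restr; case: ifP => _; exact: MK. Qed.

(** At frequency 0, homogeneity gives [M (del l *: xi0 + tt l *: u) = M (xi0 + del l *: u)], because
    [tt l] is the square of [del l]; at the other frequencies [M] is continuous at the lattice
    point. *)
Let symbol_cvg i a j (u : 'rV[R]_n) :
  M (bb l i + tt l *: u) a j - restr (k i) a j @[l --> \oo] --> 0.
Proof.
have cvZ (s : nat -> R) (v : 'rV[R]_n) : s l @[l --> \oo] --> 0 ->
    (fun l => s l *: v) @ \oo --> (0 : 'rV[R]_n).
  by move=> s0; rewrite -(scale0r v); apply: cvgZr_tmp.
rewrite /restr /bb; have d0 : del l @[l --> \oo] --> 0 by exact: cvg_harmonic.
have t0 : tt l @[l --> \oo] --> 0.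
  by rewrite -[X in _ --> X](mulr0 0); apply: cvgM.
apply/subr_cvg0; have [ki0|ki0] := eqVneq (k i) 0.
  have cv : xi0 + del l *: u @[l --> \oo] --> xi0.
    by rewrite -[X in _ --> X](addr0 xi0); apply: cvgD; [exact: cvg_cst|exact: cvZ].
  have E : \forall l \near \oo, M (xi0 + del l *: u) a j = M (lattice R (k i) + del l *: xi0 + tt l *: u) a j.
    have nz : \forall l \near \oo, xi0 + del l *: u != 0 by exact: (cvgr_neq0 _ cv xi0N0).
    apply: filterS nz => l h.
    rewrite ki0 (_ : lattice R 0 = 0) ?add0r; last by apply/rowP => q; rewrite !mxE.
    rewrite -(Mhom (del_gt0 l) h) scalerDr scalerA -expr2.
    by [].
  apply: cvg_trans (near_eq_cvg E) _.
  apply: (@cvg_comp _ _ _ (fun l => xi0 + del l *: u) (fun x => M x a j)); last exact: Mcont.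
  exact: cv.
have lk0 : lattice R (k i) != 0.
  apply: contra ki0 => /eqP/rowP h; apply/eqP/rowP => q.
  by have := h q; rewrite !mxE => /eqP; rewrite intr_eq0 => /eqP.
have cv : lattice R (k i) + del l *: xi0 + tt l *: u @[l --> \oo] --> lattice R (k i).
  rewrite -[X in _ --> X](addr0 (lattice R (k i))) -[X in _ --> X](addr0 (_ + _)).
  by apply: cvgD; [apply: cvgD; [exact: cvg_cst|exact: cvZ]|exact: cvZ].
apply: (@cvg_comp _ _ _ (fun l => lattice R (k i) + del l *: xi0 + tt l *: u) (fun x => M x a j)); last exact: Mcont.
exact: cv.
Qed.

Let err_cvg i a j : (err l i a j @[l --> \oo] --> 0)%E.
Proof.
apply: (@gauss_op_cvg0 R n (fun l x => M x a j - restr (k i) a j) (fun l => bb l i) tt (K + K)).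
- move=> l; apply: (@measurable_affine_row _ _ (fun x => M x a j - restr (k i) a j)).
  by apply: measurable_funB => //; exact: measurable_entry.
- by move=> l x; rewrite (le_trans (ler_normB _ _))// lerD.
- exact: symbol_cvg.
Qed.

Let eta l : R := (\sum_i \sum_a \sum_j fine (err l i a j)) *
  (\sum_i \sum_j cnorm (c i j 0) * (2 * m)%:R).

Let eta_cvg : eta l @[l --> \oo] --> 0.
Proof.
rewrite /eta -[X in _ --> X](mul0r (\sum_i \sum_j cnorm (c i j 0) * (2 * m)%:R)).
apply: cvgMl.
apply: cvg_sum0 => i; apply: cvg_sum0 => a; apply: cvg_sum0 => j.
by have /fine_cvg := err_cvg i a j.
Qed.

Let err_fin l i a j : err l i a j \is a fin_num.
Proof.
rewrite fin_numM//; apply: integrable_fin_num => //.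
have g1 : mun.-integrable setT (EFin \o (fun u : tup => (K + K) * gaussn 1 (row_of u - 0))).
  rewrite (_ : _ \o _ = (fun u => (K + K)%:E * (EFin \o (fun u : tup => gaussn 1 (row_of u - 0))) u)%E)//.
  by apply: integrableZl => //; exact: integrable_gaussn.
apply: le_integrable g1 => //.
- apply/measurable_EFinP; apply: measurable_funM; last exact: measurable_gaussn0.
  apply: measurableT_comp => //.
  apply: (@measurable_affine_row _ _ (fun x => M x a j - restr (k i) a j)).
  by apply: measurable_funB => //; exact: measurable_entry.
- move=> u _ /=; rewrite lee_fin subr0 !normrM normr_id ler_wpM2r//.
  rewrite (le_trans (ler_normB _ _))// (le_trans (lerD (MK _ _ _) (restrK _ _ _)))//.
  exact: ler_norm.
Qed.

Let err_ge0 l i a j : 0 <= fine (err l i a j).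
Proof.
apply: fine_ge0; apply: mule_ge0.
  by rewrite lee_fin invr_ge0 exprn_ge0// sqrtr_ge0.
by apply: integral_ge0 => u _; rewrite lee_fin mulr_ge0// gaussn_ge0.
Qed.

Let le_err_sum l i a j :
  fine (err l i a j) <= \sum_i \sum_a \sum_j fine (err l i a j).
Proof.
rewrite (bigD1 i)//= (bigD1 a)//= (bigD1 j)//= -!addrA lerDl.
rewrite !addr_ge0 ?sumr_ge0// => *; rewrite ?sumr_ge0// => *; rewrite ?sumr_ge0// => *; exact: err_ge0.
Qed.

Let mult_op_lower l (y x : 'rV[R]_n) :
  Num.max (euclid (Q (x + y)) * gaussn (tt l ^+ 2 / 4) x - eta l) 0 <=
  euclid (mult_op M (gmod (tt l) (bb l) (cc y c)) x).
Proof.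
rewrite ge_max euclid_ge0 andbT lerBlDr.
have E : gmod (tt l) (bb l) (fun i => mxC (restr (k i)) *m cc y c i) x =
    gmod (tt l) (bb l) (cc y (fun i => mxC (restr (k i)) *m c i)) x.
  by apply: eq_bigr => i _; rewrite /cc -scalemxAr.
rewrite -gmod_shift -E -lerBlDl.
have := @mult_op_gmod_approx R n m I M (fun i => restr (k i)) (tt l) K
  (\sum_i \sum_a \sum_j fine (err l i a j)) (bb l) (cc y c) x (tt_gt0 l)
  measurable_entry MK restrK.
have -> : \sum_i \sum_j cnorm (cc y c i j 0) * (2 * m)%:R = \sum_i \sum_j cnorm (c i j 0) * (2 * m)%:R.
  by apply: eq_bigr => i _; apply: eq_bigr => j _; rewrite /cc mxE cnormM cnorm_cis mul1r.
move=> H; apply: le_trans (H _).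
  by rewrite (le_trans (ler_norm _))// distrC euclidB_le.
move=> i a j.
have mh : measurable_fun [set: tup] (fun u : tup => M (row_of u) a j - restr (k i) a j).
  by apply: measurable_funB => //; exact: measurable_entry.
have hb (z : 'rV[R]_n) : `|M z a j - restr (k i) a j| <= K + K.
  by rewrite (le_trans (ler_normB _ _))// lerD.
have [h1 h2] := @gauss_op_le R n (fun z => M z a j - restr (k i) a j) (bb l i) (tt l) x (K + K) (tt_gt0 l) mh hb.
split; apply: le_trans (le_err_sum l i a j); rewrite -lee_fin fineK ?err_fin//.
Qed.

Let trunc_le l (y : tup) :
  (\int[mun]_x (Num.max (euclid (Q (row_of x + row_of y)) * gaussn (tt l ^+ 2 / 4) (row_of x) - eta l) 0 `^ p0)%R%:E
   <= intp mun p0 (mult_op M (gmod (tt l) (bb l) (cc (row_of y) c)) \o @row_of R n))%E.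
Proof.
apply: le_integralT => x; first by rewrite lee_fin powR_ge0.
rewrite lee_fin; apply: ge0_ler_powR; rewrite ?nnegrE ?euclid_ge0 ?(ltW p0_gt0)//.
by rewrite le_max lexx orbT.
Qed.

Let intp_gmod l (y : tup) :
  intp mun p (gmod (tt l) (bb l) (cc (row_of y) c) \o @row_of R n) =
  (\int[mun]_x ((euclid (P (row_of x + row_of y)) * gaussn (tt l ^+ 2 / 4) (row_of x)) `^ p)%R%:E)%E.
Proof. by apply: eq_integral => x _; rewrite /comp gmod_shift. Qed.

Let TT l : R := (tt l / 2) ^+ n.
Let TT_gt0 l : 0 < TT l. Proof. by rewrite exprn_gt0// divr_gt0. Qed.
Let G : R := (Num.sqrt pi / Num.sqrt p) ^+ n.
Let G0 : R := (Num.sqrt pi / Num.sqrt p0) ^+ n.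
Let G_gt0 : 0 < G. Proof. by rewrite exprn_gt0// divr_gt0// sqrtr_gt0// pi_gt0. Qed.
Let G0_gt0 : 0 < G0. Proof. by rewrite exprn_gt0// divr_gt0// sqrtr_gt0// pi_gt0. Qed.

Let trunc (q e r : R) : R := Num.max (r - e) 0 `^ q.

Let measurable_trunc q e : measurable_fun setT (trunc q e).
Proof.
apply: (measurableT_comp (measurable_powR q)).
by apply: measurable_maxr => //; exact: measurable_funB.
Qed.

Let integral_product (q : R) (F : 'rV[R]_n -> R) : 0 < q ->
  measurable_fun [set: tup] (fun u : tup => F (row_of u)) -> (forall x, 0 <= F x) ->
  (\int[torus R n]_y \int[mun]_x ((F (row_of y) * gaussn 1 (row_of x)) `^ q)%R%:E =
  ((Num.sqrt pi / Num.sqrt q) ^+ n)%:E * \int[torus R n]_y (F (row_of y) `^ q)%R%:E)%E.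
Proof.
move=> q0 mF F0.
under eq_integral do rewrite integral_scaled_gaussn// mul1r EFinM muleC.
rewrite ge0_integralZl//.
- by apply/measurable_EFinP; exact: (measurableT_comp (measurable_powR q)).
- by move=> y _; rewrite lee_fin powR_ge0.
Qed.

Let periodized_trunc l :
  (\int[torus R n]_y \int[mun]_x
    (trunc p0 (eta l) (euclid (Q (row_of x + row_of y)) * gaussn (tt l ^+ 2 / 4) (row_of x)))%:E =
  ((TT l)^-1)%:E * \int[torus R n]_y \int[mun]_x
    (trunc p0 (eta l) (euclid (Q (row_of y)) * gaussn 1 (row_of x)))%:E)%E.
Proof.
apply: (@periodization R n (fun x => euclid (Q x)) (trunc p0 (eta l)) (tt l)).
- exact: trigf_periodic.
- exact: measurable_euclid_trigf.
- exact: measurable_trunc.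
- by move=> r; exact: powR_ge0.
- exact: tt_gt0.
Qed.

Let periodized_powR l :
  (\int[torus R n]_y \int[mun]_x
    ((euclid (P (row_of x + row_of y)) * gaussn (tt l ^+ 2 / 4) (row_of x)) `^ p)%R%:E =
  ((TT l)^-1)%:E * \int[torus R n]_y \int[mun]_x
    ((euclid (P (row_of y)) * gaussn 1 (row_of x)) `^ p)%R%:E)%E.
Proof.
apply: (@periodization R n (fun x => euclid (P x)) (fun r => r `^ p) (tt l)).
- exact: trigf_periodic.
- exact: measurable_euclid_trigf.
- exact: measurable_powR.
- by move=> r; exact: powR_ge0.
- exact: tt_gt0.
Qed.

(** Periodization makes a factor [(TT l)^-1] explicit on the left. Once it is cancelled, [l] enters
    there only through [eta l], which [integral_powR_trunc] sends to 0. *)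
Let restriction_limit (C_ : nat -> R) (X : R) :
  (forall l, (\int[torus R n]_y \int[mun]_x
    (trunc p0 (eta l) (euclid (Q (row_of x + row_of y)) * gaussn (tt l ^+ 2 / 4) (row_of x)))%:E
      <= ((TT l)^-1 * C_ l)%:E)%E) ->
  C_ l @[l --> \oo] --> X ->
  (G0%:E * intp (torus R n) p0 (Q \o @row_of R n) <= X%:E)%E.
Proof.
move=> CC CX.
rewrite /G0 /intp -(integral_product (F := fun x => euclid (Q x)))//; last first.
- by move=> x; exact: euclid_ge0.
- exact: measurable_euclid_trigf.
pose h (z : tup * tup) := euclid (Q (row_of z.1)) * gaussn 1 (row_of z.2).
have mh : measurable_fun [set: tup * tup] h.
  apply: measurable_funM.
  - exact: (measurableT_comp (measurable_euclid_trigf _ _) measurable_fst).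
  - exact: (measurableT_comp (measurable_gaussn0 1) measurable_snd).
have h0 z : 0 <= h z by rewrite mulr_ge0 ?euclid_ge0 ?gaussn_ge0.
have E : (\int[torus R n]_y \int[mun]_x ((euclid (Q (row_of y)) * gaussn 1 (row_of x)) `^ p0)%R%:E =
    \int[(torus R n \x mun)%E]_z ((h z) `^ p0)%:E)%E.
  rewrite fubini_tonelli1//; last by move=> z; rewrite lee_fin powR_ge0.
  by apply/measurable_EFinP; exact: (measurableT_comp (measurable_powR p0)).
rewrite E; apply: (integral_powR_trunc (ltW hp0) mh h0 eta_cvg CX) => l.
rewrite fubini_tonelli1//; last 2 first.
- by apply/measurable_EFinP; exact: (measurableT_comp (measurable_trunc p0 (eta l))).
- by move=> z; rewrite lee_fin powR_ge0.
have h1 := eq_ind _ (fun z => z <= _)%E (CC l) _ (periodized_trunc l).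
by rewrite -(@lee_pmul2l _ ((TT l)^-1)%:E) -?EFinM// lte_fin invr_gt0.
Qed.

Let PB : exists2 D : R, 0 <= D & forall x, euclid (P x) <= D.
Proof. exact: trigf_bound. Qed.

Let intp_P_fin l y : exists2 a : R, 0 <= a &
  intp mun p (gmod (tt l) (bb l) (cc (row_of y) c) \o @row_of R n) = a%:E.
Proof.
have [D D0 PD] := PB.
exists (fine (intp mun p (gmod (tt l) (bb l) (cc (row_of y) c) \o @row_of R n))).
  by apply: fine_ge0; exact: intp_ge0.
rewrite fineK// ge0_fin_numE ?intp_ge0// intp_gmod.
have s0 : 0 < tt l ^+ 2 / 4 by rewrite divr_gt0// exprn_gt0.
apply: le_lt_trans (_ : (\int[mun]_x ((D * gaussn (tt l ^+ 2 / 4) (row_of x)) `^ p)%R%:E < +oo)%E).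
  apply: le_integralT => x; first by rewrite lee_fin powR_ge0.
  rewrite lee_fin; apply: ge0_ler_powR; rewrite ?nnegrE ?mulr_ge0 ?euclid_ge0 ?gaussn_ge0 ?(ltW p_gt0)//.
  by rewrite ler_wpM2r ?gaussn_ge0.
by rewrite integral_scaled_gaussn// ltry.
Qed.

(** With equal exponents both sides carry the same factor [(TT l)^-1], and the Gaussian integrals
    [G0] and [G] coincide, so that only the torus integrals and the power of [B] remain. *)
Lemma restriction_eq : p0 = p ->
  (intp (torus R n) p0 (Q \o @row_of R n) <= (B `^ p)%:E * intp (torus R n) p (P \o @row_of R n))%E.
Proof.
move=> pE.
have mPs s : measurable_fun [set: tup * tup] (fun z : tup * tup =>
    ((euclid (P (row_of z.2 + row_of z.1)) * gaussn s (row_of z.2)) `^ p)%R%:E).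
  apply/measurable_EFinP; apply: (measurableT_comp (measurable_powR p)); apply: measurable_funM.
    under eq_fun do rewrite addrC.
    exact: (measurable_shifted (Q := fun x => euclid (P x)) (measurable_euclid_trigf _ _)).
  exact: (measurableT_comp (measurable_gaussn0 s) measurable_snd).
have PL : intp (torus R n) p (P \o @row_of R n) \is a fin_num by exact: intp_trigf_fin.
have key := @restriction_limit (fun=> B `^ p * G * fine (intp (torus R n) p (P \o @row_of R n)))
  (B `^ p * G * fine (intp (torus R n) p (P \o @row_of R n))) _ (@cvg_cst _ _ _ _ _).
have {key} : (G0%:E * intp (torus R n) p0 (Q \o @row_of R n) <=
    (B `^ p * G * fine (intp (torus R n) p (P \o @row_of R n)))%:E)%E.
  apply: key => l.
  apply: (@le_trans _ _ (\int[torus R n]_y ((B `^ p)%:E * \int[mun]_x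
     ((euclid (P (row_of x + row_of y)) * gaussn (tt l ^+ 2 / 4) (row_of x)) `^ p)%R%:E))%E).
    apply: le_integralT => y; first by apply: integral_ge0 => x _; rewrite lee_fin powR_ge0.
    apply: (le_trans (trunc_le l y)); have [a a0 aE] := intp_P_fin l y.
    rewrite -intp_gmod aE.
    have ia : (intp mun p (gmod (tt l) (bb l) (cc (row_of y) c) \o @row_of R n) <= a%:E)%E by rewrite aE.
    apply: (le_trans (intp_mult_op_gmod (tt_gt0 l) a0 ia)).
    rewrite pE powRM ?powR_ge0// -powRrM mulVf ?gt_eqF// powRr1// -EFinM.
  rewrite ge0_integralZl; [|exact: measurableT| | |by rewrite lee_fin powR_ge0].
  all: first [by move=> y _; apply: integral_ge0 => x _; rewrite lee_fin powR_ge0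
             |by apply: (measurable_fun_fubini_tonelli_F _ (mPs _)) => z; rewrite lee_fin powR_ge0|idtac].
  rewrite [X in (_ * X)%E](periodized_powR l).
  rewrite (integral_product (F := fun x => euclid (P x)))//; first last.
  - by move=> x; exact: euclid_ge0.
  - exact: measurable_euclid_trigf.
  rewrite -/G (_ : (\int[torus R n]_y _)%E = (fine (intp (torus R n) p (P \o @row_of R n)))%:E); last first.
    by rewrite fineK.
  rewrite -!EFinM lee_fin.
  rewrite le_eqVlt; apply/orP; left; apply/eqP; rewrite /TT; ring.
rewrite (_ : G0 = G); last by rewrite /G0 pE.
rewrite -(mulrC G) -!mulrA EFinM lee_pmul2l ?lte_fin//.
by rewrite EFinM fineK.
Qed.

Let TT_cvg0 : TT l @[l --> \oo] --> 0.
Proof.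
have t0 : tt l / 2 @[l --> \oo] --> 0.
  rewrite -[X in _ --> X](mul0r (2^-1)); apply: cvgMl.
  by rewrite -[X in _ --> X](mulr0 0); apply: cvgM; exact: cvg_harmonic.
rewrite /TT; case: n hn => // n' _.
elim: n' => [|n' IH]; first by under eq_fun do rewrite expr1.
have h := cvgM t0 IH.
by rewrite mulr0 in h; under eq_fun do rewrite exprS; exact: h.
Qed.

Let powR_TT_cvg0 (e : R) : 0 < e -> TT l `^ e @[l --> \oo] --> 0.
Proof.
move=> e0; have /cvg_at_rightP := @powR_cvg0 R e e0; apply; split; first exact: TT_gt0.
exact: TT_cvg0.
Qed.

Lemma restriction_lt : p0 < p -> intp (torus R n) p0 (Q \o @row_of R n) = 0%E.
Proof.
move=> plt; have [D D0 PD] := PB.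
have e0 : 0 < 1 - p0 / p by rewrite subr_gt0 ltr_pdivrMr// mul1r.
(* The crude bound of [P] by [D] suffices: the right side grows like the power [- p0 / p] of [TT l],
   the left one like [(TT l)^-1], so their quotient tends to 0. *)
pose A := (B * (D `^ p * G) `^ p^-1) `^ p0.
have CX : A * TT l `^ (1 - p0 / p) @[l --> \oo] --> 0.
  by rewrite -[X in _ --> X](mulr0 A); apply: cvgMr; exact: powR_TT_cvg0.
have : (G0%:E * intp (torus R n) p0 (Q \o @row_of R n) <= 0%:E)%E.
  apply: restriction_limit CX => l.
  apply: (@le_trans _ _ (\int[torus R n]_y (((B * (D `^ p * G / TT l) `^ p^-1) `^ p0)%:E))%E).
    apply: le_integralT => y; first by apply: integral_ge0 => x _; rewrite lee_fin powR_ge0.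
    apply: (le_trans (trunc_le l y)); apply: intp_mult_op_gmod => //.
      by rewrite mulr_ge0 ?mulr_ge0 ?powR_ge0 ?invr_ge0 ?(ltW G_gt0) ?(ltW (TT_gt0 l)).
    rewrite intp_gmod.
    apply: le_trans (_ : (\int[mun]_x ((D * gaussn (tt l ^+ 2 / 4) (row_of x)) `^ p)%R%:E <= _)%E).
      apply: le_integralT => x; first by rewrite lee_fin powR_ge0.
      rewrite lee_fin; apply: ge0_ler_powR; rewrite ?nnegrE ?mulr_ge0 ?euclid_ge0 ?gaussn_ge0 ?(ltW p_gt0)//.
      by rewrite ler_wpM2r ?gaussn_ge0.
    rewrite integral_scaled_gaussn//; last by rewrite divr_gt0// exprn_gt0.
    rewrite lee_fin -[leRHS]mulrA ler_wpM2l ?powR_ge0// /G /TT -exprVn -exprMn.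
    rewrite sqrtrM; last by rewrite divr_ge0// sqr_ge0.
    rewrite (_ : Num.sqrt (tt l ^+ 2 / 4) = tt l / 2); last first.
      have -> : tt l ^+ 2 / 4 = (tt l / 2) ^+ 2 by move: (tt l) => r; field.
      by rewrite sqrtr_sqr ger0_norm// divr_ge0// ltW.
    by rewrite invfM mulrA mulrAC.
  rewrite integral_cst// [X in (_ * X)%E](torus_setT R n) mule1 lee_fin.
  rewrite le_eqVlt; apply/orP; left; apply/eqP; rewrite /A.
  have : 0 <= D `^ p * G by rewrite mulr_ge0 ?powR_ge0 ?(ltW G_gt0).
  move: (D `^ p * G) (TT_gt0 l) => X; move: (TT l) => T T0 X0.
  rewrite (powRM _ X0) ?invr_ge0 ?(ltW T0)// mulrA (powRM _ (mulr_ge0 B0 (powR_ge0 _ _)) (powR_ge0 _ _)).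
  rewrite mulrCA; congr (_ * _).
  rewrite -powR_inv1 ?(ltW T0)// -!powRrM -powRD; last by rewrite (gt_eqF T0) implybT.
  by congr (_ `^ _); ring.
rewrite pmule_rle0 ?lte_fin// => h; apply/eqP; rewrite eq_le h; exact: intp_ge0.
Qed.

End family.

End restriction.

Lemma lee_pdivrMr_fin (R : realType) (x y z : \bar R) :
  (0 <= y -> y != 0 -> y < +oo -> (x / y <= z) = (x <= z * y))%E.
Proof.
move=> y0 yN0 yoo; have yf : y \is a fin_num by rewrite ge0_fin_numE.
have y1 : (0 < fine y)%R by rewrite fine_gt0// lt0e yN0 y0.
by rewrite -(fineK yf) inver gt_eqF// lee_pdivrMr.
Qed.

(** * Comparison of the two operator norms *)

Section multiplier_norms.
Variables (R : realType) (n m : nat) (hn : (0 < n)%N) (hm : (0 < m)%N) (p p0 : R).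
Hypotheses (hp0 : 1 < p0) (hp : p0 <= p).
Local Notation C := R[i].
Local Notation mun := (lebesgue_Rn R n).
Local Notation tup := (n.-tuple (measurableTypeR R)).
Variables (M : 'rV[R]_n -> 'M[R]_m).
Hypothesis hM : is_multiplier p p0 M.
Local Open Scope ereal_scope.

Let p0_gt0 : (0 < p0)%R. Proof. exact: lt_trans hp0. Qed.
Let p_gt0 : (0 < p)%R. Proof. exact: lt_le_trans hp. Qed.

Lemma LpNorm_ratio_ge0 d d' (T : measurableType d) (T' : measurableType d')
    (mu : {measure set T -> \bar R}) (mu' : {measure set T' -> \bar R}) (q q' : R)
    (f : T -> 'cV[C]_m) (g : T' -> 'cV[C]_m) :
  0 <= LpNorm mu q f / LpNorm mu' q' g.
Proof. by rewrite mule_ge0 ?inve_ge0 ?LpNorm_ge0. Qed.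

(** The supremum of an empty set would be [-oo]; a Gaussian times a fixed nonzero vector provides
    one quotient, and quotients are nonnegative. *)
Lemma mult_norm_ge0 : 0 <= mult_norm p p0 M.
Proof.
pose v : 'cV[C]_m := const_mx 1%R.
pose f := gmod 1 (fun _ : 'I_1 => 0 : 'rV[R]_n)%R (fun=> v).
have v0 : (0 < euclid v)%R.
  rewrite lt0r euclid_ge0 andbT; apply/eqP => /euclid_eq0/colP/(_ (Ordinal hm)).
  by rewrite !mxE => /eqP; rewrite oner_eq0.
have fE (x : 'rV[R]_n) : euclid (f x) = (euclid v * gaussn (1 ^+ 2 / 4) x)%R.
  rewrite /f /gmod big_ord1 euclidZ sqnM sqn_cis mulr1 sqn_real sqrtr_sqr mulrC.
  by rewrite ger0_norm ?gaussn_ge0.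
have s0 : (0 < 1 ^+ 2 / 4 :> R)%R by rewrite expr1n mul1r invr_gt0.
have nf : norm_Rn p f != 0.
  rewrite /norm_Rn LpNorm_eq0_intp// /intp.
  under eq_integral do rewrite /comp fE.
  rewrite integral_scaled_gaussn ?(ltW v0)// eqe mulf_neq0 ?gt_eqF ?powR_gt0//.
  by rewrite exprn_gt0// divr_gt0 ?sqrtr_gt0 ?pi_gt0 ?mulr_gt0.
apply: le_trans (LpNorm_ratio_ge0 mun mun p0 p (mult_op M f \o @row_of R n) (f \o @row_of R n)) _.
by apply: ereal_sup_ubound; exists f => //; split => //; exact: gmod_schwartz.
Qed.

Let B : R := fine (mult_norm p p0 M).

Let B_fin : B%:E = mult_norm p p0 M.
Proof. by rewrite fineK// ge0_fin_numE ?mult_norm_ge0//; exact: mult_Lp_bounded hM. Qed.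

Let B_ge0 : (0 <= B)%R.
Proof. by rewrite -lee_fin B_fin mult_norm_ge0. Qed.

Lemma mult_norm_bound f : schwartz_vec f -> norm_Rn p f != 0 -> norm_Rn p f < +oo ->
  norm_Rn p0 (mult_op M f) <= B%:E * norm_Rn p f.
Proof.
move=> sf nf ff.
rewrite -lee_pdivrMr_fin ?LpNorm_ge0//.
by rewrite B_fin; apply: ereal_sup_ubound; exists f.
Qed.

Let hcont := mult_continuous hM.
Let hhom := mult_homogeneous hM.

(** [restriction_lt] is used for a constant polynomial: [restr] takes the value [M xi] at frequency
    0, so that each column of [M xi] has norm 0. *)
Lemma mult_eq0_lt xi : (p0 < p)%R -> (xi != 0)%R -> M xi = 0%R.
Proof.
move=> plt xi0; have [K MK] := mult_bounded hM.
apply/matrixP => a j; rewrite mxE.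
have := @restriction_lt R n m hn p p0 hp0 hp M K B MK hcont hhom B_ge0 mult_norm_bound
  'I_1 (fun=> 0%R) (fun=> delta_mx j 0%R) xi xi0 plt.
rewrite /restr eqxx /intp.
have E (x : 'rV[R]_n) : euclid (trigf (R := R) (fun _ : 'I_1 => 0%R) (fun _ : 'I_1 => mxC (M xi) *m delta_mx j 0%R) x) =
    euclid (col j (mxC (M xi))).
  by rewrite /trigf big_ord1 euclid_cis -colE.
under eq_integral do rewrite /comp E.
rewrite integral_cst// [X in _ * X](torus_setT R n) mule1 => -[] /eqP.
rewrite powR_eq0 => /andP[/eqP/euclid_eq0/colP/(_ a)] + _.
by rewrite !mxE => -[].
Qed.

Lemma LpNorm_trigf_fin (q : R) (I : finType) (k : I -> 'rV[int]_n) (c : I -> 'cV[C]_m) : (0 < q)%R ->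
  LpNorm (torus R n) q (trigf (R := R) k c \o @row_of R n) < +oo.
Proof.
by move=> q0; rewrite LpNormE// -(fineK (intp_trigf_fin k c q0)) poweR_EFin ltry.
Qed.

Hypothesis hM0 : averaged_at_0 M.

Lemma disc_mult_op_bound f : trig_poly f ->
  norm_Tn p0 (disc_mult_op M f) <= B%:E * norm_Tn p f.
Proof.
move=> /trig_polyP[L ->{f}]; rewrite disc_mult_opE /norm_Tn !LpNorm_torus//.
pose k i := (tnth (in_tuple L) i).1; pose c i := (tnth (in_tuple L) i).2.
have [K MK] := mult_bounded hM.
have [s [w [xi [w0 w1 xi0 M0]]]] := hM0.
(* On the lattice [M] is the average of the [restr M (xi i)], which differ from each other only at
   the origin. *)
have ME l : mxC (M (lattice R l)) = (\sum_i (w i)%:C%C *: mxC (restr M (xi i) l))%R.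
  rewrite /restr; have [->|l0] := eqVneq l 0%R.
    rewrite (_ : lattice R 0 = 0%R) ?M0; last by apply/rowP => i; rewrite !mxE.
    apply/matrixP => a b; rewrite mxE !summxE rmorph_sum.
    by apply: eq_bigr => i _; rewrite !mxE rmorphM.
  by rewrite -scaler_suml -rmorph_sum w1 scale1r.
pose Q i := trigf (R := R) k (fun z => mxC (restr M (xi i) (k z)) *m c z).
have QE : trig (R := R) [seq (z.1, mxC (M (lattice R z.1)) *m z.2) | z <- L] =
    (fun x => \sum_i (w i)%:C%C *: Q i x)%R.
  apply/funext => x; rewrite /trig big_map /Q /trigf.
  under [RHS]eq_bigr do rewrite scaler_sumr.
  rewrite exchange_big /= big_tnth; apply: eq_bigr => z _.
  rewrite ME mulmx_suml scaler_sumr; apply: eq_bigr => i _.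
  by rewrite -scalemxAl !scalerA mulrC.
have NP := LpNorm_trigf_fin k c p_gt0.
rewrite QE trig_trigf -/k -/c.
set N := LpNorm _ p _ in NP *.
have Nfin : N \is a fin_num by rewrite ge0_fin_numE ?LpNorm_ge0.
have N0 : (0 <= fine N)%R by rewrite fine_ge0 ?LpNorm_ge0.
rewrite -(fineK Nfin) -EFinM.
have -> : (B * fine N = \sum_i w i * (B * fine N))%R by rewrite -mulr_suml w1 mul1r.
apply: (@LpNorm_convex _ _ _ _ _ p0 _ _ w (fun i => Q i \o @row_of R n)) => //.
- exact: ltW.
- by move=> i j; exact: Cmeasurable_trigf.
move=> i; rewrite LpNorm_le_intp ?mulr_ge0//.
have [pE|plt] := eqVneq p0 p.
  have := @restriction_eq R n m hn p p0 hp0 hp M K B MK hcont hhom B_ge0 mult_norm_bound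
    _ k c (xi i) (xi0 i) pE.
  move=> /le_trans; apply.
  by rewrite -LpNorm_intp// -/N -(fineK Nfin) poweR_EFin pE powRM.
have := @restriction_lt R n m hn p p0 hp0 hp M K B MK hcont hhom B_ge0 mult_norm_bound
  _ k c (xi i) (xi0 i).
by rewrite lt_neqAle plt hp => -> //; rewrite lee_fin powR_ge0.
Qed.

Lemma disc_mult_norm_le : disc_mult_norm p p0 M <= mult_norm p p0 M.
Proof.
apply: ge_ereal_sup => _ [f [tf nf] <-].
have fin : norm_Tn p f < +oo.
  have /trig_polyP[L ->] := tf.
  by rewrite /norm_Tn LpNorm_torus// trig_trigf; exact: LpNorm_trigf_fin.
rewrite -B_fin lee_pdivrMr_fin ?LpNorm_ge0//.
exact: disc_mult_op_bound.
Qed.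

Lemma averaged_at_0_eq0 : (forall xi, xi != 0 -> M xi = 0)%R -> forall xi, M xi = 0%R.
Proof.
move=> h xi; have [->|/h//] := eqVneq xi 0%R.
have [s [w [x [_ _ x0 ->]]]] := hM0.
by rewrite big1// => i _; rewrite h// scaler0.
Qed.

End multiplier_norms.

(** * Transference to higher dimensional tori *)

Lemma euclid_mxC_le (R : realType) m (D : 'M[R]_m) (c : 'cV[R[i]]_m) :
  euclid (mxC D *m c) <=
  \sum_a \sum_b `|D a b| * (`|complex.Re (c b 0)| + `|complex.Im (c b 0)|).
Proof.
apply: le_trans (euclid_le_sum _) _; apply: ler_sum => a _.
under [leRHS]eq_bigr do rewrite mulrDr.
rewrite big_split /= mxE !raddf_sum; apply: lerD; apply: le_trans (ler_norm_sum _ _ _) _;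
  apply: ler_sum => b _; rewrite -normrM mxE; case: (c b 0) => x y /=.
- by rewrite mul0r subr0.
- by rewrite mul0r addr0.
Qed.

Section transference.
Variables (R : realType) (n m : nat) (p K : R) (M : 'rV[R]_n -> 'M[R]_m).
Hypothesis hp : 1 < p.
Local Notation C := R[i].
Local Notation tup n := (n.-tuple (measurableTypeR R)).
Hypothesis Mcont : forall i j xi, xi != 0 -> {for xi, continuous (fun x => M x i j)}.
Hypothesis Mhom : forall (l : R) xi, 0 < l -> xi != 0 -> M (l *: xi) = M xi.
Hypothesis Meven : forall xi, M (- xi) = M xi.
Hypothesis disc_bound : forall (I : finType) (k : I -> 'rV[int]_n) (c : I -> 'cV[C]_m),
  (intp (torus R n) p (trigf k (fun i => mxC (M (lattice R (k i))) *m c i) \o @row_of R n) <=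
   (K `^ p)%:E * intp (torus R n) p (trigf k c \o @row_of R n))%E.

Let p_gt0 : 0 < p. Proof. exact: lt_trans hp. Qed.

(** Only directions matter, by homogeneity, so the [x l] themselves may go to infinity as long as
    some positive rescaling of them converges. *)
Lemma symbol_direction_cvg (a : nat -> R) (x : nat -> 'rV[R]_n) (y : 'rV[R]_n) i j :
  (forall l, 0 < a l) -> a l *: x l @[l --> \oo] --> y -> y != 0 ->
  M (x l) i j @[l --> \oo] --> M y i j.
Proof.
move=> a0 axy y0.
have E : \forall l \near \oo, M (a l *: x l) i j = M (x l) i j.
  have nz : \forall l \near \oo, a l *: x l != 0 by exact: (cvgr_neq0 _ axy y0).
  apply: filterS nz => l h; rewrite Mhom//.
  by apply: contra h => /eqP ->; rewrite scaler0.
apply: cvg_trans (near_eq_cvg E) _.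
by apply: (@cvg_comp _ _ _ (fun l => a l *: x l) (fun x => M x i j)); [exact: axy|exact: Mcont].
Qed.

(** The top coordinate of a frequency can be negative, which reverses the limiting direction;
    evenness of [M] makes this harmless. *)
Lemma symbol_int (q : int) xi : q != 0 -> xi != 0 -> M (q%:~R *: xi) = M xi.
Proof.
move=> q0 xi0; have : 0 < `|q%:~R : R| by rewrite normr_gt0 intr_eq0.
have [q1|q1] := ltP 0 (q%:~R : R); first by rewrite gtr0_norm// => _; rewrite Mhom.
by rewrite ler0_norm// => q2; rewrite -Meven -scaleNr Mhom.
Qed.

Section family.
Variables (N : nat) (I : finType) (z : I -> 'rV[int]_N) (top : I -> 'I_N).
Variable v : 'I_N -> 'rV[R]_n.
Hypothesis z_top : forall i, z i 0 (top i) != 0.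
Hypothesis z_gt : forall i (j : 'I_N), (top i < j)%N -> z i 0 j = 0.
Hypothesis v_top : forall i, v (top i) != 0.

(* The frequency [z] of the torus of dimension [N] is sent to the point
   [\sum_j z_j u_j] of the lattice of dimension [n]; the lengths of the [u_j] are
   increasingly large powers of [l + 1], so that its direction is, in the limit,
   that of [v] at the top index of [z]. *)
Let u (l : nat) (j : 'I_N) : 'rV[int]_n := round (l.+1%:R ^+ j.+1) (v j).
Let kk (l : nat) (i : I) : 'rV[int]_n := \sum_j (z i 0 j) *: u l j.
(** The transpose of the map that sends [z] to [kk]: along [W l th + y], a polynomial with
    frequencies [z i] becomes one in [th] with frequencies [kk l i]. *)
Let W (l : nat) (th : 'rV[R]_n) : 'rV[R]_N := \row_j dotr (lattice R (u l j)) th.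

Let lattice_kk l i : lattice R (kk l i) = \sum_j (z i 0 j)%:~R *: lattice R (u l j).
Proof.
apply/rowP => q; rewrite mxE !summxE rmorph_sum; apply: eq_bigr => j _.
by rewrite !mxE rmorphM.
Qed.

Let dotr_kk l i (th : 'rV[R]_n) (y : 'rV[R]_N) :
  dotr (lattice R (z i)) (W l th + y) = dotr (lattice R (kk l i)) th + dotr (lattice R (z i)) y.
Proof.
rewrite dotrC dotrDl !(dotrC _ (lattice R (z i))); congr (_ + _).
rewrite lattice_kk /dotr; under [RHS]eq_bigr do rewrite summxE mulr_suml.
rewrite exchange_big /=; apply: eq_bigr => j _; rewrite !mxE /dotr mulr_sumr.
by apply: eq_bigr => q _; rewrite !mxE mulrA.
Qed.

Let trigf_W l (c : I -> 'cV[C]_m) (th : 'rV[R]_n) (y : 'rV[R]_N) :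
  trigf z c (W l th + y) = trigf (kk l) (fun i => cis (dotr (lattice R (z i)) y) *: c i) th.
Proof.
by apply: eq_bigr => i _; rewrite dotr_kk cisD scalerA.
Qed.

Let measurable_W l (c : I -> 'cV[C]_m) :
  measurable_fun [set: tup N * tup n] (fun s : tup N * tup n =>
    euclid (trigf z c (W l (row_of s.2) + row_of s.1))).
Proof.
apply: measurable_euclid => j; under eq_fun do rewrite trigf_W /trigf summxE.
apply: Cmeasurable_sum => i; under eq_fun do rewrite !mxE.
apply: CmeasurableM.
  apply: Cmeasurable_cis.
  exact: (measurableT_comp (@measurable_dotr _ _ _) measurable_snd).
apply: CmeasurableM; last exact: Cmeasurable_cst.
apply: Cmeasurable_cis.
exact: (measurableT_comp (@measurable_dotr _ _ _) measurable_fst).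
Qed.

(** For each [th], invariance of the torus of dimension [N] removes the translation by [W l th]; the
    integral over [th] is then that of a constant. *)
Let integral_W l (c : I -> 'cV[C]_m) :
  (\int[torus R N]_y \int[torus R n]_th (euclid (trigf z c (W l (row_of th) + row_of y)) `^ p)%:E =
   intp (torus R N) p (trigf z c \o @row_of R N))%E.
Proof.
rewrite (@fubini_tonelli _ _ _ _ R (torus R N) (torus R n)
  (fun s => (euclid (trigf z c (W l (row_of s.2) + row_of s.1)) `^ p)%:E)); first last.
- by move=> s; rewrite lee_fin powR_ge0.
- by apply/measurable_EFinP; apply: (measurableT_comp (measurable_powR p)); exact: measurable_W.
rewrite (eq_integral (fun=> intp (torus R N) p (trigf z c \o @row_of R N))); last first.
  move=> th _ /=.
  apply: (@integral_torus_shift R N (fun x => euclid (trigf z c x)) (fun r => r `^ p) (W l (row_of th))).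
  - exact: trigf_periodic.
  - exact: measurable_euclid_trigf.
  - exact: measurable_powR.
  - by move=> r; exact: powR_ge0.
by rewrite -(fineK (intp_trigf_fin z c p_gt0)) integral_cst// [X in (_ * X)%E](torus_setT R n) mule1.
Qed.

(** [disc_bound] is applied in [th] for each fixed [y], whose phases join the coefficients, and the
    result is averaged over [y]. *)
Let lattice_transfer l (c : I -> 'cV[C]_m) :
  (intp (torus R N) p (trigf z (fun i => mxC (M (lattice R (kk l i))) *m c i) \o @row_of R N) <=
   (K `^ p)%:E * intp (torus R N) p (trigf z c \o @row_of R N))%E.
Proof.
rewrite -!(integral_W l) -ge0_integralZl; first last.
- by rewrite lee_fin powR_ge0.
- by move=> y _; apply: integral_ge0 => th _; rewrite lee_fin powR_ge0.
- apply: (@measurable_fun_fubini_tonelli_F _ _ _ _ R (torus R n)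
    (fun s => (euclid (trigf z c (W l (row_of s.2) + row_of s.1)) `^ p)%:E)).
  + by apply/measurable_EFinP; apply: (measurableT_comp (measurable_powR p)); exact: measurable_W.
  + by move=> s; rewrite lee_fin powR_ge0.
- exact: measurableT.
apply: le_integralT => y.
  by apply: integral_ge0 => th _; rewrite lee_fin powR_ge0.
pose c' i := cis (dotr (lattice R (z i)) (row_of y)) *: c i.
have E1 : (\int[torus R n]_th
    (euclid (trigf z (fun i => mxC (M (lattice R (kk l i))) *m c i) (W l (row_of th) + row_of y)) `^ p)%:E =
    intp (torus R n) p (trigf (kk l) (fun i => mxC (M (lattice R (kk l i))) *m c' i) \o @row_of R n))%E.
  apply: eq_integral => th _; rewrite trigf_W /comp; congr ((euclid _ `^ p)%:E).
  by apply: eq_bigr => i _; rewrite -scalemxAr.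
have E2 : (\int[torus R n]_th (euclid (trigf z c (W l (row_of th) + row_of y)) `^ p)%:E =
    intp (torus R n) p (trigf (kk l) c' \o @row_of R n))%E.
  by apply: eq_integral => th _; rewrite trigf_W.
by rewrite E1 E2; exact: disc_bound.
Qed.

(** After division by [(l + 1)^(top i + 1)] the terms with [j < top i] are damped by a power of
    [(l + 1)^-1], those with [j > top i] are 0, and the top term tends to a multiple of [v (top i)].
    The exponents start at 1 rather than 0, so that the rounding error disappears for [j = 0]
    too. *)
Let direction_cvg i a b :
  M (lattice R (kk l i)) a b @[l --> \oo] --> M (v (top i)) a b.
Proof.
rewrite -(symbol_int (z_top i) (v_top i)).
have cl (l e : nat) : 0 < (l.+1%:R ^+ e : R) by rewrite exprn_gt0.
apply: (@symbol_direction_cvg (fun l => (l.+1%:R ^+ (top i).+1)^-1)).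
- by move=> l; rewrite invr_gt0.
- rewrite (_ : (fun l => _) = fun l => \sum_(j < N)
    (if (j <= top i)%N then ((l.+1%:R ^+ (top i - j))^-1 * (z i 0 j)%:~R) *:
       ((l.+1%:R ^+ j.+1)^-1 *: lattice R (round (l.+1%:R ^+ j.+1) (v j))) else 0)); last first.
    apply/funext => l; rewrite lattice_kk scaler_sumr; apply: eq_bigr => j _.
    case: leqP => [jt|jt]; last by rewrite z_gt// scale0r scaler0.
    rewrite !scalerA; congr (_ *: _); rewrite mulrAC; congr (_ * _).
    by rewrite -invfM -exprD addnS subnK.
  rewrite (_ : _ *: v (top i) = \sum_(j < N) (if j == top i then (z i 0 j)%:~R *: v j else 0)); last first.
    by rewrite (bigD1 (top i))//= eqxx big1 ?addr0// => j /negbTE ->.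
  have inv0 (e : nat) : (0 < e)%N -> (l.+1%:R ^+ e)^-1 @[l --> \oo] --> (0 : R).
    case: e => // e _; elim: e => [|e IH]; first by under eq_fun do rewrite expr1; exact: invSn_cvg0.
    have h := cvgM (@invSn_cvg0 R) IH.
    by rewrite mulr0 in h; under eq_fun do rewrite exprS invfM; exact: h.
  have rc (j : 'I_N) : (l.+1%:R ^+ j.+1)^-1 *: lattice R (round (l.+1%:R ^+ j.+1) (v j)) @[l --> \oo] --> v j.
    by apply: (@round_cvg _ _ (fun l => l.+1%:R ^+ j.+1)) => //; exact: inv0.
  apply: cvg_big => [|j _]; first exact: add_continuous.
  have [jt|jt] := eqVneq j (top i).
    rewrite jt leqnn subnn; under eq_fun do rewrite expr0 invr1 mul1r.
    by apply: cvgZl_tmp; exact: rc.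
  have [jt'|jt'] := leqP j (top i); last exact: cvg_cst.
  rewrite -(scale0r (v j)); apply: cvgZ; last exact: rc.
  rewrite -[X in _ --> X](mul0r ((z i 0 j)%:~R)); apply: cvgMl; apply: inv0.
  by rewrite subn_gt0 ltn_neqAle jt jt'.
- by rewrite scaler_eq0 negb_or v_top intr_eq0 z_top.
Qed.

(** The frequencies [z i] do not move with [l] and the coefficients converge, so the polynomials
    converge uniformly, which is the situation of [integral_powR_trunc]. *)
Lemma top_index_transfer (c : I -> 'cV[C]_m) :
  (intp (torus R N) p (trigf z (fun i => mxC (M (v (top i))) *m c i) \o @row_of R N) <=
   (K `^ p)%:E * intp (torus R N) p (trigf z c \o @row_of R N))%E.
Proof.
set X := intp _ _ (trigf z c \o _).
have Xfin : X \is a fin_num by exact: intp_trigf_fin.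
pose DD l i : 'M[R]_m := M (lattice R (kk l i)) - M (v (top i)).
pose e l := \sum_i \sum_a \sum_b `|DD l i a b| *
  (`|complex.Re (c i b 0)| + `|complex.Im (c i b 0)|).
have e0 : e l @[l --> \oo] --> 0.
  apply: cvg_sum0 => i; apply: cvg_sum0 => a; apply: cvg_sum0 => b.
  rewrite -[X in _ --> X](mul0r (`|complex.Re (c i b 0)| + `|complex.Im (c i b 0)|)).
  apply: cvgMl; rewrite -(@normr0 R R); apply: cvg_norm.
  by under eq_fun do rewrite !mxE; apply/subr_cvg0; exact: direction_cvg.
rewrite -(fineK Xfin) -EFinM.
apply: (@integral_powR_trunc _ _ _ (torus R N)
  (fun y => euclid (trigf z (fun i => mxC (M (v (top i))) *m c i) (row_of y))) p e
  (fun=> K `^ p * fine X)) => //.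
- exact: ltW.
- exact: measurable_euclid_trigf.
- by move=> y; exact: euclid_ge0.
- exact: cvg_cst.
move=> l; rewrite EFinM fineK//; apply: le_trans (lattice_transfer l c).
apply: le_integralT => y; first by rewrite lee_fin powR_ge0.
rewrite lee_fin; apply: ge0_ler_powR; rewrite ?nnegrE ?euclid_ge0 ?(ltW p_gt0)//.
  by rewrite le_max lexx orbT.
rewrite ge_max euclid_ge0 andbT lerBlDr -lerBlDl.
apply: le_trans (_ : euclid (trigf z (fun i => mxC (DD l i) *m c i) (row_of y)) <= _).
  rewrite (le_trans (ler_norm _))// distrC (le_trans (euclidB_le _ _))// le_eqVlt.
  apply/orP; left; apply/eqP; congr euclid; rewrite /trigf -sumrB; apply: eq_bigr => i _.
  rewrite -scalerBr -mulmxBl; congr (_ *: (_ *m _)).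
  by apply/matrixP => a b; rewrite !mxE rmorphB.
apply: le_trans (euclid_sum _ _ _) _; apply: ler_sum => i _.
by rewrite euclid_cis; exact: euclid_mxC_le.
Qed.

End family.
End transference.

(** * Rademacher functions and signs of cosines *)

Section sign_average.
Variable R : realType.
Implicit Types (x : nat -> R) (F : (nat -> R) -> R).

Definition scons (a : R) x : nat -> R := fun k => if k is k'.+1 then x k' else a.

(** The default 0 beyond [n] matches the base case of [sign_avg], which evaluates [F] at the zero
    sequence. *)
Definition strunc (n : nat) x : nat -> R := fun k => if (k < n)%N then x k else 0.

Lemma struncS n x : strunc n.+1 x = scons (x 0) (strunc n (fun k => x k.+1)).
Proof. by apply/funext => -[|k]. Qed.

(** The expectation of [F] under [n] independent fair signs: the common value through which
    Rademacher functions and signs of cosines are compared. *)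
Fixpoint sign_avg (n : nat) F : R :=
  if n is n'.+1 then
    (sign_avg n' (fun x => F (scons 1 x)) + sign_avg n' (fun x => F (scons (-1) x))) / 2
  else F (fun=> 0).

Lemma sign_avg_ge0 n F : (forall x, 0 <= F x) -> 0 <= sign_avg n F.
Proof.
elim: n F => [|n IH] F F0 /=; first exact: F0.
by rewrite divr_ge0// addr_ge0// IH.
Qed.

Lemma measurable_signs d (T : measurableType d) (y : nat -> T -> R) n F :
  (forall k, measurable_fun setT (y k)) ->
  (forall k t, [\/ y k t = 1, y k t = -1 | y k t = 0]) ->
  measurable_fun setT (fun t => F (strunc n (y^~ t))).
Proof.
elim: n y F => [|n IH] y F my yv; first exact: (@measurable_cst _ _ _ _ _ (F (fun=> 0))).
have H a := IH (fun k => y k.+1) (fun x => F (scons a x)) (fun k => my k.+1) (fun k => yv k.+1).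
rewrite (_ : (fun t => _) = (fun t =>
    if y 0 t == 1 then F (scons 1 (strunc n (fun k => y k.+1 t))) else
    if y 0 t == -1 then F (scons (-1) (strunc n (fun k => y k.+1 t))) else
      F (scons 0 (strunc n (fun k => y k.+1 t))))); last first.
  apply/funext => t; rewrite struncS.
  have N11 : (-1 == 1 :> R) = false by apply/negbTE; rewrite lt_eqF//; lra.
  have [-> | -> | ->] := yv 0 t.
  - by rewrite eqxx.
  - by rewrite N11 eqxx.
  - by rewrite !(eq_sym 0) oppr_eq0 oner_eq0.
have mE (a : R) : measurable_fun setT (fun t => y 0 t == a) by exact: measurable_fun_eqr.
by apply: measurable_fun_ifT => //; apply: measurable_fun_ifT.
Qed.

End sign_average.

Section unit_interval.
Variable R : realType.
Local Notation mu := (@lebesgue_measure R).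
Local Open Scope ereal_scope.

Lemma integral_unit_itv (f : measurableTypeR R -> \bar R) :
  measurable_fun setT f -> (forall x, 0 <= f x) ->
  \int[unit_itv_measure R]_x f x = \int[mu]_(x in `[0%R, 1%R[) f x.
Proof.
move=> mf f0.
have U (h : measurableTypeR R -> \bar R) : measurable_fun setT h -> (forall x, 0 <= h x) ->
    \int[uniform_prob (ltr01 : (0 < 1 :> R)%R)]_x h x = \int[mu]_(x in `[0%R, 1%R[) h x.
  move=> mh h0; rewrite integral_uniform// subr0 invr1 mul1e.
  by rewrite -!integral_itv_bndo_bndc//; exact: measurable_funTS.
rewrite -U//; apply: eq_measure_integral => A mA _.
transitivity (\int[uniform_prob (ltr01 : (0 < 1 :> R)%R)]_x (\1_A x)%:E); last first.
  by rewrite integral_indic// setIT.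
rewrite U; [|exact/measurable_EFinP/measurable_indic|by []].
by rewrite integral_indic.
Qed.

(** Rademacher functions read binary digits, and halving the argument moves every digit by one
    place. *)
Lemma rademacher_half k (s : R) : rademacher k.+1 (s / 2) = rademacher k s.
Proof. by rewrite /rademacher (exprS _ k.+1); congr (_ ^+ Num.truncn _)%R; field. Qed.

Lemma rademacher_half_shift k (s : R) : (0 <= s)%R ->
  rademacher k.+1 ((1 + s) / 2) = rademacher k s.
Proof.
move=> s0; rewrite /rademacher.
rewrite (_ : (2 ^+ k.+2 * ((1 + s) / 2) = (2 ^ k.+1)%:R + 2 ^+ k.+1 * s)%R); last first.
  by rewrite natrX (exprS _ k.+1); field.
rewrite truncnD ?nnegrE ?mulr_ge0 ?exprn_ge0// ?natr_nat// natrK exprD.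
(* The added integer [2 ^ k.+1] is even and leaves the sign unchanged. *)
by rewrite -signr_odd oddX /= mul1r.
Qed.

Lemma rademacher0_half (s : R) : (0 <= s < 1)%R -> rademacher 0 (s / 2) = 1%R.
Proof.
move=> s01; rewrite /rademacher expr1 (_ : (2 * (s / 2) = s)%R); last by field.
by rewrite (@truncn_def _ s 0)// mulr0n.
Qed.

Lemma rademacher0_half_shift (s : R) : (0 <= s < 1)%R -> rademacher 0 ((1 + s) / 2) = (-1)%R.
Proof.
move=> /andP[s0 s1]; rewrite /rademacher expr1 (_ : (2 * ((1 + s) / 2) = 1 + s)%R); last by field.
rewrite (@truncn_def _ (1 + s)%R 1) ?expr1//.
by apply/andP; split; lra.
Qed.

Lemma rademacherP k (t : R) : [\/ rademacher k t = 1, rademacher k t = -1 | rademacher k t = 0]%R.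
Proof.
rewrite /rademacher -signr_odd; case: odd; [exact: Or32 (expr1 _)|exact: Or31 (expr0 _)].
Qed.

Lemma measurable_rademacher k : measurable_fun [set: measurableTypeR R] (rademacher k : measurableTypeR R -> R).
Proof.
have mtr : measurable_fun [set: measurableTypeR R]
    (fun t : measurableTypeR R => (Num.truncn (2 ^+ k.+1 * t))%:R : R).
  apply: nondecreasing_measurable => // x y xy.
  by rewrite ler_nat le_truncn// ler_wpM2l// exprn_ge0.
have mo : measurable_fun [set: measurableTypeR R]
    (fun t : measurableTypeR R => odd (Num.truncn (2 ^+ k.+1 * t))).
  apply: (measurable_fun_bool true); rewrite setTI.
  rewrite (_ : _ @^-1` _ = \bigcup_(j in [set j | odd j])
      ((fun t : measurableTypeR R => (Num.truncn (2 ^+ k.+1 * t))%:R : R) @^-1` [set j%:R%R])).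
    apply: bigcup_measurable => j _; rewrite -[X in measurable X]setTI; exact: mtr.
  apply/seteqP; split => [t /= ot|t [j /= oj] /eqP].
    by exists (Num.truncn (2 ^+ k.+1 * t)).
  by rewrite eqr_nat => /eqP ->.
rewrite (_ : (rademacher k : _ -> _) = fun t => if odd (Num.truncn (2 ^+ k.+1 * t)) then (-1)%R else 1%R).
  by apply: measurable_fun_ifT.
by apply/funext => t; rewrite /rademacher -signr_odd; case: odd.
Qed.

Lemma integral_unit_halves (f : measurableTypeR R -> \bar R) :
  measurable_fun setT f -> (forall x, 0 <= f x) ->
  \int[mu]_(x in `[0%R, 1%R[) f x =
  2^-1%:E * (\int[mu]_(x in `[0%R, 1%R[) f (x / 2)%R + \int[mu]_(x in `[0%R, 1%R[) f ((1 + x) / 2)%R).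
Proof.
move=> mf f0.
have half (b : R) : \int[mu]_(x in `[b, (b + 1 / 2)%R[) f x =
    2^-1%:E * \int[mu]_(x in `[0%R, 1%R[) f (b + x / 2)%R.
  have := @ge0_integral_affine R b (1 / 2) (f \_ `[b, (b + 1 / 2)%R[).
  rewrite (_ : (1 / 2)^-1 = 2)%R; last by rewrite invf_div divr1.
  move=> H; rewrite [LHS]integral_mkcond [X in _ * X]integral_mkcond.
  have -> : \int[mu]_x (f \_ `[b, (b + 1 / 2)%R[) x =
      2^-1%:E * (2%:E * \int[mu]_x (f \_ `[b, (b + 1 / 2)%R[) x).
    by rewrite muleA -EFinM mulVf// mul1e.
  congr (_ * _); rewrite -H//; last 2 first.
  - by apply/(measurable_restrictT _ _).1 => //; exact: measurable_funTS.
  - by move=> x; apply: erestrict_ge0.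
  apply: eq_integral => x _; rewrite !patchE /affine !mem_setE/= !in_itv/=.
  rewrite (_ : (b + 1 / 2 * x = b + x / 2)%R); last by field.
  by congr (if _ then _ else _); apply/andP/andP => -[h1 h2]; split; lra.
have setE : `[0%R, 1%R[%classic = (`[0%R, (1 / 2)%R[ `|` `[(1 / 2)%R, 1%R[)%classic :> set (measurableTypeR R).
  by rewrite -(@itv_bndbnd_setU _ _ (BLeft 0%R) (BLeft (1 / 2)%R) (BLeft 1%R)) ?bnd_simp//; lra.
rewrite [X in integral _ X f]setE.
rewrite ge0_integral_setU//=; first last.
- apply/disj_set2P/seteqP; split => // x /= [].
  by rewrite !in_itv/= => /andP[_ + /andP[]]; rewrite ltNge => /negbTE ->.
- exact: measurable_funTS.
have := half 0%R; rewrite add0r => ->.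
have := half (1 / 2)%R; rewrite (_ : 1 / 2 + 1 / 2 = 1)%R; last by field.
move=> ->; rewrite -muleDr ?ge0_adde_def ?inE ?integral_ge0//; congr (_ * (_ + _)).
- by apply: eq_integral => x _; rewrite add0r.
- by apply: eq_integral => x _; congr f; field.
Qed.

(** Induction by halving the interval: the first sign is constant on each half, and after rescaling
    the later ones are again the Rademacher functions. *)
Lemma integral_rademacher n (F : (nat -> R) -> R) : (forall x, 0 <= F x)%R ->
  \int[unit_itv_measure R]_t (F (strunc n (fun k => rademacher k t)))%:E = (sign_avg n F)%:E.
Proof.
have mF n' (F' : (nat -> R) -> R) : measurable_fun [set: measurableTypeR R]
    (fun t : measurableTypeR R => (F' (strunc n' (fun k => rademacher k t)))%:E).
  apply/measurable_EFinP; apply: (measurable_signs (y := fun k => rademacher k)).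
  - exact: measurable_rademacher.
  - exact: rademacherP.
move=> F0; rewrite integral_unit_itv//; last by move=> t; rewrite lee_fin.
elim: n F F0 => [|n IH] F F0.
  transitivity (\int[mu]_(x in `[0%R, 1%R[) cst (F (fun=> 0%R))%:E x); first exact: eq_integral.
  by rewrite integral_cst//= lebesgue_measure_itv/= lte01 sube0 mule1.
rewrite integral_unit_halves//; last by move=> t; rewrite lee_fin.
have -> : \int[mu]_(x in `[0%R, 1%R[) (F (strunc n.+1 (fun k => rademacher k (x / 2))))%:E =
    (sign_avg n (fun y => F (scons 1 y)))%:E.
  rewrite -IH//; apply: eq_integral => s; rewrite inE/= in_itv/= => s01.
  rewrite struncS rademacher0_half//; congr (F (scons _ (strunc n _)))%:E.
  by apply/funext => k; rewrite rademacher_half.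
have -> : \int[mu]_(x in `[0%R, 1%R[) (F (strunc n.+1 (fun k => rademacher k ((1 + x) / 2))))%:E =
    (sign_avg n (fun y => F (scons (-1) y)))%:E.
  rewrite -IH//; apply: eq_integral => s; rewrite inE/= in_itv/= => s01.
  rewrite struncS rademacher0_half_shift//; congr (F (scons _ (strunc n _)))%:E.
  by apply/funext => k; rewrite rademacher_half_shift//; case/andP: s01.
by rewrite -EFinD -EFinM /= mulrC.
Qed.

End unit_interval.

Section circle_signs.
Variable R : realType.
Local Notation mu := (@lebesgue_measure R).
Local Open Scope ereal_scope.

Definition csign (x : measurableTypeR R) : R := Num.sg (cos x).

Lemma csignP x : [\/ csign x = 1, csign x = -1 | csign x = 0]%R.
Proof.
rewrite /csign; case: sgrP => _; [exact: Or33|exact: Or31|exact: Or32].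
Qed.

Lemma measurable_csign : measurable_fun setT csign.
Proof.
have mcos : measurable_fun setT (fun x : measurableTypeR R => cos x).
  by apply: continuous_measurable_fun => x; exact: continuous_cos.
rewrite (_ : csign = fun x => if (0 < cos x)%R then 1%R else if (cos x < 0)%R then (-1)%R else 0%R).
  apply: measurable_fun_ifT => //; first exact: measurable_fun_ltr.
  by apply: measurable_fun_ifT => //; exact: measurable_fun_ltr.
by apply/funext => x; rewrite /csign; case: sgrP.
Qed.

Lemma measurable_cos_eq0 : measurable [set x : measurableTypeR R | cos x = 0%R].
Proof.
have mcos : measurable_fun setT (fun x : measurableTypeR R => cos x).
  by apply: continuous_measurable_fun => x; exact: continuous_cos.
rewrite (_ : [set x | _] = setT `&` (fun x : measurableTypeR R => cos x) @^-1` [set 0%R]) ?setTI//.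
by rewrite -[X in measurable X]setTI; exact: mcos.
Qed.

(** The zeros in [[-pi, pi)] are among [pi / 2] and [- pi / 2]: at any other point, [x] or one of
    its translates by [pi] lies in [(-pi/2, pi/2)], where the cosine is positive. *)
Lemma circle_cos_eq0 : circle R [set x | cos x = 0%R] = 0.
Proof.
have mN := measurable_cos_eq0.
transitivity (\int[circle R]_x (\1_[set x : measurableTypeR R | cos x = 0%R] x)%:E).
  by rewrite integral_indic// setIT.
rewrite integral_circle; [|exact/measurable_EFinP/measurable_indic|by []].
rewrite integral_indic//; apply/eqP; rewrite mule_eq0; apply/orP; right; apply/eqP.
apply: (@subset_measure0 _ _ _ mu _ [set (pi / 2)%R; (- (pi / 2))%R]).
- exact: measurableI.
- by apply: measurableU.
- move=> x /= [] cx; rewrite in_itv/= => /andP[x1 x2].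
  have [h1|h1] := leP x (- (pi / 2))%R; have [h2|h2] := leP (pi / 2)%R x.
  + by exfalso; have := pi_gt0 R; move: (pi : R) h1 h2 => P; lra.
  + move: h1; rewrite le_eqVlt => /orP[/eqP ->|h1]; first by right.
    exfalso; have : (0 < cos (x + pi))%R.
      by apply: cos_gt0_pihalf; move: (pi : R) x1 x2 h1 h2 => P *; apply/andP; split; lra.
    by rewrite cosDpi cx oppr0 ltxx.
  + move: h2; rewrite le_eqVlt => /orP[/eqP ->|h2]; first by left.
    exfalso; have : (0 < cos (x - pi))%R.
      by apply: cos_gt0_pihalf; move: (pi : R) x1 x2 h1 h2 => P *; apply/andP; split; lra.
    by rewrite -oppr_lt0 -cosDpi subrK cx ltxx.
  + exfalso; have : (0 < cos x)%R by apply: cos_gt0_pihalf; rewrite h1 h2.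
    by rewrite cx ltxx.
- by apply: countable_lebesgue_measure0; apply: finite_set_countable; exact: finite_set2.
Qed.

(** Rotation by [pi] exchanges the signs, so twice the integral is that of
    [g (csign x) + g (- csign x)], which is [g 1 + g (-1)] off the null set where the cosine
    vanishes. *)
Lemma integral_csign (g : R -> R) : (forall r, 0 <= g r)%R ->
  \int[circle R]_x (g (csign x))%:E = ((g 1 + g (-1)) / 2)%R%:E.
Proof.
move=> g0.
have mg (h : R -> R) : measurable_fun setT (fun x => (h (csign x))%:E).
  apply/measurable_EFinP.
  have := @measurable_signs R _ _ (fun _ : nat => csign) 1 (fun y => h (y 0%N))
    (fun=> measurable_csign) (fun=> csignP).
  by [].
have EN : \int[circle R]_x (g (csign x))%:E = \int[circle R]_x (g (- csign x))%:E.
  rewrite -[LHS](@ge0_integral_wrap R pi) //; last by move=> x; rewrite lee_fin.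
  apply: eq_integral => x _; congr (g _)%:E; rewrite /csign -sgrN.
  have := cos_wrap 1 0 (pi + x)%R; rewrite !mul1r !addr0 => ->.
  by rewrite addrC cosDpi.
have : \int[circle R]_x (g (csign x))%:E + \int[circle R]_x (g (csign x))%:E = (g 1 + g (-1))%R%:E.
  rewrite [X in _ + X]EN -ge0_integralD//; first last.
  - exact: (mg (fun r => g (- r)%R)).
  - by move=> x _; rewrite lee_fin.
  - by move=> x _; rewrite lee_fin.
  rewrite -[RHS]integral_circle_cst; apply: ae_eq_integral => //.
  - apply: emeasurable_funD => //; exact: (mg (fun r => g (- r)%R)).
  exists [set x : measurableTypeR R | cos x = 0%R]; split.
  - exact: measurable_cos_eq0.
  - exact: circle_cos_eq0.
  move=> x /= /not_implyP[_]; apply: contraPP => /eqP cx; rewrite -EFinD.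
  rewrite /csign; case: sgrP cx => // _ _; apply; first by [].
  by rewrite opprK addrC.
case: (\int[circle R]_x _) => [r| |]//=; rewrite -EFinD => -[] <-.
by congr EFin; field.
Qed.

End circle_signs.

Section torus_signs.
Variable R : realType.
Local Notation tup n := (n.-tuple (measurableTypeR R)).

(** Together with [integral_rademacher], this says that the signs of cosines of independent angles
    have the joint distribution of the Rademacher functions. *)
Lemma integral_torus_signs n (F : (nat -> R) -> R) : (forall x, 0 <= F x) ->
  (\int[torus R n]_t (F (strunc n (fun k => csign (nth 0 t k))))%:E = (sign_avg n F)%:E)%E.
Proof.
have my n' k : measurable_fun [set: tup n'] (fun t : tup n' => csign (nth 0 t k)).
  apply: (measurableT_comp (@measurable_csign R)).
  have [kn|kn] := ltnP k n'; last first.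
    rewrite (_ : (fun t => _) = cst 0); first exact: measurable_cst.
    by apply/funext => t; rewrite nth_default// size_tuple.
  rewrite (_ : (fun t => _) = (fun t : tup n' => tnth t (Ordinal kn))); first exact: measurable_tnth.
  by apply/funext => t; rewrite (tnth_nth 0).
have mF n' (F' : (nat -> R) -> R) : measurable_fun [set: tup n']
    (fun t : tup n' => (F' (strunc n' (fun k => csign (nth 0 t k))))%:E).
  apply/measurable_EFinP; apply: (measurable_signs (y := fun k (t : tup n') => csign (nth 0 t k))).
  - exact: my.
  - by move=> k t; exact: csignP.
elim: n F => [|n IH] F F0; first by rewrite /torus ge0_integral_tuple0.
rewrite /torus ge0_integral_tupleS//; last by move=> t; rewrite lee_fin.
transitivity (\int[circle R]_x (sign_avg n (fun y => F (scons (csign x) y)))%:E)%E.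
  by apply: eq_integral => x _; rewrite -IH//; apply: eq_integral => t _; rewrite struncS.
by rewrite (@integral_csign R (fun a => sign_avg n (fun y => F (scons a y))))// => r; exact: sign_avg_ge0.
Qed.

End torus_signs.

(** * Polynomial approximation of signs and its frequencies *)

Section sign_polynomials.
Variable R : realType.
Implicit Types x : R.

Definition cubic x : R := (3 * x - x ^+ 3) / 2.

(* 0, 1 and -1 are the fixed points of the cubic, and the last two attract the
   rest of [-1, 1]. Being odd, [signpol j (cos x)] has only odd frequencies, so
   that its frequency never vanishes. *)
Definition signpol (j : nat) x : R := iter j cubic x.

Lemma cubicN x : cubic (- x) = - cubic x.
Proof. by rewrite /cubic; field. Qed.

Lemma signpolN j x : signpol j (- x) = - signpol j x.
Proof. by elim: j => //= j ->; rewrite cubicN. Qed.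

Lemma cubic_ge x : 0 <= x <= 1 -> x <= cubic x.
Proof.
move=> /andP[x0 x1]; rewrite -subr_ge0 (_ : _ - x = x * ((1 - x) * (1 + x)) / 2); last first.
  by rewrite /cubic; field.
by rewrite divr_ge0// !mulr_ge0//; lra.
Qed.

Lemma cubic_dist x : 1 - cubic x = (1 - x) * ((1 - x) * (x + 2) / 2).
Proof. by rewrite /cubic; field. Qed.

Lemma cubic_le1 x : 0 <= x <= 1 -> cubic x <= 1.
Proof.
move=> /andP[x0 x1]; rewrite -subr_ge0 cubic_dist mulr_ge0 ?divr_ge0 ?mulr_ge0//; lra.
Qed.

(** One step from an iterate [y] multiplies the distance to 1 by [(1 - y) (y + 2) / 2 = 1 - y / 2 -
    y^2 / 2]. The iterates stay above [x], so this factor is at most [1 - x / 2]. *)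
Lemma signpol_itv j x : 0 <= x <= 1 ->
  x <= signpol j x <= 1 /\ 1 - signpol j x <= (1 - x / 2) ^+ j.
Proof.
move=> x01; have /andP[x0 x1] := x01; elim: j => [|j [/andP[h1 h2] h3]].
  by rewrite /signpol /= lexx x1 expr0; split => //; lra.
have h0 : 0 <= signpol j x <= 1 by rewrite (le_trans x0 h1) h2.
rewrite /signpol iterS -/(signpol j x); split.
  by rewrite (le_trans h1 (cubic_ge h0)) cubic_le1.
rewrite cubic_dist exprSr; apply: ler_pM => //.
- by rewrite subr_ge0.
- by rewrite divr_ge0// mulr_ge0//; lra.
- move: h1 h2; move: (signpol j x) => y h1 h2.
  have -> : (1 - y) * (y + 2) / 2 = 1 - y / 2 - y * y / 2 by field.
  by have : 0 <= y * y := sqr_ge0 y; lra.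
Qed.

Lemma signpol_norm_le1 j x : `|x| <= 1 -> `|signpol j x| <= 1.
Proof.
have pos y : 0 <= y <= 1 -> `|signpol j y| <= 1.
  move=> y01; have [/andP[h1 h2] _] := signpol_itv j y01.
  by rewrite ger0_norm//; case/andP: y01 => y0 _; exact: le_trans h1.
have [x0|x0] := leP 0 x.
  by rewrite ger0_norm// => x1; apply: pos; rewrite x0.
rewrite ltr0_norm// => x1; rewrite -(opprK x) signpolN normrN; apply: pos.
by rewrite x1 oppr_ge0 ltW.
Qed.

Lemma signpol_cvg x : `|x| <= 1 -> signpol j x @[j --> \oo] --> Num.sg x.
Proof.
have pos y : 0 < y <= 1 -> signpol j y @[j --> \oo] --> (1 : R).
  move=> /andP[y0 y1]; have y01 : 0 <= y <= 1 by rewrite ltW.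
  have g0 : (1 - y / 2) ^+ j @[j --> \oo] --> (0 : R).
    by apply: cvg_expr; rewrite ger0_norm; lra.
  have g1 : 1 - (1 - y / 2) ^+ j @[j --> \oo] --> (1 : R).
    by rewrite -[X in _ --> X](subr0 1); apply: cvgB => //; exact: cvg_cst.
  apply: (@squeeze_cvgr _ _ _ _ (fun j => 1 - (1 - y / 2) ^+ j) (cst 1)).
  - apply: nearW => j; have [/andP[h1 h2] h3] := signpol_itv j y01.
    by rewrite h2 andbT lerBlDl -lerBlDr.
  - exact: g1.
  - exact: cvg_cst.
case: sgrP => [->|x0|x0] x1.
- rewrite (_ : (fun j => _) = cst 0); first exact: cvg_cst.
  apply/funext => j /=; have := signpolN j (0 : R); rewrite oppr0.
  by move: (signpol j 0) => y; lra.
- by apply: pos; rewrite x0.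
- rewrite (_ : (fun j => _) = fun j => - signpol j (- x)); last first.
    by apply/funext => j; rewrite signpolN opprK.
  by apply: cvgN; apply: pos; rewrite oppr_gt0 x0.
Qed.

End sign_polynomials.

Section spectrum.
Variables (R : realType) (D : nat).
Local Notation C := R[i].
Implicit Types (S : 'rV[int]_D -> Prop) (f g : 'rV[R]_D -> C).

(** Carrying a set [S] of allowed frequencies lets the support of a product be found by composition,
    without computing its coefficients. *)
Definition spec S f := exists2 L : seq ('rV[int]_D * C),
  (forall z, z \in L -> S z.1) &
  forall x, f x = \sum_(z <- L) cis (dotr (lattice R z.1) x) * z.2.

Lemma spec_sub S S' f : (forall l, S l -> S' l) -> spec S f -> spec S' f.
Proof. by move=> SS' [L LS fE]; exists L => // z /LS; exact: SS'. Qed.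

Lemma spec_cst S c : S 0 -> spec S (fun=> c).
Proof.
move=> S0; exists [:: (0, c)] => [z|x]; first by rewrite inE => /eqP ->.
rewrite big_seq1 (_ : dotr _ _ = 0) ?cis0 ?mul1r//.
by rewrite /dotr big1// => i _; rewrite !mxE mul0r.
Qed.

Lemma spec_cis (l : 'rV[int]_D) S : S l -> spec S (fun x => cis (dotr (lattice R l) x)).
Proof.
move=> Sl; exists [:: (l, 1)] => [z|x]; first by rewrite inE => /eqP ->.
by rewrite big_seq1 mulr1.
Qed.

Lemma spec_add S f g : spec S f -> spec S g -> spec S (fun x => f x + g x).
Proof.
move=> [L LS fE] [L' LS' gE]; exists (L ++ L') => [z|x]; last by rewrite big_cat fE gE.
by rewrite mem_cat => /orP[/LS|/LS'].
Qed.

Lemma spec_mul S S' S'' f g : (forall a b, S a -> S' b -> S'' (a + b)) ->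
  spec S f -> spec S' g -> spec S'' (fun x => f x * g x).
Proof.
move=> SS [L LS fE] [L' LS' gE].
exists [seq (a.1 + b.1, a.2 * b.2) | a <- L, b <- L'] => [z /allpairsP[[a b] /= [aL bL ->]]|x].
  by apply: SS; [exact: LS|exact: LS'].
rewrite fE gE big_allpairs_dep mulr_suml; apply: eq_bigr => a _.
rewrite mulr_sumr; apply: eq_bigr => b _ /=.
rewrite (_ : lattice R (a.1 + b.1) = lattice R a.1 + lattice R b.1); last first.
  by apply/rowP => i; rewrite !mxE rmorphD.
by rewrite dotrDl cisD mulrACA.
Qed.

Lemma spec_prod S (J : Type) (r : seq J) (P : pred J) (F : J -> 'rV[R]_D -> C) :
  S 0 -> (forall a b, S a -> S b -> S (a + b)) ->
  (forall j, P j -> spec S (F j)) -> spec S (fun x => \prod_(j <- r | P j) F j x).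
Proof.
move=> S0 SD SF; elim: r => [|j r IH].
  by under [X in spec _ X]funext do rewrite big_nil; exact: spec_cst.
under [X in spec _ X]funext do rewrite big_cons.
case: (boolP (P j)) => [Pj|_ //]; exact: spec_mul SD (SF j Pj) IH.
Qed.

Definition odd_at (i : 'I_D) (l : 'rV[int]_D) :=
  (forall j, j != i -> l 0 j = 0) /\ exists q : int, l 0 i = q * 2 + 1.

Definition even_at (i : 'I_D) (l : 'rV[int]_D) :=
  (forall j, j != i -> l 0 j = 0) /\ exists q : int, l 0 i = q * 2.

Definition below (k : nat) (l : 'rV[int]_D) := forall j : 'I_D, (k <= j)%N -> l 0 j = 0.

Definition topped (k : 'I_D) (l : 'rV[int]_D) :=
  l 0 k != 0 /\ forall j : 'I_D, (k < j)%N -> l 0 j = 0.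

Lemma odd_at_below (i : 'I_D) (k : nat) l : (i < k)%N -> odd_at i l -> below k l.
Proof.
by move=> ik [l0 _] j kj; apply: l0; apply: contraTneq kj => ->; rewrite -ltnNge.
Qed.

(** This is what oddness is for: an odd entry at [k], added to a frequency that vanishes from [k]
    on, cannot cancel. *)
Lemma odd_at_below_topped (k : 'I_D) a b : odd_at k a -> below k b -> topped k (a + b).
Proof.
move=> [a0 [q aE]] b0; split; first by rewrite mxE aE b0// addr0; lia.
by move=> j kj; rewrite mxE a0 ?b0 ?(ltnW kj)//; apply: contraTneq kj => ->; rewrite ltnn.
Qed.

Lemma spec_cos i : spec (odd_at i) (fun x => (cos (x 0 i))%:C%C).
Proof.
have dE (q : int) x : dotr (lattice R (q *: delta_mx 0 i)) x = q%:~R * x 0 i.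
  rewrite /dotr (bigD1 i)//= big1 ?addr0 => [|j ji]; rewrite !mxE eqxx /=.
    by rewrite eqxx mulr1.
  by rewrite (negbTE ji) mulr0 mul0r.
have So (q : int) (r : int) : q = r * 2 + 1 -> odd_at i (q *: delta_mx 0 i).
  move=> qr; split => [j ji|]; first by rewrite !mxE (negbTE ji) andbF mulr0.
  by exists r; rewrite !mxE !eqxx mulr1.
have -> : (fun x : 'rV[R]_D => (cos (x 0 i))%:C%C : C) = fun x =>
    cis (dotr (lattice R (1 *: delta_mx 0 i)) x) * (2^-1)%:C%C +
    cis (dotr (lattice R (-1 *: delta_mx 0 i)) x) * (2^-1)%:C%C.
  apply/funext => x; rewrite !dE mul1r mulN1r /cis cosN sinN.
  by apply/eqP; rewrite eq_complex /=; apply/andP; split; apply/eqP; field.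
have sp q : odd_at i q -> spec (odd_at i) (fun x => cis (dotr (lattice R q) x) * (2^-1)%:C%C).
  move=> oq; apply: (@spec_mul (odd_at i) (fun l => l = 0)).
  - by move=> a b oa ->; rewrite addr0.
  - exact: spec_cis.
  - exact: spec_cst.
by apply: spec_add; apply: sp; [exact: (So 1 0)|exact: (So (-1) (-1))].
Qed.

Lemma spec_cubic i (f : 'rV[R]_D -> R) : spec (odd_at i) (fun x => (f x)%:C%C) ->
  spec (odd_at i) (fun x => (cubic (f x))%:C%C).
Proof.
move=> sf.
have s3 : spec (odd_at i) (fun x => (f x)%:C%C * (f x)%:C%C * (f x)%:C%C).
  have s2 : spec (even_at i) (fun x => (f x)%:C%C * (f x)%:C%C).
    apply: spec_mul (sf) (sf) => a b [a0 [q aE]] [b0 [r bE]].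
    split=> [j ji|]; first by rewrite mxE a0// b0.
    by exists (q + r + 1); rewrite mxE aE bE; ring.
  apply: spec_mul s2 sf => a b [a0 [q aE]] [b0 [r bE]].
  split=> [j ji|]; first by rewrite mxE a0// b0.
  by exists (q + r); rewrite mxE aE bE; ring.
have scale (c : C) g : spec (odd_at i) g -> spec (odd_at i) (fun x => c * g x).
  move=> sg; apply: (@spec_mul (fun l => l = 0) (odd_at i)) sg.
  - by move=> a b ->; rewrite add0r.
  - exact: spec_cst.
have -> : (fun x => (cubic (f x))%:C%C : C) = fun x =>
    (3 / 2)%:C%C * (f x)%:C%C + (- 2^-1)%:C%C * ((f x)%:C%C * (f x)%:C%C * (f x)%:C%C).
  apply/funext => x; rewrite -!rmorphM -rmorphD; congr (_%:C%C).
  by rewrite /cubic; field.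
by apply: spec_add; apply: scale.
Qed.

Lemma spec_signpol i j : spec (odd_at i) (fun x => (signpol j (cos (x 0 i)))%:C%C).
Proof. by elim: j => [|j IH]; [exact: spec_cos|exact: spec_cubic IH]. Qed.

End spectrum.

Section linear_combination_limits.
Variables (R : realType) (m : nat).
Local Notation C := R[i].

Lemma cvg_euclid_sum (J : Type) (r : seq J) (P : pred J) (a_ : nat -> J -> R) (a : J -> R)
    (V : J -> 'cV[C]_m) :
  (forall q, a_ l q @[l --> \oo] --> a q) ->
  euclid (\sum_(q <- r | P q) (a_ l q)%:C%C *: V q) @[l --> \oo] -->
  euclid (\sum_(q <- r | P q) (a q)%:C%C *: V q).
Proof.
move=> aa.
have b0 : \sum_(q <- r) `|a_ l q - a q| * euclid (V q) @[l --> \oo] --> 0.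
  apply: cvg_sum0 => q; rewrite -[X in _ --> X](mul0r (euclid (V q))).
  by apply: cvgMl; rewrite -(@normr0 R R); apply: cvg_norm; apply/subr_cvg0.
apply/cvgrPdist_le => e e0; have /cvgrPdist_le/(_ e e0) := b0; apply: filterS => l.
rewrite sub0r normrN => /(le_trans (ler_norm _)); apply: le_trans.
rewrite distrC (le_trans (euclidB_le _ _))// -sumrB (le_trans (euclid_sum _ _ _))//.
rewrite big_mkcond/=; apply: ler_sum => q _; case: ifP => _.
  by rewrite -scalerBl -rmorphB euclidZr.
by rewrite mulr_ge0 ?euclid_ge0.
Qed.

Lemma bounded_cvg_integral d (T : measurableType d) (mu : {measure set T -> \bar R})
    (f_ : nat -> T -> R) (f : T -> R) (B : R) : (mu setT < +oo)%E ->
  (forall l, measurable_fun setT (f_ l)) -> measurable_fun setT f ->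
  (forall l x, `|f_ l x| <= B) ->
  (forall x, f_ l x @[l --> \oo] --> f x) ->
  (\int[mu]_x (f_ l x)%:E @[l --> \oo] --> \int[mu]_x (f x)%:E)%E.
Proof.
move=> muT mf_ mf fB ff.
have g1 : mu.-integrable setT (EFin \o (cst B : T -> R)).
  apply: measurable_bounded_integrable => //.
  exists `|B|; split; first exact: num_real.
  by move=> y y1 x _ /=; exact: ltW.
have mf' l : measurable_fun setT (fun x => (f_ l x)%:E) by exact/measurable_EFinP.
have mf'' : measurable_fun setT (fun x => (f x)%:E) by exact/measurable_EFinP.
have cf x : ((f_ l x)%:E @[l --> \oo] --> (f x)%:E)%E.
  by apply: cvg_EFin; [exact: nearW|exact: ff].
have fg x l : (`|(f_ l x)%:E| <= (EFin \o (cst B : T -> R)) x)%E by rewrite lee_fin.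
have [_ _ cv] := @dominated_convergence _ _ R mu setT measurableT (fun l x => (f_ l x)%:E)
  (fun x => (f x)%:E) _ mf' mf'' (aeW mu (fun (x : T) _ => cf x)) g1
  (aeW mu (fun (x : T) n _ => fg x n)).
exact: cv.
Qed.

Lemma le_cvg_scaled (X Y : nat -> \bar R) (c x y : R) :
  (forall l, X l <= c%:E * Y l)%E ->
  (X l @[l --> \oo] --> x%:E)%E -> (Y l @[l --> \oo] --> y%:E)%E -> x <= c * y.
Proof.
move=> XY cX cY; have cY' := cvgeZl (isT : c%:E \is a fin_num) cY.
rewrite -lee_fin EFinM -(cvg_lim (@ereal_hausdorff R) cX) -(cvg_lim (@ereal_hausdorff R) cY').
by apply: lee_lim; [exact: cvgP cX|exact: cvgP cY'|exact: nearW].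
Qed.

End linear_combination_limits.

(** * From polynomials on the torus to averages over signs *)

Section martingale_transfer.
Variables (R : realType) (m N : nat).
Local Notation C := R[i].
Local Notation D := N.+1.
Local Notation tup := (D.-tuple (measurableTypeR R)).
Variable d : forall k : nat, ('I_k -> R) -> 'cV[C]_m.
Implicit Types (s : nat -> R) (A : nat -> 'M[R]_m).

Local Notation J := {k : 'I_D & {ffun 'I_k -> bool}}.

(** At signs this is the indicator that the first [k] of them form the pattern [e]. It is affine in
    each variable, so that it stays a trigonometric polynomial when polynomials in cosines replace
    the signs. *)
Definition weight k (e : {ffun 'I_k -> bool}) s : R :=
  \prod_(i < k) ((1 + (-1) ^+ (e i) * s i) / 2).

Definition coef (q : J) s : R := s (tag q) * weight (tagged q) s.

Definition dval (q : J) : 'cV[C]_m := @d (tag q) (fun i => (-1) ^+ (tagged q i)).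

(* The extension of the martingale sum, with coefficients [A], from the signs to
   all values of [s], affine in each [s k]. *)
Definition msum A s : 'cV[C]_m :=
  \sum_(q : J | (0 < tag q)%N) (coef q s)%:C%C *: (mxC (A (tag q)) *m dval q).

Lemma weight_signs k (e : {ffun 'I_k -> bool}) s : (forall i : 'I_k, s i = 1 \/ s i = -1) ->
  weight e s = (e == [ffun i : 'I_k => s i == -1])%:R.
Proof.
move=> hs; have N11 : (1 == -1 :> R) = false by apply/negbTE; rewrite gt_eqF//; lra.
have E (i : 'I_k) (b : bool) : (1 + (-1) ^+ b * s i) / 2 = (b == (s i == -1))%:R.
  by case: (hs i) => ->; rewrite ?N11 ?eqxx; case: b; rewrite /= ?expr0 ?expr1; field.
rewrite /weight; under eq_bigr do rewrite E.
case: eqP => [->|/eqP ee]; first by rewrite big1// => i _; rewrite ffunE eqxx.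
have /existsP[i ei] : [exists i, e i != (s i == -1)].
  rewrite -negb_forall; apply: contra ee => /forallP ee; apply/eqP/ffunP => i.
  by rewrite ffunE; apply/eqP.
by rewrite (bigD1 i)//= (negbTE ei) mul0r.
Qed.

Lemma msum_signs A s : (forall i, (i < D)%N -> s i = 1 \/ s i = -1) ->
  msum A s = \sum_(1 <= k < D) (s k)%:C%C *: (mxC (A k) *m @d k (fun i => s i)).
Proof.
move=> hs; rewrite big_geq_mkord /=.
have -> : msum A s = \sum_(k < D | (0 < k)%N) \sum_(e : {ffun 'I_k -> bool})
    (coef (Tagged _ e : J) s)%:C%C *: (mxC (A k) *m @d k (fun i => (-1) ^+ (e i))).
  rewrite (sig_big_dep _ (fun _ _ => true)) /=.
  by apply: eq_big => [[k e]|[k e] _] //=; rewrite andbT.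
apply: eq_bigr => k k0.
have hk (i : 'I_k) : s i = 1 \/ s i = -1 by apply: hs; exact: ltn_trans (ltn_ord k).
rewrite (bigD1 [ffun i : 'I_k => s i == -1])//= big1 ?addr0 => [|e ee].
  rewrite /coef /= weight_signs// eqxx mulr1; congr (_ *: (_ *m d _)).
  apply/funext => i; rewrite ffunE; case: (hk i) => ->; last by rewrite eqxx expr1.
  by rewrite (_ : _ == _ = false) ?expr0//; apply/negbTE; rewrite gt_eqF//; lra.
by rewrite /coef /= weight_signs// (negbTE ee) mulr0 scale0r.
Qed.

Lemma eq_msum A s s' : (forall i, (i < D)%N -> s i = s' i) -> msum A s = msum A s'.
Proof.
move=> ss; apply: eq_bigr => -[k e] _; congr (_%:C%C *: _); rewrite /coef /= ss//.
congr (_ * _); apply: eq_bigr => i _; rewrite ss//.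
exact: ltn_trans (ltn_ord i) (ltn_ord k).
Qed.

Lemma coef_bound (q : J) s : (forall i, `|s i| <= 1) -> `|coef q s| <= 1.
Proof.
move=> s1; rewrite normrM mulr_ile1//.
have f01 (b : bool) i : 0 <= (1 + (-1) ^+ b * s i) / 2 <= 1.
  have := s1 i; rewrite ler_norml => /andP[h1 h2].
  by case: b; rewrite ?expr0 ?expr1; apply/andP; split; lra.
rewrite /weight ger0_norm; last by apply: prodr_ge0 => i _; case/andP: (f01 (tagged q i) i).
by apply: prodr_ile1 => i _; exact: f01.
Qed.

Lemma coef_cvg (q : J) (s_ : nat -> nat -> R) s :
  (forall i, s_ l i @[l --> \oo] --> s i) -> coef q (s_ l) @[l --> \oo] --> coef q s.
Proof.
move=> ss; apply: cvgM; first exact: ss.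
apply: cvg_big => [|i _]; first exact: mul_continuous.
apply: cvgMl; apply: cvgD; first exact: cvg_cst.
by apply: cvgMr; exact: ss.
Qed.

(** Indexed by [nat] like sequences of signs; beyond the dimension [inord] falls back to coordinate
    0, and [msum] reads only the indices below [D]. *)
Definition approx_signs (l : nat) (x : 'rV[R]_D) : nat -> R :=
  fun k => signpol l (cos (x 0 (inord k))).

(** The factor at [k] has odd frequencies in coordinate [k], and the weight involves earlier
    coordinates only. The top index of a frequency is therefore the time whose coefficient matrix
    acts on it. *)
Lemma spec_coef l (q : J) :
  spec (topped (tag q)) (fun x => (coef q (approx_signs l x))%:C%C).
Proof.
case: q => k e; rewrite /coef /=.
have kE : inord k = k :> 'I_D by rewrite inord_val.
rewrite (_ : (fun x => _) = fun x : 'rV[R]_D => (signpol l (cos (x 0 k)))%:C%C *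
    \prod_(i < k) (2^-1%:C%C + ((-1) ^+ (e i) / 2)%:C%C *
      (signpol l (cos (x 0 (inord i))))%:C%C)); last first.
  apply/funext => x; rewrite rmorphM /approx_signs kE rmorph_prod; congr (_ * _).
  apply: eq_bigr => i _; rewrite -rmorphM -rmorphD; congr (_%:C%C).
  by move: ((-1) ^+ _) (signpol _ _) => u v; field.
apply: (spec_mul (@odd_at_below_topped _ k)); first exact: spec_signpol.
have b0 : below k (0 : 'rV[int]_D) by move=> j _; rewrite mxE.
have bD (a b : 'rV[int]_D) : below k a -> below k b -> below k (a + b).
  by move=> a0 b0' j kj; rewrite mxE a0 ?b0'.
apply: spec_prod => // i _; apply: spec_add; first exact: spec_cst.
apply: (spec_mul bD); first exact: spec_cst.
apply: spec_sub (spec_signpol R (inord i) l) => z.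
by apply: odd_at_below; rewrite inordK// (ltn_trans (ltn_ord i))// ltn_ord.
Qed.

(** One list serves all [A], because the coefficient matrix depends only on the top index. The sums
    with the matrices [M (v k)] and with the identity thus have the same frequencies and the same
    vectors. *)
Lemma spec_family (r : seq J) (f : J -> 'rV[R]_D -> C) :
  (forall q, spec (topped (tag q)) (f q)) ->
  exists LL : seq ('I_D * ('rV[int]_D * 'cV[C]_m)),
    (forall w, w \in LL -> topped w.1 w.2.1 /\ w.1 \in map tag r) /\
    forall A x, \sum_(q <- r) f q x *: (mxC (A (tag q)) *m dval q) =
      \sum_(w <- LL) cis (dotr (lattice R w.2.1) x) *: (mxC (A w.1) *m w.2.2).
Proof.
move=> sf; elim: r => [|q r [LL [tLL eLL]]].
  by exists [::]; split => [w|A x]; rewrite ?inE ?big_nil.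
have [L LS fE] := sf q.
exists ([seq (tag q, (z.1, z.2 *: dval q)) | z <- L] ++ LL); split => [w|A x].
  rewrite mem_cat => /orP[/mapP[z zL ->]|/tLL[h1 h2]]; last by rewrite inE h2 orbT.
  by split; [exact: LS|rewrite inE eqxx].
rewrite big_cons big_cat eLL big_map fE; congr (_ + _).
by rewrite scaler_suml; apply: eq_bigr => z _; rewrite -scalemxAr scalerA.
Qed.

Definition msum_powR (p : R) A s : R := euclid (msum A s) `^ p.

Section transfer.
Variables (n : nat) (p K : R) (M : 'rV[R]_n -> 'M[R]_m).
Hypothesis hp : 1 < p.
Hypothesis Mcont : forall i j xi, xi != 0 -> {for xi, continuous (fun x => M x i j)}.
Hypothesis Mhom : forall (l : R) xi, 0 < l -> xi != 0 -> M (l *: xi) = M xi.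
Hypothesis Meven : forall xi, M (- xi) = M xi.
Hypothesis disc_bound : forall (I : finType) (k : I -> 'rV[int]_n) (c : I -> 'cV[C]_m),
  (intp (torus R n) p (trigf k (fun i => mxC (M (lattice R (k i))) *m c i) \o @row_of R n) <=
   (K `^ p)%:E * intp (torus R n) p (trigf k c \o @row_of R n))%E.
Variable v : nat -> 'rV[R]_n.
Hypothesis v0 : forall k, (0 < k < D)%N -> v k != 0.

Let p_gt0 : 0 < p. Proof. exact: lt_trans hp. Qed.

Let msum_trigf l : exists (I : finType) (z : I -> 'rV[int]_D) (top : I -> 'I_D) (c : I -> 'cV[C]_m),
  (forall i, topped (top i) (z i) /\ v (top i) != 0) /\
  forall A x, msum A (approx_signs l x) = trigf (R := R) z (fun i => mxC (A (top i)) *m c i) x.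
Proof.
have [LL [tLL eLL]] := spec_family [seq q : J <- index_enum J | (0 < tag q)%N] (spec_coef l).
exists 'I_(size LL), (fun i => (tnth (in_tuple LL) i).2.1),
  (fun i => (tnth (in_tuple LL) i).1), (fun i => (tnth (in_tuple LL) i).2.2).
split=> [i|A x].
  have [h1 h2] := tLL _ (mem_tnth i (in_tuple LL)); split => //.
  have /mapP[q + ->] := h2.
  by rewrite mem_filter => /andP[q0 _]; apply: v0; rewrite q0 ltn_ord.
by rewrite /trigf -(big_tnth _ _ LL xpredT
  (fun w => cis (dotr (lattice R w.2.1) x) *: (mxC (A w.1) *m w.2.2))) -eLL big_filter.
Qed.

Let measurable_msum l A :
  measurable_fun [set: tup] (fun t : tup => msum_powR p A (approx_signs l (row_of t))).
Proof.
have [I [z [top [c [_ E]]]]] := msum_trigf l.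
apply: (measurableT_comp (measurable_powR p)).
by under eq_fun do rewrite E; exact: measurable_euclid_trigf.
Qed.

Let approx_transfer l :
  (\int[torus R D]_t (msum_powR p (fun k => M (v k)) (approx_signs l (row_of t)))%:E <=
   (K `^ p)%:E * \int[torus R D]_t (msum_powR p (fun=> 1%:M) (approx_signs l (row_of t)))%:E)%E.
Proof.
have [I [z [top [c [zt E]]]]] := msum_trigf l.
have E1 : (\int[torus R D]_t (msum_powR p (fun k => M (v k)) (approx_signs l (row_of t)))%:E =
    intp (torus R D) p (trigf z (fun i => mxC (M (v (top i))) *m c i) \o @row_of R D))%E.
  by apply: eq_integral => t _; rewrite /msum_powR E.
have E2 : (\int[torus R D]_t (msum_powR p (fun=> 1%:M) (approx_signs l (row_of t)))%:E =
    intp (torus R D) p (trigf z c \o @row_of R D))%E.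
  apply: eq_integral => t _; rewrite /msum_powR E; congr ((euclid _ `^ p)%:E).
  by apply: eq_bigr => i _; rewrite /mxC map_mx1 mul1mx.
have z1 i : z i 0 (top i) != 0 by case: (zt i) => -[].
have z2 i (j : 'I_D) : (top i < j)%N -> z i 0 j = 0 by case: (zt i) => -[_ h] _; exact: h.
have z3 i : v (top i) != 0 by case: (zt i).
have H := @top_index_transfer R n m p K M hp Mcont Mhom Meven disc_bound
  D I z top (fun i : 'I_D => v i) z1 z2 z3 c.
exact: (eq_ind_r (fun X => X <= _)%E (eq_ind_r (fun Y => _ <= _ * Y)%E H E2) E1).
Qed.

(** Bounded convergence: the polynomials stay in [[-1, 1]] and tend pointwise to the signs of the
    cosines, and the limiting integral depends only on the distribution of these signs. *)
Let approx_cvg A :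
  (\int[torus R D]_t (msum_powR p A (approx_signs l (row_of t)))%:E @[l --> \oo] --> (sign_avg D (msum_powR p A))%:E)%E.
Proof.
have F0 s : 0 <= msum_powR p A s by exact: powR_ge0.
rewrite -(integral_torus_signs D F0).
pose B := (\sum_(q : J | (0 < tag q)%N) euclid (mxC (A (tag q)) *m dval q)) `^ p.
pose sg (t : tup) := strunc D (fun k => csign (nth 0 t k)).
have sgE (t : tup) i : (i < D)%N -> sg t i = Num.sg (cos (row_of t 0 (inord i))).
  by move=> iD; rewrite /sg /strunc iD mxE (tnth_nth 0) inordK.
have E (t : tup) : msum_powR p A (sg t) = msum_powR p A (fun i => Num.sg (cos (row_of t 0 (inord i)))).
  by congr (euclid _ `^ p); apply: eq_msum => i /sgE.
have cv (t : tup) : msum_powR p A (approx_signs l (row_of t)) @[l --> \oo] --> msum_powR p A (sg t).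
  rewrite E; apply: powR_cvg; [exact: ltW|by move=> l; exact: euclid_ge0|].
  apply: cvg_euclid_sum => q; apply: coef_cvg => i.
  by apply: signpol_cvg; exact: cos_max.
apply: (@bounded_cvg_integral R _ _ (torus R D) _ (fun t => msum_powR p A (sg t)) B).
- by rewrite [X in (X < _)%E](torus_setT R D) ltry.
- by move=> l; exact: measurable_msum.
- by apply: (measurable_fun_cvg (fun l => measurable_msum l A)) => t _; exact: cv.
- move=> l t; rewrite ger0_norm//; apply: ge0_ler_powR; rewrite ?nnegrE ?euclid_ge0 ?(ltW p_gt0)//.
    by apply: sumr_ge0 => q _; exact: euclid_ge0.
  rewrite /msum (le_trans (euclid_sum _ _ _))//; apply: ler_sum => q _.
  rewrite euclidZr ler_piMl ?euclid_ge0// coef_bound// => i.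
  by apply: signpol_norm_le1; exact: cos_max.
- exact: cv.
Qed.

Lemma sign_avg_transfer :
  sign_avg D (msum_powR p (fun k => M (v k))) <= K `^ p * sign_avg D (msum_powR p (fun=> 1%:M)).
Proof.
exact: (le_cvg_scaled approx_transfer (@approx_cvg (fun k => M (v k))) (@approx_cvg (fun=> 1%:M))).
Qed.

End transfer.

End martingale_transfer.

(** * Martingale transforms *)

Lemma powR_root_le (R : realType) (p K X Y : R) : 0 < p -> 0 <= K -> 0 <= X -> 0 <= Y ->
  X <= K `^ p * Y -> X `^ p^-1 <= K * Y `^ p^-1.
Proof.
move=> p0 K0 X0 Y0 XY; apply: (@le_trans _ _ ((K `^ p * Y) `^ p^-1)).
  by apply: ge0_ler_powR; rewrite ?nnegrE ?invr_ge0 ?mulr_ge0 ?powR_ge0 ?(ltW p0).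
by rewrite powRM ?powR_ge0// -powRrM mulfV ?gt_eqF// powRr1.
Qed.

Section rademacher_sums.
Variables (R : realType) (m N : nat).
Local Notation C := R[i].
Local Notation D := N.+1.
Variable d : forall k : nat, ('I_k -> R) -> 'cV[C]_m.
Implicit Types (s : nat -> R) (A : nat -> 'M[R]_m) (t : measurableTypeR R).

Let sign_sum A s : 'cV[C]_m :=
  \sum_(1 <= k < D) (s k)%:C%C *: (mxC (A k) *m @d k (fun i => s i)).

Definition mart A t : 'cV[C]_m := sign_sum A (fun k => rademacher k t).

Let sign_sum_strunc A s : sign_sum A (strunc D s) = sign_sum A s.
Proof.
apply: eq_big_nat => k /andP[_ kD]; rewrite /strunc kD; congr (_ *: (_ *m d _)).
by apply/funext => i; rewrite (ltn_trans (ltn_ord i) kD).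
Qed.

Let rademacher_pm k t : rademacher k t = 1 \/ rademacher k t = -1.
Proof.
rewrite /rademacher -signr_odd; case: odd; [by right; rewrite expr1|by left; rewrite expr0].
Qed.

Lemma Cmeasurable_mart A j : Cmeasurable (fun t => mart A t j 0).
Proof.
have E t : mart A t = sign_sum A (strunc D (fun k => rademacher k t)) by rewrite sign_sum_strunc.
split; under eq_fun do rewrite E.
- apply: (@measurable_signs R _ _ (fun k => rademacher k) D (fun s => complex.Re (sign_sum A s j 0))).
  + exact: measurable_rademacher.
  + exact: rademacherP.
- apply: (@measurable_signs R _ _ (fun k => rademacher k) D (fun s => complex.Im (sign_sum A s j 0))).
  + exact: measurable_rademacher.
  + exact: rademacherP.
Qed.

Lemma intp_mart (p : R) A :
  intp (unit_itv_measure R) p (mart A) = (sign_avg D (msum_powR N d p A))%:E.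
Proof.
rewrite -integral_rademacher; last by move=> s; exact: powR_ge0.
apply: eq_integral => t _; congr ((euclid _ `^ p)%:E).
rewrite (@eq_msum R m N d A _ (fun k => rademacher k t)); last by move=> i iD; rewrite /strunc iD.
by rewrite msum_signs// => i _; exact: rademacher_pm.
Qed.

Lemma LpNorm_mart (p : R) A : 0 < p ->
  LpNorm (unit_itv_measure R) p (mart A) = (sign_avg D (msum_powR N d p A) `^ p^-1)%:E.
Proof. by move=> p0; rewrite LpNormE// intp_mart poweR_EFin. Qed.

Section bounds.
Variables (n : nat) (p K : R) (M : 'rV[R]_n -> 'M[R]_m).
Hypotheses (hp : 1 < p) (K0 : 0 <= K).
Hypothesis Mcont : forall i j xi, xi != 0 -> {for xi, continuous (fun x => M x i j)}.
Hypothesis Mhom : forall (l : R) xi, 0 < l -> xi != 0 -> M (l *: xi) = M xi.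
Hypothesis Meven : forall xi, M (- xi) = M xi.
Hypothesis disc_bound : forall (I : finType) (k : I -> 'rV[int]_n) (c : I -> 'cV[C]_m),
  (intp (torus R n) p (trigf k (fun i => mxC (M (lattice R (k i))) *m c i) \o @row_of R n) <=
   (K `^ p)%:E * intp (torus R n) p (trigf k c \o @row_of R n))%E.
Hypothesis M0 : averaged_at_0 M.

Let p_gt0 : 0 < p. Proof. exact: lt_trans hp. Qed.

Definition mart_norm : R := sign_avg D (msum_powR N d p (fun=> 1%:M)) `^ p^-1.

Let mart_bound_neq0 (v : nat -> 'rV[R]_n) : (forall k, (k < D)%N -> v k != 0) ->
  (LpNorm (unit_itv_measure R) p (mart (fun k => M (v k))) <= (K * mart_norm)%:E)%E.
Proof.
move=> v0; rewrite LpNorm_mart// lee_fin.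
have S0 : 0 <= sign_avg D (msum_powR N d p (fun=> 1%:M)).
  by apply: sign_avg_ge0 => s; exact: powR_ge0.
have S1 : 0 <= sign_avg D (msum_powR N d p (fun k => M (v k))).
  by apply: sign_avg_ge0 => s; exact: powR_ge0.
have H := @sign_avg_transfer R m N d n p K M hp Mcont Mhom Meven disc_bound v
  (fun k h => v0 k (proj2 (andP h))).
exact: (powR_root_le p_gt0 K0 S1 S0 H).
Qed.

Lemma mart_bound (v : nat -> 'rV[R]_n) :
  (LpNorm (unit_itv_measure R) p (mart (fun k => M (v k))) <= (K * mart_norm)%:E)%E.
Proof.
have [s [w [xi [w0 w1 xi0 ME]]]] := M0.
(* [j] counts the leading indices at which [v] may still vanish. *)
suff H j : forall v, (forall k, (j <= k < D)%N -> v k != 0) ->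
    (LpNorm (unit_itv_measure R) p (mart (fun k => M (v k))) <= (K * mart_norm)%:E)%E.
  by apply: (H D) => k /andP[/leq_ltn_trans h /h]; rewrite ltnn.
elim: j => [|j IH] {}v v0; first by apply: mart_bound_neq0 => k kD; exact: v0.
have [vj0|vj0] := eqVneq (v j) 0; last first.
  apply: IH => k /andP[jk kD]; have [<-//|kj] := eqVneq j k.
  by apply: v0; rewrite kD andbT ltn_neqAle kj.
pose v' i k := if k == j then xi i else v k.
have E : mart (fun k => M (v k)) = fun t => \sum_i (w i)%:C%C *: mart (fun k => M (v' i k)) t.
  apply/funext => t; rewrite /mart /sign_sum.
  under [RHS]eq_bigr do rewrite scaler_sumr.
  rewrite exchange_big /=; apply: eq_bigr => k _.
  have -> : mxC (M (v k)) = \sum_i (w i)%:C%C *: mxC (M (v' i k)).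
    rewrite /v'; case: eqP => [->|_].
      rewrite vj0 ME; apply/matrixP => a b; rewrite mxE !summxE rmorph_sum.
      by apply: eq_bigr => i _; rewrite !mxE rmorphM.
    by rewrite -scaler_suml -rmorph_sum w1 scale1r.
  rewrite mulmx_suml scaler_sumr; apply: eq_bigr => i _.
  by rewrite -scalemxAl !scalerA mulrC.
rewrite E (_ : K * mart_norm = \sum_i w i * (K * mart_norm)); last first.
  by rewrite -mulr_suml w1 mul1r.
apply: LpNorm_convex => //; first exact: ltW.
- by move=> i a; exact: Cmeasurable_mart.
- move=> i; apply: IH => k /andP[jk kD]; rewrite /v'; have [_|kj] := eqVneq k j; first exact: xi0.
  by apply: v0; rewrite kD andbT ltn_neqAle eq_sym kj.
Qed.

Lemma mart1E : mart (fun=> 1%:M) = martingale_sum N (fun=> 1) d.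
Proof.
apply/funext => t; rewrite /mart /sign_sum /martingale_sum.
by apply: eq_bigr => k _; rewrite /mxC map_mx1 mul1mx mul1r.
Qed.

Lemma LpNorm_martingale1 :
  LpNorm (unit_itv_measure R) p (martingale_sum N (fun=> 1) d) = mart_norm%:E.
Proof. by rewrite -mart1E LpNorm_mart. Qed.

Lemma LpNorm_martingale_scaled (v : nat -> 'rV[R]_n) (delta : nat -> R) (U : 'M[C]_m) :
  U \is unitarymx -> (forall k, mxC (M (v k)) = (delta k)%:C%C *: U) ->
  (LpNorm (unit_itv_measure R) p (martingale_sum N delta d) <= (K * mart_norm)%:E)%E.
Proof.
move=> hU MU; apply: le_trans (mart_bound v).
rewrite le_eqVlt; apply/orP; left; apply/eqP; apply: eq_LpNorm => t.
rewrite -(euclid_unitary _ hU) /mart /sign_sum /martingale_sum mulmx_sumr; congr euclid.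
apply: eq_bigr => k _; rewrite MU -scalemxAr -scalemxAl scalerA -rmorphM.
by rewrite mulrC.
Qed.

Lemma Cmeasurable_martingale_sum (beta : nat -> R) j :
  Cmeasurable (fun t => martingale_sum N beta d t j 0).
Proof.
rewrite (_ : (fun t => _) = fun t => mart (fun k => (beta k)%:M) t j 0); first exact: Cmeasurable_mart.
apply/funext => t; rewrite /mart /sign_sum /martingale_sum !summxE.
apply: eq_bigr => k _; rewrite (_ : mxC _ = (beta k)%:C%C%:M); last by rewrite /mxC map_scalar_mx.
by rewrite mul_scalar_mx scalerA -rmorphM mulrC.
Qed.

Lemma martingale_transform_bound (vp vm : 'rV[R]_n) (U : 'M[C]_m) (dp dm : R) (beta : nat -> R) :
  U \is unitarymx -> dm < dp -> mxC (M vp) = dp%:C%C *: U -> mxC (M vm) = dm%:C%C *: U ->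
  (forall k, beta k = 1 \/ beta k = -1) -> mart_norm != 0 ->
  (LpNorm (unit_itv_measure R) p (martingale_sum N beta d) <=
   (K * (2 / (dp - dm) * (1 + `|dp + dm| / (`|dp| + `|dm|))) * mart_norm)%:E)%E.
Proof.
move=> hU hd hvp hvm hb X0.
have Xge0 : 0 <= mart_norm by exact: powR_ge0.
have X_gt0 : 0 < mart_norm by rewrite lt0r X0.
have dd : 0 < dp - dm by rewrite subr_gt0.
(* With all directions equal, the transform is multiplication by [e] up to a unitary factor, and the
   norm of the sum is positive, so it can be cancelled. *)
have cst_bound v e : mxC (M v) = e%:C%C *: U -> `|e| <= K.
  move=> hv; have := @LpNorm_martingale_scaled (fun=> v) (fun=> e) U hU (fun=> hv).
  rewrite (_ : martingale_sum N (fun=> e) d = fun t => e%:C%C *: martingale_sum N (fun=> 1) d t); last first.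
    apply/funext => t; rewrite /martingale_sum scaler_sumr; apply: eq_bigr => k _.
    by rewrite scalerA -rmorphM mul1r.
  rewrite LpNormZ//; last by move=> j; exact: Cmeasurable_martingale_sum.
  by rewrite LpNorm_martingale1 /cnorm sqn_real sqrtr_sqr -EFinM lee_fin ler_pM2r.
have Kp := cst_bound _ _ hvp; have Km := cst_bound _ _ hvm.
pose delta k := if beta k == 1 then dp else dm.
pose v k := if beta k == 1 then vp else vm.
have Hd : (LpNorm (unit_itv_measure R) p (martingale_sum N delta d) <= (K * mart_norm)%:E)%E.
  apply: (@LpNorm_martingale_scaled v delta U hU) => k.
  by rewrite /v /delta; case: eqP.
(* The solution of [c1 dp + c2 = 1] and [c1 dm + c2 = -1], so that [beta = c1 delta + c2] at every
   time. *)
pose c1 := 2 / (dp - dm); pose c2 := - ((dp + dm) / (dp - dm)).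
have E : martingale_sum N beta d = fun t =>
    c1%:C%C *: martingale_sum N delta d t + c2%:C%C *: martingale_sum N (fun=> 1) d t.
  apply/funext => t; rewrite /martingale_sum !scaler_sumr -big_split /=.
  apply: eq_bigr => k _; rewrite !scalerA -!rmorphM -scalerDl -rmorphD; congr (_%:C%C *: _).
  rewrite /c1 /c2 /delta mul1r; have [bE|bE] := hb k.
    by rewrite bE eqxx; field; rewrite subr_eq0 gt_eqF.
  rewrite bE (_ : -1 == 1 = false); last by apply/negbTE; rewrite lt_eqF//; lra.
  by field; rewrite subr_eq0 gt_eqF.
have c10 : 0 < c1 by rewrite divr_gt0.
have m1 b j : Cmeasurable (fun t => martingale_sum N b d t j 0) by exact: Cmeasurable_martingale_sum.
rewrite E; apply: le_trans (LpNormD (unit_itv_measure R) (ltW hp) _ _) _.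
- by apply: Cmeasurable_scale.
- by apply: Cmeasurable_scale.
rewrite !LpNormZ// LpNorm_martingale1 /cnorm !sqn_real !sqrtr_sqr.
apply: le_trans (_ : ((`|c1| * (K * mart_norm))%:E + (`|c2| * mart_norm)%:E <= _)%E).
  rewrite [in leRHS]EFinM; apply: leeD => //; apply: lee_wpmul2l => //; rewrite lee_fin//.
rewrite -EFinD lee_fin mulrA -mulrDl ler_wpM2r// (gtr0_norm c10) /c2 normrN normrM normfV (gtr0_norm dd).
rewrite mulrCA mulrDr mulr1 mulrDr mulrC -/c1 lerD2l /c1.
have s0 : 0 < `|dp| + `|dm|.
  rewrite lt0r addr_ge0// andbT; apply/eqP => h.
  have := normr_ge0 dp; have := normr_ge0 dm => h1 h2.
  have /eqP : `|dp| = 0 by lra.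
  have /eqP : `|dm| = 0 by lra.
  by rewrite !normr_eq0 => /eqP h3 /eqP h4; move: hd; rewrite h3 h4 ltxx.
(* The second summand of the constant is [|c2|] times [2 K / (|dp| + |dm|)], and this factor is at
   least 1 by [Kp] and [Km]. *)
have -> : 2 / (dp - dm) * (K * (`|dp + dm| / (`|dp| + `|dm|))) =
    (2 * K / (`|dp| + `|dm|)) * (`|dp + dm| / (dp - dm)).
  by move: (dp - dm) dd (`|dp| + `|dm|) s0 => x x0 y y0; field; rewrite !gt_eqF.
rewrite ler_peMl ?divr_ge0 ?(ltW dd)// ler_pdivlMr// mul1r; lra.
Qed.

End bounds.

End rademacher_sums.

(** * The norm of the discrete operator for equal exponents *)

Section discrete_multiplier.
Variables (R : realType) (n m : nat) (p : R) (M : 'rV[R]_n -> 'M[R]_m).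
Hypotheses (hm : (0 < m)%N) (hp : 1 < p).
Local Notation C := R[i].
Local Notation tup := (n.-tuple (measurableTypeR R)).

Let p_gt0 : 0 < p. Proof. exact: lt_trans hp. Qed.

Lemma trigf_trig (I : finType) (k : I -> 'rV[int]_n) (c : I -> 'cV[C]_m) :
  trigf (R := R) k c = trig [seq (k i, c i) | i <- index_enum I].
Proof. by apply/funext => x; rewrite /trig big_map. Qed.

(** A nonzero constant polynomial shows that the supremum is not over the empty set, where it would
    be [-oo]. *)
Lemma disc_mult_norm_ge0 : (0 <= disc_mult_norm p p M)%E.
Proof.
pose v : 'cV[C]_m := const_mx 1.
pose f := trigf (R := R) (fun _ : 'I_1 => 0 : 'rV[int]_n) (fun=> v).
have v0 : euclid v != 0.
  apply/eqP => /euclid_eq0/colP/(_ (Ordinal hm)).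
  by rewrite !mxE => /eqP; rewrite oner_eq0.
have nf : norm_Tn p f != 0%E.
  rewrite /norm_Tn LpNorm_torus// LpNorm_eq0_intp// /intp.
  under eq_integral do rewrite /comp /f /trigf big_ord1 euclid_cis.
  rewrite integral_cst// [X in (_ * X)%E](torus_setT R n) mule1 eqe.
  by rewrite powR_eq0 (negbTE v0).
apply: le_trans (LpNorm_ratio_ge0 (torus_measure R n) (torus_measure R n) p p
  (disc_mult_op M f \o @row_of R n) (f \o @row_of R n)) _.
apply: ereal_sup_ubound; exists f => //; split => //.
by apply/trig_polyP; rewrite /f trigf_trig; eexists.
Qed.

Hypothesis disc_lty : (disc_mult_norm p p M < +oo)%E.

Lemma disc_mult_norm_bound (I : finType) (k : I -> 'rV[int]_n) (c : I -> 'cV[C]_m) :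
  (intp (torus R n) p (trigf k (fun i => mxC (M (lattice R (k i))) *m c i) \o @row_of R n) <=
   (fine (disc_mult_norm p p M) `^ p)%:E * intp (torus R n) p (trigf k c \o @row_of R n))%E.
Proof.
have fin : disc_mult_norm p p M \is a fin_num by rewrite ge0_fin_numE ?disc_mult_norm_ge0.
have K0 : 0 <= fine (disc_mult_norm p p M) by rewrite fine_ge0 ?disc_mult_norm_ge0.
have opE : disc_mult_op M (trigf (R := R) k c) =
    trigf (R := R) k (fun i => mxC (M (lattice R (k i))) *m c i).
  by rewrite !trigf_trig disc_mult_opE -map_comp.
(* A polynomial of norm 0 gives no quotient in the operator norm; its Fourier coefficients vanish,
   and with them its image. *)
rewrite -opE; have [i0|i0] := eqVneq (intp (torus R n) p (trigf k c \o @row_of R n)) 0%E.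
  have -> : disc_mult_op M (trigf (R := R) k c) = fun=> 0.
    apply/funext => x; rewrite /disc_mult_op; apply: fsbig1 => l _.
    rewrite (_ : fourier_coef _ _ = 0) ?mulmx0 ?scaler0//; apply/colP => j.
    rewrite !mxE Cintegral_torus_measure; apply: (intp_eq0_Cintegral (p := p)) i0 => //.
      by move=> j'; exact: Cmeasurable_trigf.
    by apply: Cmeasurable_cis; apply: measurable_funN; exact: measurable_dotr.
  rewrite i0 mule0 /intp (_ : (fun x => _) = cst 0%E) ?integral0//.
  by apply/funext => u /=; rewrite euclid0 powR0// gt_eqF.
have NP := LpNorm_trigf_fin k c p_gt0.
have nT : norm_Tn p (trigf (R := R) k c) = LpNorm (torus R n) p (trigf k c \o @row_of R n).
  by rewrite /norm_Tn LpNorm_torus.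
have Nfin : LpNorm (torus R n) p (trigf k c \o @row_of R n) \is a fin_num.
  by rewrite ge0_fin_numE ?LpNorm_ge0.
have N0 : LpNorm (torus R n) p (trigf k c \o @row_of R n) != 0%E by rewrite LpNorm_eq0_intp.
have : (norm_Tn p (disc_mult_op M (trigf (R := R) k c)) <=
    disc_mult_norm p p M * norm_Tn p (trigf (R := R) k c))%E.
  rewrite -lee_pdivrMr_fin ?LpNorm_ge0 ?nT//; apply: ereal_sup_ubound.
  exists (trigf (R := R) k c); last by rewrite nT.
  by split; [apply/trig_polyP; rewrite trigf_trig; eexists|rewrite nT].
have L0 : 0 <= fine (LpNorm (torus R n) p (trigf k c \o @row_of R n)) by rewrite fine_ge0 ?LpNorm_ge0.
rewrite nT -[X in (_ <= X * _)%E -> _](fineK fin) -[X in (_ <= _ * X)%E -> _](fineK Nfin) -EFinM.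
rewrite /norm_Tn LpNorm_torus// LpNorm_le_intp ?mulr_ge0//.
have iE : intp (torus R n) p (trigf k c \o @row_of R n) =
    (fine (LpNorm (torus R n) p (trigf k c \o @row_of R n)) `^ p)%:E.
  by rewrite -LpNorm_intp// -[in LHS](fineK Nfin) poweR_EFin.
by rewrite (powRM _ K0 L0) EFinM iE.
Qed.

End discrete_multiplier.

Theorem theorem14 (R : realType) (n m : nat) (hn : (0 < n)%N) (hm : (0 < m)%N)
  (p p0 : R) (hp0 : 1 < p0) (hp0p : p0 <= p)
  (M : 'rV[R]_n -> 'M[R]_m) (hM : is_multiplier p p0 M) (hM0 : averaged_at_0 M)
  (vp vm : 'rV[R]_n) (U : 'M[R[i]]_m) (hU : U \is unitarymx)
  (dp dm : R) (hd : dm < dp)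
  (hvp : mxC (M vp) = dp%:C%C *: U) (hvm : mxC (M vm) = dm%:C%C *: U) :
  (disc_mult_norm p p0 M <= mult_norm p p0 M)%E /\
  (UMD m p p0 / (2 / (dp - dm) * (1 + `|dp + dm| / (`|dp| + `|dm|)))%:E
     <= disc_mult_norm p p0 M)%E.
Proof.
have le1 := disc_mult_norm_le hn hm hp0 hp0p hM hM0; split; first by [].
have [pE|plt] := eqVneq p0 p; last first.
  (* [M] vanishes identically here, whereas a column of [U] is nonzero because [U] preserves the
     norm of a basis vector; hence [dp = dm = 0], against [dm < dp]. *)
  have Mz := averaged_at_0_eq0 hM0 (fun xi h => mult_eq0_lt hn hm hp0 hp0p hM _ h).
  exfalso; have plt' : p0 < p by rewrite lt_neqAle plt.
  have Uj : col (Ordinal hm) U != 0.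
    apply/eqP => U0; have := euclid_unitary (delta_mx (Ordinal hm) 0) hU.
    rewrite -colE U0 euclid0 => /esym/euclid_eq0/colP/(_ (Ordinal hm)).
    by rewrite !mxE !eqxx => /eqP; rewrite oner_eq0.
  have d0 v (e : R) : mxC (M v) = e%:C%C *: U -> e = 0.
    move=> hv; have : e%:C%C *: col (Ordinal hm) U = 0.
      apply/colP => i; have /matrixP/(_ i (Ordinal hm)) := hv.
      by rewrite !mxE Mz// mxE => <-.
    by move=> /eqP; rewrite scaler_eq0 (negbTE Uj) orbF => /eqP[].
  by move: hd; rewrite (d0 _ _ hvp) (d0 _ _ hvm) ltxx.
rewrite {}pE in hp0 hM le1 *.
have disc_lty : (disc_mult_norm p p M < +oo)%E.
  by apply: le_lt_trans le1 _; exact: mult_Lp_bounded hM.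
have disc0 := disc_mult_norm_ge0 M hm hp0.
have dfin : disc_mult_norm p p M \is a fin_num by rewrite ge0_fin_numE.
have K0 : 0 <= fine (disc_mult_norm p p M) by rewrite fine_ge0.
set c := 2 / (dp - dm) * _.
have c0 : 0 < c.
  apply: mulr_gt0; first by rewrite divr_gt0// subr_gt0.
  by rewrite ltr_pwDl// divr_ge0// addr_ge0.
rewrite lee_pdivrMr_fin ?lee_fin ?(ltW c0) ?eqe ?gt_eqF ?ltry//.
apply: ge_ereal_sup => _ [N [beta [d [N1 hb X0 ->]]]].
rewrite LpNorm_martingale1// in X0 *.
have X1 : mart_norm N d p != 0 by rewrite -eqe.
rewrite lee_pdivrMr_fin ?ltry ?lee_fin ?powR_ge0//.
rewrite -(fineK dfin) -!EFinM.
exact: (martingale_transform_bound hp0 K0 (mult_continuous hM) (mult_homogeneous hM)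
  (mult_even hM) (disc_mult_norm_bound hm hp0 disc_lty) hM0 hU hd hvp hvm hb X1).
Qed.
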